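(* Let $A_o,B_o\in M(n,\mathbb C)$, and let $\nabla^o$ be the meromorphic connection on the trivial rank $n$ bundle $E^o\to\mathbb P^1$ with matrix of connection 1-forms (in a suitable basis of sections) $\Omega_o=-\left(A_o+\frac1zB_o\right)\mathrm dz$. Assume that one of the following holds: - the pole part $A_o$ is an element of $\mathcal M_{\rm reg}\cap\mathcal M_{\rm diag}$; - the pole part $A_o$ is an element of $\mathcal M_{\rm diag}$ and Property PNR holds for $(A_o,B_o)$. Then $\emptyset\neq\mathfrak I_{\rm d}^{\rm gen}(\nabla^o)\subsetneq\mathfrak I_{\rm fs}(\nabla^o)$.
   Context: Conventions. A connection with matrix of connection 1-forms $\Omega$ in a basis of sections is $\nabla=\mathrm d+\Omega$; a change of basis $G$ replaces $\Omega$ by $G^{-1}\Omega G+G^{-1}\mathrm dG$. For a square matrix $M$, $M'$ is its diagonal part and $M''=M-M'$ its off-diagonal part. $\mathcal M_{\rm reg}\subset M(n,\mathbb C)$ is the set of regular matrices (minimal polynomial equal to characteristic polynomial) and $\mathcal M_{\rm diag}$ the set of diagonalizable matrices (with possibly non-simple spectrum). Property PNR (partial non-resonance): there exists $P\in GL(n,\mathbb C)$ with $P^{-1}A_oP=\Lambda_o=\mathrm{diag}(u_o^1,\dots,u_o^n)$ such that $\mathcal B_o:=P^{-1}B_oP$ satisfies: $(\star)$ $\mathcal B_o''\in\mathrm{Im}\,\mathrm{ad}(\Lambda_o)$, i.e. $(\mathcal B_o)_{ij}=0$ whenever $i\neq j$ and $u_o^i=u_o^j$; $(\star\star)$ $(\mathcal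 B_o)_{ii}-(\mathcal B_o)_{jj}\notin\mathbb Z\setminus\{0\}$ whenever $u_o^i=u_o^j$. Integrable deformations. An integrable deformation $(\nabla,E,X,x_o)$ of $(E^o,\nabla^o)$ consists of a connected complex manifold $X$, a point $x_o\in X$, a holomorphic vector bundle $E$ on $D\times X$ ($D\subseteq\mathbb P^1$ a disc centered at $z=\infty$), and a flat meromorphic connection $\nabla$ on $E$ with a pole of order 2 along $\{\infty\}\times X$, such that $(E,\nabla)$ restricts to $(E^o,\nabla^o)$ at $x_o$. It is a known fact that, if $X$ is simply connected (always the case after shrinking $X$), there are an analytic hypersurface $\Theta\subseteq X\setminus\{x_o\}$ and a unique basis of sections (meromorphic along $D\times \Theta$) with respect to which $\nabla$ has matrix $$\Omega(z,x)=-\left(A(x)+\tfrac1zB_o\right)\mathrm dz-z\,C(x),\qquad x\in X\setminus\Theta,$$ with $A$ a holomorphic matrix function and $C$ a matrix of holomorphic 1-forms on $X\setminus\Theta$ (meromorphic along $\Theta$), $A(x_o)=A_o$, $C(x_o)=0$. $A$ is the pole part and $C$ the deformation part of $\nabla$. Classes of germs (at the base point) of integrable deformations of $\nabla^o$: - $\mathfrak I_{\rm d}^{\rm gen}(\nabla^o)$ (generic d-type): $A$ and $C$ are locally holomorphically diagonalizable at $x_o$ (conjugate to diagonal by a holomorphic invertible matrix defined near $x_o$) and, if $f_1,\dots,f_n$ are the holomorphic eigenvalues of $A$ near $x_o$, then $\mathrm d_{x_o}f_i\neq\mathrm d_{x_o}f_j$ for all $i\neq j$. - $\mathfrak I_{\rm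 fs}(\nabla^o)$ (fs-type, formally simplifiable): there are a neighborhood $U\subseteq X\setminus\Theta$ of $x_o$, holomorphic maps $\Phi_k\colon U\to M(n,\mathbb C)$, $k\geq0$, with $\Phi_0(U)\subseteq GL(n,\mathbb C)$, a holomorphic diagonal matrix $\Delta_0\colon U\to M(n,\mathbb C)$, and a constant diagonal matrix $\mathfrak B_o'\in M(n,\mathbb C)$ such that the formal series $\Phi=\sum_{k\ge0}\Phi_kz^{-k}$ satisfies $\Phi^{-1}\Omega\Phi+\Phi^{-1}\mathrm d\Phi=-\mathrm d(z\Delta_0(x))-\mathfrak B_o'\frac{\mathrm dz}{z}$.
   Formalization: The strict inclusion is stated only for n ≥ 2; for n = 1 it is false, since both classes then contain every integrable deformation (no pairs i ≠ j; Φ = 1, Δ_0 = A). Non-emptiness and inclusion are stated for all n ≥ 1. C(x_o) = 0 is read as a condition on the pullback to x_o. *)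

(* Defs.v *)
From HB Require Import structures.
From mathcomp Require Import all_boot all_order all_algebra.
From mathcomp Require Import complex.
From mathcomp Require Import all_classical all_reals all_analysis.
Set Implicit Arguments.
Unset Strict Implicit.
Unset Printing Implicit Defensive.
Import Order.TTheory GRing.Theory Num.Theory.
Import numFieldNormedType.Exports.
Local Open Scope classical_set_scope.
Local Open Scope complex_scope.
Local Open Scope ring_scope.

(** The complex field [R[i]], packaged as a [numFieldType] so that it (and the
    matrices over it) carry the normed-module structures of mathcomp-analysis.
    Differentiability over this field is complex differentiability. *)
Definition Cplx (R : realType) : numFieldType := R[i].

(** Meant to be used with [U] open. *)
Definition holomorphic_on (R : realType) (V W : normedModType (Cplx R))
    (U : set V) (f : V -> W) : Prop :=
  forall p, U p -> differentiable f p.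

Definition regular_mx (R : realType) (n : nat) (M : 'M[Cplx R]_n.+1) : Prop :=
  mxminpoly M = char_poly M.

(** Partial non-resonance. *)
Definition PNR (R : realType) (n : nat) (Ao Bo : 'M[Cplx R]_n) : Prop :=
  exists (P : 'M[Cplx R]_n) (u : 'rV[Cplx R]_n),
    let B := invmx P *m Bo *m P in
    [/\ P \in unitmx,
        invmx P *m Ao *m P = diag_mx u,
        (forall i j, i != j -> u 0 i = u 0 j -> B i j = 0)
      & (forall i j, u 0 i = u 0 j ->
           forall m : int, B i i - B j j = m%:~R -> m = 0)].

(** ** Matrix-valued 1-forms

    Throughout, [w = 1/z] is the coordinate of P^1 at infinity and
    [x = (x_1, ..., x_d)] are local coordinates of the parameter manifold.
    A 1-form [F_w dw + sum_i F_i dx_i] is given by its components: [None] stands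
    for [dw] and [Some i] for [dx_i]. *)
Definition mxform (R : realType) (d n : nat) :=
  option 'I_d -> Cplx R * 'rV[Cplx R]_d -> 'M[Cplx R]_n.

Definition coord_vec (R : realType) (d : nat) (a : option 'I_d) :
    Cplx R * 'rV[Cplx R]_d :=
  if a is Some i then (0, delta_mx 0 i) else (1, 0).

Definition gauge (R : realType) (d n : nat)
    (G : Cplx R * 'rV[Cplx R]_d -> 'M[Cplx R]_n) (Om : mxform R d n) :
    mxform R d n :=
  fun a p => invmx (G p) *m Om a p *m G p
             + invmx (G p) *m 'D_(coord_vec R a) G p.

Definition disc (R : realType) (r : Cplx R) : set (Cplx R) :=
  [set w | `|w| < r].

Definition punctured_disc (R : realType) (r : Cplx R) : set (Cplx R) :=
  [set w | `|w| < r /\ w != 0].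

(** Vanishing of [dOm + Om /\ Om] at [p]. *)
Definition flat_at (R : realType) (d n : nat) (Om : mxform R d n)
    (p : Cplx R * 'rV[Cplx R]_d) : Prop :=
  forall a b,
    'D_(coord_vec R a) (Om b) p - 'D_(coord_vec R b) (Om a) p
    + (Om a p *m Om b p - Om b p *m Om a p) = 0.

(** Pole of order (at most) 2 along [w = 0]: [w^2 Om] extends holomorphically. *)
Definition pole_order2 (R : realType) (d n : nat) (r : Cplx R)
    (X : set 'rV[Cplx R]_d) (Om : mxform R d n) : Prop :=
  exists N : mxform R d n,
    (forall a, holomorphic_on (disc r `*` X) (N a)) /\
    (forall a p, (punctured_disc r `*` X) p -> Om a p = p.1 ^- 2 *: N a p).

(** The form [- (A(x) + B/z) dz - z C(x)], with [C = sum_i C_i dx_i], written in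
    the coordinate [w = 1/z], where [dz = - dw / w^2]. *)
Definition normal_form (R : realType) (d n : nat)
    (A : 'rV[Cplx R]_d -> 'M[Cplx R]_n) (B : 'M[Cplx R]_n)
    (C : 'I_d -> 'rV[Cplx R]_d -> 'M[Cplx R]_n) : mxform R d n :=
  fun a p => match a with
             | None => p.1 ^- 2 *: (A p.2 + p.1 *: B)
             | Some i => - (p.1^-1 *: C i p.2)
             end.

(** ** Integrable deformations

    Only germs at the base point matter, so the parameter manifold is a connected
    open subset [X] of C^d (a chart around the base point [xo]; [d] is arbitrary)
    and the bundle on the product of the disc [|w| < r] with [X] is trivialized.
    [conn] is the matrix of the connection in such a trivialization. The
    trivialization is arbitrary: the identification of the restriction at [xo]
    with the connection of matrix [- (Ao + Bo/z) dz] is the change of frame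
    [frame0]. *)
Record integrable_deformation (R : realType) (n : nat)
    (Ao Bo : 'M[Cplx R]_n) := IntegrableDeformation {
  pdim : nat;
  base : set 'rV[Cplx R]_pdim;
  pt : 'rV[Cplx R]_pdim;
  wradius : Cplx R;
  conn : mxform R pdim n;
  frame0 : Cplx R -> 'M[Cplx R]_n;
  base_open : open base;
  base_connected : connected base;
  base_pt : base pt;
  wradius_gt0 : 0 < wradius;
  conn_pole : pole_order2 wradius base conn;
  conn_flat : forall p, (punctured_disc wradius `*` base) p -> flat_at conn p;
  frame0_holo : holomorphic_on (disc wradius) frame0;
  frame0_unit : forall w, disc wradius w -> frame0 w \in unitmx;
  conn_restr : forall w, punctured_disc wradius w ->
    invmx (frame0 w) *m conn None (w, pt) *m frame0 w
    + invmx (frame0 w) *m 'D_1 frame0 w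
    = w ^- 2 *: (Ao + w *: Bo) }.

Arguments pdim {R n Ao Bo} i.
Arguments base {R n Ao Bo} i.
Arguments pt {R n Ao Bo} i.
Arguments wradius {R n Ao Bo} i.
Arguments conn {R n Ao Bo} i.
Arguments frame0 {R n Ao Bo} i.

(** [A] and [C] are the pole part and the deformation part on the open
    neighbourhood [V] of the base point. The condition "C = 0 at the base point"
    concerns the pullback of the 1-form [C] to the point, not its value as a
    covector: it is the requirement that the frame [G] restrict to [frame0],
    which is also what makes the frame unique. *)
Definition is_normal_form (R : realType) (n : nat) (Ao Bo : 'M[Cplx R]_n)
    (E : integrable_deformation Ao Bo) (V : set 'rV[Cplx R]_(pdim E))
    (A : 'rV[Cplx R]_(pdim E) -> 'M[Cplx R]_n)
    (C : 'I_(pdim E) -> 'rV[Cplx R]_(pdim E) -> 'M[Cplx R]_n) : Prop :=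
  [/\ open V, V (pt E) & V `<=` base E] /\
  [/\ holomorphic_on V A, forall i, holomorphic_on V (C i) & A (pt E) = Ao] /\
  exists G : Cplx R * 'rV[Cplx R]_(pdim E) -> 'M[Cplx R]_n,
    [/\ holomorphic_on (disc (wradius E) `*` V) G,
        (forall p, (disc (wradius E) `*` V) p -> G p \in unitmx),
        (forall w, disc (wradius E) w -> G (w, pt E) = frame0 E w)
      & (forall a p, (punctured_disc (wradius E) `*` V) p ->
           gauge G (conn E) a p = normal_form A Bo C a p)].

(** Near [x], the matrices [M i] are all brought to the diagonal form
    [diag (f i)] by one and the same holomorphic invertible matrix. *)
Definition holo_diagonalized_near (R : realType) (d n : nat) (I : Type)
    (x : 'rV[Cplx R]_d) (M : I -> 'rV[Cplx R]_d -> 'M[Cplx R]_n)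
    (f : I -> 'rV[Cplx R]_d -> 'rV[Cplx R]_n) : Prop :=
  exists (W : set 'rV[Cplx R]_d) (G : 'rV[Cplx R]_d -> 'M[Cplx R]_n),
    [/\ open W, W x, holomorphic_on W G & forall y, W y -> G y \in unitmx] /\
    forall i, holomorphic_on W (f i) /\
      forall y, W y -> invmx (G y) *m M i y *m G y = diag_mx (f i y).

Definition generic_dtype (R : realType) (n : nat) (Ao Bo : 'M[Cplx R]_n) :
    set (integrable_deformation Ao Bo) :=
  [set E | exists V A C, is_normal_form V A C /\
    (exists c, holo_diagonalized_near (pt E) C c) /\
    exists f : 'rV[Cplx R]_(pdim E) -> 'rV[Cplx R]_n,
      holo_diagonalized_near (pt E) (fun _ : unit => A) (fun _ => f) /\
      forall i j, i != j ->
        ~ ('d (fun y => f y 0 i) (pt E) =1 'd (fun y => f y 0 j) (pt E))].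

(** ** Formal gauge transformations

    A formal series [sum_k S_k w^k = sum_k S_k z^-k] with matrix coefficients is
    its sequence of coefficients. The components of the 1-forms below have at most
    a double pole in [w]; they are multiplied by [w^2], so as to be series too. *)
Definition fmul (R : realType) (n : nat) (S T : nat -> 'M[Cplx R]_n) :
    nat -> 'M[Cplx R]_n :=
  fun k => \sum_(j < k.+1) S j *m T (k - j)%N.

Definition fone (R : realType) (n : nat) : nat -> 'M[Cplx R]_n :=
  fun k => (k == 0%N)%:R%:M.

(** [w^2 * normal_form A B C], as a series in [w]. *)
Definition fnormal_form (R : realType) (d n : nat)
    (A : 'rV[Cplx R]_d -> 'M[Cplx R]_n) (B : 'M[Cplx R]_n)
    (C : 'I_d -> 'rV[Cplx R]_d -> 'M[Cplx R]_n)
    (a : option 'I_d) (x : 'rV[Cplx R]_d) : nat -> 'M[Cplx R]_n :=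
  fun k => (if a is Some i then [:: 0; - C i x] else [:: A x; B])`_k.

(** The components of [w^2 * d(sum_k Phi_k(x) w^k)], as series in [w]: the
    [dw]-component is [sum_k k Phi_k w^(k+1)] and the [dx_i]-component is
    [sum_k (d Phi_k / d x_i) w^(k+2)]. *)
Definition fdiff (R : realType) (d n : nat)
    (Phi : nat -> 'rV[Cplx R]_d -> 'M[Cplx R]_n)
    (a : option 'I_d) (x : 'rV[Cplx R]_d) : nat -> 'M[Cplx R]_n :=
  fun k => match a, k with
           | None, j.+1 => Phi j x *+ j
           | Some i, j.+2 => 'D_(delta_mx 0 i) (Phi j) x
           | _, _ => 0
           end.

(** [Psi] is the inverse series of [Phi]; the right-hand side of the gauge
    equation is [- d(z Delta0) - B' dz/z], with [Delta0 = diag_mx delta] and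
    [B' = diag_mx b]. *)
Definition fs_type (R : realType) (n : nat) (Ao Bo : 'M[Cplx R]_n) :
    set (integrable_deformation Ao Bo) :=
  [set E | exists V A C, is_normal_form V A C /\
    exists (U : set 'rV[Cplx R]_(pdim E))
           (Phi Psi : nat -> 'rV[Cplx R]_(pdim E) -> 'M[Cplx R]_n)
           (delta : 'rV[Cplx R]_(pdim E) -> 'rV[Cplx R]_n) (b : 'rV[Cplx R]_n),
      [/\ open U, U (pt E) & U `<=` V] /\
      [/\ forall k, holomorphic_on U (Phi k),
          forall x, U x -> Phi 0%N x \in unitmx
        & holomorphic_on U delta] /\
      forall x, U x ->
        [/\ fmul (Phi^~ x) (Psi^~ x) =1 fone R n,
            fmul (Psi^~ x) (Phi^~ x) =1 fone R n
          & forall a k,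
              fmul (Psi^~ x) (fmul (fnormal_form A Bo C a x) (Phi^~ x)) k
              + fmul (Psi^~ x) (fdiff Phi a x) k
              = fnormal_form (fun y => diag_mx (delta y)) (diag_mx b)
                  (fun i => 'D_(delta_mx 0 i) (fun y => diag_mx (delta y)))
                  a x k]].

Arguments generic_dtype {R n} Ao Bo.
Arguments fs_type {R n} Ao Bo.

(* Main.v *)
(** Regularity and diagonalizability of [Ao] together imply PNR, so PNR may be
    assumed. A normal form is flat iff [A C_i = C_i A], [C_i C_j = C_j C_i],
    [d_i C_j = d_j C_i] and [d_i A = C_i + (C_i Bo - Bo C_i)].

    Inclusion. Let [A S = S diag(f)], [theta = S^-1 dS] and [B = S^-1 Bo S].
    Genericity makes [f_p <> f_q] on a dense set, so [S^-1 C S] is diagonal,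
    equal to [df]. Moreover [theta_pq = F_pq d(f_p - f_q)] and
    [B_pq = F_pq (f_q - f_p)] with [F_pq] holomorphic; hence the diagonal of
    [theta] is closed and can be killed by rescaling the columns of [S], and the
    diagonal of [B] is constant. The coefficients of the formal gauge
    transformation are then found recursively from the x-equation, dividing by a
    directional derivative of [f_p - f_q] that does not vanish rather than by
    [f_p - f_q] itself; the z-equation follows by compatibility.

    Existence. Take one parameter [x], distinct numbers [v_k], [U = diag(u)],
    [V = diag(v)], and look for [A = G (U + x V) G^-1] and [C = G V G^-1] with
    [G' = G [V, F]], where [F] is off-diagonal and [b + [F, U + x V]] is to equal
    [G^-1 Bo G]. This is a quadratic differential equation for [F], singular at
    the entries with [u_k = u_l]; there the coefficient of [x^p] is multiplied by
    [p + 1 + b_k - b_l], nonzero by PNR, and the formal solution converges.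

    Strictness. For [n > 1] the constant deformation over a point is formally
    simplifiable by PNR, but all differentials vanish on it. *)

Require Import Defs.
From HB Require Import structures.
From mathcomp Require Import all_boot all_order all_algebra.
From mathcomp Require Import complex.
From mathcomp Require Import all_classical all_reals all_analysis.
From mathcomp Require Import ring lra.
From Stdlib Require Ncring Ncring_tac.
Set Implicit Arguments.
Unset Strict Implicit.
Unset Printing Implicit Defensive.
Import Order.TTheory GRing.Theory Num.Theory.
Import numFieldNormedType.Exports.
Local Open Scope classical_set_scope.
Local Open Scope complex_scope.
Local Open Scope ring_scope.

(** * Complex numbers and integrals *)

(** Holomorphy here is complex differentiability at the points of an open set and nothing more, yet
    second derivatives must exist and commute at two places: flatness of the normal form is
    inherited from an arbitrary trivialization through a gauge matrix, and the diagonal of [theta]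
    is closed by the Maurer-Cartan equation. Cauchy's formula on complex lines, differentiated under
    the integral sign, yields both facts. The obstacle behind the inclusion is that eigenvalues may
    coincide at the base point, where the usual recursion breaks down. The ansatz for existence
    reads the frame equations backwards: for eigenvalues [u + x v] they suggest [theta = [V, F]],
    and the constancy of [Bo] becomes [B' = [B, theta]] for [B = b + [F, U + x V]]. If [u_k = u_l],
    a common factor [v_k - v_l] splits off and leaves the Euler operator [x d/dx + 1 + b_k - b_l].
    Divisors growing like [p + 1] compensate the number of terms in a convolution, whence geometric
    bounds and convergence. *)

Lemma continuous_epsP (K K' : numFieldType) (V : normedModType K)
    (W : normedModType K') (f : V -> W) (x : V) :
  {for x, continuous f} <-> forall e, 0 < e -> exists2 d, 0 < d &
    forall y, `|x - y| < d -> `|f x - f y| < e.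
Proof.
split=> [/cvgrPdist_lt cf e e0|cf].
  have /nbhs_ballP[d d0 dP] := cf e e0; exists d => // y xy.
  by apply: dP; rewrite -ball_normE.
apply/cvgrPdist_lt => e /cf[d d0 dP].
apply/nbhs_ballP; exists d => // y; rewrite -ball_normE; exact: dP.
Qed.

Section continuity_kit.
Variables (T : topologicalType) (K : numFieldType) (W : normedModType K) (x : T).
Lemma ct_cst (p : W) : continuous_at x (fun _ : T => p).
Proof. by refine (cvg_cst p). Qed.
Lemma ct_id : continuous_at x (fun y : T => y).
Proof. by refine (@cvg_id _ _). Qed.
Lemma ctD (f g : T -> W) : continuous_at x f -> continuous_at x g ->
  continuous_at x (fun y => f y + g y).
Proof. by move=> cf cg; refine (cvgD cf cg). Qed.
Lemma ctB (f g : T -> W) : continuous_at x f -> continuous_at x g ->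
  continuous_at x (fun y => f y - g y).
Proof. by move=> cf cg; refine (cvgB cf cg). Qed.
Lemma ctM (f g : T -> K) : continuous_at x f -> continuous_at x g ->
  continuous_at x (fun y => f y * g y).
Proof. by move=> cf cg; refine (cvgM cf cg). Qed.
Lemma ctZ (f : T -> K) (g : T -> W) : continuous_at x f -> continuous_at x g ->
  continuous_at x (fun y => f y *: g y).
Proof. by move=> cf cg; refine (cvgZ cf cg). Qed.
Lemma ct_comp (U : topologicalType) (f : T -> U) (g : U -> W) :
  continuous_at x f -> continuous_at (f x) g ->
  continuous_at x (fun y => g (f y)).
Proof. by move=> cf cg; refine (continuous_comp cf cg). Qed.
End continuity_kit.

Section complex_numbers.
Variable R : realType.
Local Notation C := (Cplx R).
Definition cre (z : C) : R := complex.Re z.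
Definition cim (z : C) : R := complex.Im z.
Definition toC (x : R) : C := x%:C.
Definition cabs (z : C) : R := cre `|z|.
Definition cx (x y : R) : C := x +i* y.
Definition ci : C := 'i%C.

Lemma toC_le x y : (toC x <= toC y) = (x <= y).
Proof. exact: lecR. Qed.
Lemma toC_lt x y : (toC x < toC y) = (x < y).
Proof. exact: ltcR. Qed.
Lemma toC_ge0 x : (0 <= toC x) = (0 <= x).
Proof. exact: ler0c. Qed.
Lemma toC_gt0 x : (0 < toC x) = (0 < x).
Proof. exact: (ltcR 0). Qed.
Lemma toCD x y : toC (x + y) = toC x + toC y.
Proof. exact: (rmorphD (real_complex R)). Qed.
Lemma toCB x y : toC (x - y) = toC x - toC y.
Proof. exact: (rmorphB (real_complex R)). Qed.
Lemma toCM x y : toC (x * y) = toC x * toC y.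
Proof. exact: (rmorphM (real_complex R)). Qed.
Lemma toC0 : toC 0 = 0. Proof. by []. Qed.
Lemma toC1 : toC 1 = 1. Proof. by []. Qed.
Lemma toC_inj : injective toC. Proof. exact: complexI. Qed.
Lemma toCV x : toC x^-1 = (toC x)^-1.
Proof. exact: (fmorphV (real_complex R)). Qed.
Lemma toCn n : toC n%:R = n%:R.
Proof. exact: (rmorph_nat (real_complex R)). Qed.
Lemma ge0_toC (e : C) : 0 <= e -> e = toC (cre e).
Proof. by case: e => a b; rewrite lecE => /andP[/eqP/= -> _]. Qed.
Lemma gt0_toC (e : C) : 0 < e -> exists2 r : R, 0 < r & e = toC r.
Proof.
move=> e0; exists (cre e); last exact/ge0_toC/ltW.
by rewrite -toC_gt0 -ge0_toC // ltW.
Qed.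
Lemma normCE (z : C) : `|z| = toC (cabs z).
Proof. exact: ge0_toC. Qed.
Lemma cabs_ge0 z : 0 <= cabs z.
Proof. by rewrite -toC_ge0 -normCE. Qed.
Lemma cabsM z w : cabs (z * w) = cabs z * cabs w.
Proof. by apply: toC_inj; rewrite toCM -!normCE normrM. Qed.
Lemma cabsD z w : cabs (z + w) <= cabs z + cabs w.
Proof. by rewrite -toC_le toCD -!normCE ler_normD. Qed.
Lemma cabsN z : cabs (- z) = cabs z.
Proof. by rewrite /cabs normrN. Qed.
Lemma cabsB z w : cabs (z - w) <= cabs z + cabs w.
Proof. by rewrite -(cabsN w) cabsD. Qed.
Lemma cabs0 : cabs 0 = 0.
Proof. by apply: toC_inj; rewrite -normCE normr0. Qed.
Lemma cabs_toC x : cabs (toC x) = `|x|.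
Proof. by rewrite /cabs normc_def/= expr0n addr0 sqrtr_sqr. Qed.
Lemma cabsE z : cabs z = Num.sqrt (cre z ^+ 2 + cim z ^+ 2).
Proof. by rewrite /cabs normc_def. Qed.
Lemma cre_le z : `|cre z| <= cabs z.
Proof. by rewrite cabsE -sqrtr_sqr ler_wsqrtr // lerDl sqr_ge0. Qed.
Lemma cim_le z : `|cim z| <= cabs z.
Proof. by rewrite cabsE -sqrtr_sqr ler_wsqrtr // lerDr sqr_ge0. Qed.
Lemma cxE x y : cx x y = toC x + ci * toC y.
Proof. by rewrite [LHS]complexE. Qed.
Lemma cx_re_im z : cx (cre z) (cim z) = z. Proof. by case: z. Qed.
Lemma cabs_i : cabs ci = 1.
Proof. by rewrite cabsE /= expr0n add0r expr1n sqrtr1. Qed.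
Lemma cabs_le z : cabs z <= `|cre z| + `|cim z|.
Proof.
rewrite -{1}(cx_re_im z) cxE (le_trans (cabsD _ _)) //.
by rewrite cabsM cabs_i mul1r !cabs_toC.
Qed.
Lemma creD z w : cre (z + w) = cre z + cre w. Proof. by case: z w => a b []. Qed.
Lemma cimD z w : cim (z + w) = cim z + cim w. Proof. by case: z w => a b []. Qed.
Lemma creN z : cre (- z) = - cre z. Proof. by case: z. Qed.
Lemma cimN z : cim (- z) = - cim z. Proof. by case: z. Qed.
Lemma creM z w : cre (z * w) = cre z * cre w - cim z * cim w.
Proof. by case: z w => a b []. Qed.
Lemma cimM z w : cim (z * w) = cre z * cim w + cim z * cre w.
Proof. by case: z w => a b []. Qed.
Lemma cx_eq z w : cre z = cre w -> cim z = cim w -> z = w.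
Proof. by case: z w => a b [c d] /= -> ->. Qed.

Lemma ci_neq0 : ci != 0.
Proof. by rewrite -normr_eq0 normCE cabs_i toC1 oner_eq0. Qed.
Lemma cre_toC x : cre (toC x) = x. Proof. by []. Qed.
Lemma cim_toC x : cim (toC x) = 0. Proof. by []. Qed.
Lemma cre_cx x y : cre (cx x y) = x. Proof. by []. Qed.
Lemma cim_cx x y : cim (cx x y) = y. Proof. by []. Qed.
Lemma cre_cont : continuous (cre : C -> R).
Proof.
move=> z; apply/continuous_epsP => e e0; exists (toC e); first by rewrite toC_gt0.
move=> w; rewrite normCE toC_lt; apply: le_lt_trans.
by rewrite -creN -creD cre_le.
Qed.
Lemma cim_cont : continuous (cim : C -> R).
Proof.
move=> z; apply/continuous_epsP => e e0; exists (toC e); first by rewrite toC_gt0.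
move=> w; rewrite normCE toC_lt; apply: le_lt_trans.
by rewrite -cimN -cimD cim_le.
Qed.
Lemma cx_cont (K : numFieldType) (V : normedModType K) (f g : V -> R) t :
  continuous_at t f -> continuous_at t g ->
  continuous_at t (fun s => cx (f s) (g s) : C).
Proof.
move=> cf cg; apply/cvgrPdist_lt => e /gt0_toC[r r0 ->].
move/cvgrPdist_lt: cf => /(_ (r / 2)); move/cvgrPdist_lt: cg => /(_ (r / 2)).
rewrite divr_gt0 // => /(_ isT) cg /(_ isT) cf; near=> s.
rewrite normCE toC_lt (splitr r) (le_lt_trans (cabs_le _)) // ltrD //.
  by near: s.
by near: s.
Unshelve. all: by end_near. Qed.
Lemma toC_cont : continuous (toC : R -> C).
Proof.
move=> t; apply/continuous_epsP => e /gt0_toC[r r0 ->]; exists r => // s.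
by rewrite -toCB normCE cabs_toC toC_lt.
Qed.
End complex_numbers.
Ltac ct := try match goal with
  | |- continuous_at _ (fun _ => ?p) => exact: ct_cst
  | |- continuous_at _ (fun y => y) => exact: ct_id
  | |- continuous_at _ (fun y => @?f y - @?g y) => apply: (@ctB _ _ _ _ f g); ct
  | |- continuous_at _ (fun y => @?f y + @?g y) => apply: (@ctD _ _ _ _ f g); ct
  | |- continuous_at _ (fun y => @?f y * @?g y) => apply: (@ctM _ _ _ f g); ct
  | |- continuous_at _ (fun y => @?f y *: @?g y) => apply: (@ctZ _ _ _ _ f g); ct
  end.
(* Otherwise unification unfolds complex numbers into pairs of reals. *)
#[global] Typeclasses Opaque Cplx.
#[global] Opaque Cplx cre cim cx toC cabs ci.

Section complex_integral.
Variable R : realType.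
Local Notation C := (Cplx R).
Local Notation mu := (@lebesgue_measure R).

(** Integral over the set [[a, b]], so zero when [b < a] and not oriented; hence the hypotheses
    [a <= b] below. *)
Definition rint (a b : R) (f : R -> R) : R := (\int[mu]_(x in `[a, b]) f x)%R.
Definition cint (a b : R) (f : R -> C) : C :=
  cx (rint a b (fun x => cre (f x))) (rint a b (fun x => cim (f x))).

Lemma cont_integrable a b (f : R -> R) : continuous f ->
  mu.-integrable `[a, b] (EFin \o f).
Proof.
move=> cf; apply: continuous_compact_integrable; first exact: segment_compact.
exact: continuous_subspaceT.
Qed.
Lemma rintD a b (f g : R -> R) : continuous f -> continuous g ->
  rint a b (fun x => f x + g x) = rint a b f + rint a b g.
Proof. by move=> cf cg; rewrite /rint RintegralD //; exact: cont_integrable. Qed.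
Lemma rintZ a b k (f : R -> R) : continuous f ->
  rint a b (fun x => k * f x) = k * rint a b f.
Proof. by move=> cf; rewrite /rint RintegralZl //; exact: cont_integrable. Qed.
Lemma rint_cat a b c (f : R -> R) : continuous f -> a <= b -> b <= c ->
  rint a c f = rint a b f + rint b c f.
Proof.
move=> cf ab bc; apply/eqP; rewrite addrC -subr_eq; apply/eqP.
rewrite /rint Rintegral_itvB ?bnd_simp //; last exact: cont_integrable.
by rewrite Rintegral_itv_obnd_cbnd //; apply: integrableS (cont_integrable b c cf) => //; exact: subset_itv_oc_cc.
Qed.
Lemma rint_le a b (f : R -> R) M : continuous f -> a <= b ->
  (forall x, a <= x <= b -> `|f x| <= M) -> `|rint a b f| <= M * (b - a).
Proof.
move=> cf ab fM; rewrite /rint (le_trans (le_normr_Rintegral _ _)) //.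
  exact: cont_integrable.
have -> : M * (b - a) = (\int[mu]_(x in `[a, b]) M)%R.
  rewrite Rintegral_cst //= lebesgue_measure_itv /= lte_fin.
  by case: ltgtP ab => // -> _; rewrite subrr.
apply: le_Rintegral => //.
- by apply: (@cont_integrable _ _ (fun x => `|f x|)) => x; apply: cvg_norm; exact: cf.
- by apply: (@cont_integrable _ _ (fun x => M)) => x; exact: cvg_cst.
Qed.
Lemma rint_FTC (a b : R) (F f : R -> R) : continuous f -> a <= b ->
  (forall x : R, a <= x <= b -> is_derive x (1 : R) F (f x)) -> rint a b f = F b - F a.
Proof.
move=> cf; rewrite le_eqVlt => /predU1P[->|ab] dF.
  by rewrite subrr /rint set_itv1 Rintegral_set1.
have cF x : a <= x <= b -> {for x, continuous F}.
  by move=> xab; apply: differentiable_continuous; apply/derivable1_diffP; have [] := dF x xab.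
rewrite /rint /Rintegral (@continuous_FTC2 _ f F) //.
- exact: continuous_subspaceT.
- split=> [x||].
  + by rewrite in_itv /= => /andP[ax xb]; have [] := dF x; rewrite ?(ltW ax) ?(ltW xb).
  + by apply: cvg_at_right_filter; apply: cF; rewrite lexx ltW.
  + by apply: cvg_at_left_filter; apply: cF; rewrite lexx andbT ltW.
- move=> x; rewrite in_itv /= => /andP[ax xb]; rewrite derive1E.
  by have [] := dF x; rewrite ?(ltW ax) ?(ltW xb).
Qed.

Lemma ccre (f : R -> C) : continuous f -> continuous (fun x => cre (f x)).
Proof. by move=> cf x; apply: (continuous_comp (cf x)); exact: cre_cont. Qed.
Lemma ccim (f : R -> C) : continuous f -> continuous (fun x => cim (f x)).
Proof. by move=> cf x; apply: (continuous_comp (cf x)); exact: cim_cont. Qed.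

Lemma eq_cint (a b : R) (f g : R -> C) : f =1 g -> cint a b f = cint a b g.
Proof. by move=> /funext->. Qed.
Lemma eq_rint (a b : R) (f g : R -> R) : f =1 g -> rint a b f = rint a b g.
Proof. by move=> /funext->. Qed.
Lemma cintD a b (f g : R -> C) : continuous f -> continuous g ->
  cint a b (fun x => f x + g x) = cint a b f + cint a b g.
Proof.
move=> cf cg; apply: cx_eq; rewrite ?creD ?cimD ?cre_cx ?cim_cx -rintD; do ?[exact: ccre|exact: ccim].
  by apply: eq_rint => x; rewrite creD.
by apply: eq_rint => x; rewrite cimD.
Qed.
Lemma cintZ a b k (f : R -> C) : continuous f ->
  cint a b (fun x => k * f x) = k * cint a b f.
Proof.
move=> cf; have cr := ccre cf; have ci := ccim cf.
have cZ (g : R -> R) c : continuous g -> continuous (fun x => c * g x).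
  by move=> cg x; apply: cvgMr; exact: cg.
apply: cx_eq.
  rewrite creM /cint !(cre_cx, cim_cx) -mulNr -!rintZ // -rintD; [|exact: cZ..].
  by apply: eq_rint => x; rewrite creM mulNr.
rewrite cimM /cint !(cre_cx, cim_cx) -!rintZ // -rintD; [|exact: cZ..].
by apply: eq_rint => x; rewrite cimM.
Qed.
Lemma cint_cat a b c (f : R -> C) : continuous f -> a <= b -> b <= c ->
  cint a c f = cint a b f + cint b c f.
Proof.
move=> cf ab bc; apply: cx_eq; rewrite ?creD ?cimD ?cre_cx ?cim_cx -rint_cat //.
  exact: ccre.
exact: ccim.
Qed.
(** Real and imaginary parts are bounded separately, which costs the factor 2; later numerical
    constants carry it along. *)
Lemma cint_le a b (f : R -> C) M : continuous f -> a <= b ->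
  (forall x, a <= x <= b -> cabs (f x) <= M) -> cabs (cint a b f) <= 2 * (M * (b - a)).
Proof.
move=> cf ab fM; rewrite (le_trans (cabs_le _)) // mulr_natl mulr2n lerD // rint_le //.
- exact: ccre.
- by move=> x /fM; apply: le_trans; exact: cre_le.
- exact: ccim.
- by move=> x /fM; apply: le_trans; exact: cim_le.
Qed.
Lemma cint_FTC (a b : R) (F f : R -> C) : continuous f -> a <= b ->
  (forall x : R, a <= x <= b -> is_derive x (1 : R) (fun x => cre (F x)) (cre (f x)) /\
    is_derive x (1 : R) (fun x => cim (F x)) (cim (f x))) ->
  cint a b f = F b - F a.
Proof.
move=> cf ab dF; apply: cx_eq; rewrite ?creD ?cimD ?creN ?cimN ?cre_cx ?cim_cx.
  apply: (rint_FTC (F := fun x => cre (F x))) => //; first exact: ccre.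
  by move=> x /dF[].
apply: (rint_FTC (F := fun x => cim (F x))) => //; first exact: ccim.
by move=> x /dF[].
Qed.
Lemma rint_cst (a b k : R) : a <= b -> rint a b (fun=> k) = k * (b - a).
Proof.
move=> ab; rewrite /rint Rintegral_cst //= lebesgue_measure_itv /= lte_fin.
by case: ltgtP ab => // -> _; rewrite subrr.
Qed.
Lemma cint_cst (a b : R) (k : C) : a <= b -> cint a b (fun=> k) = k * toC (b - a).
Proof.
move=> ab; apply: cx_eq; rewrite ?creM ?cimM /cint ?cre_cx ?cim_cx ?cre_toC ?cim_toC !rint_cst //.
  by rewrite mulr0 subr0.
by rewrite mulr0 add0r.
Qed.
End complex_integral.
#[global] Opaque rint cint.

(** * Goursat's theorem and Cauchy's formula *)

Section goursat.
Variable R : realType.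
Local Notation C := (Cplx R).

Lemma ccontZ (k : C) (f : R -> C) : continuous f -> continuous (fun x => k * f x).
Proof. by move=> cf x; apply: cvgMr; exact: cf. Qed.
Lemma ccontD (f g : R -> C) : continuous f -> continuous g -> continuous (fun x => f x + g x).
Proof. by move=> cf cg x; apply: cvgD; [exact: cf|exact: cg]. Qed.
Lemma cintB (a b : R) (f g : R -> C) : continuous f -> continuous g ->
  cint a b (fun x => f x - g x) = cint a b f - cint a b g.
Proof.
move=> cf cg; rewrite -[in RHS]mulN1r -cintZ; last exact: cg.
rewrite -cintD; [|exact: cf|exact: ccontZ].
by apply: eq_cint => x; rewrite mulN1r.
Qed.
Lemma cx_hor (y : R) : continuous (fun x : R => cx x y : C).
Proof. by move=> x; apply: cx_cont; [exact: cvg_id|exact: cvg_cst]. Qed.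
Lemma cx_ver (x : R) : continuous (fun y : R => cx x y : C).
Proof. by move=> y; apply: cx_cont; [exact: cvg_cst|exact: cvg_id]. Qed.
Lemma ccomp_hor (k : C -> C) (y : R) : continuous k -> continuous (fun x : R => k (cx x y)).
Proof. by move=> ck x; apply: continuous_comp; [exact: cx_hor|exact: ck]. Qed.
Lemma ccomp_ver (k : C -> C) (x : R) : continuous k -> continuous (fun y : R => k (cx x y)).
Proof. by move=> ck y; apply: continuous_comp; [exact: cx_ver|exact: ck]. Qed.

(** Contour integral over the boundary of [[a, b] x [c, d]], counterclockwise: bottom minus top,
    plus [i] times right minus left. *)
Definition rect_int (k : C -> C) (a b c d : R) : C :=
  (cint a b (fun x => k (cx x c)) - cint a b (fun x => k (cx x d))) +
  ci R * (cint c d (fun y => k (cx b y)) - cint c d (fun y => k (cx a y))).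

Lemma rect_int_split k (a m b c n d : R) : continuous k ->
  a <= m -> m <= b -> c <= n -> n <= d ->
  rect_int k a b c d = rect_int k a m c n + rect_int k m b c n +
                       (rect_int k a m n d + rect_int k m b n d).
Proof.
move=> ck am mb cn nd; rewrite /rect_int.
have H := fun y => cint_cat (@ccomp_hor k y ck) am mb.
have V := fun x => cint_cat (@ccomp_ver k x ck) cn nd.
rewrite !H !V; ring.
Qed.

Lemma rect_int_le k (a b c d M : R) : continuous k -> a <= b -> c <= d ->
  (forall x y, a <= x <= b -> c <= y <= d -> cabs (k (cx x y)) <= M) ->
  cabs (rect_int k a b c d) <= 4 * M * ((b - a) + (d - c)).
Proof.
move=> ck ab cd kM; rewrite (le_trans (cabsD _ _)) //.
have -> : 4 * M * (b - a + (d - c)) = 2 * (M * (b - a)) + 2 * (M * (b - a)) +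
   (2 * (M * (d - c)) + 2 * (M * (d - c))) by ring.
rewrite lerD //; last rewrite cabsM cabs_i mul1r.
  rewrite (le_trans (cabsB _ _)) // lerD //; apply: cint_le => //; try exact: ccomp_hor.
    by move=> x xab; apply: kM; rewrite // lexx.
  by move=> x xab; apply: kM; rewrite // lexx andbT.
rewrite (le_trans (cabsB _ _)) // lerD //; apply: cint_le => //; try exact: ccomp_ver.
  by move=> x xab; apply: kM; rewrite // lexx andbT.
by move=> x xab; apply: kM; rewrite // lexx.
Qed.

(** On opposite sides an affine function differs by a constant, and the two contributions
    [q i (b - a) (d - c)] cancel. In Goursat's argument the affine function is the tangent at the
    limit point. *)
Lemma rect_int_affine (k : C -> C) (p q : C) (a b c d : R) : continuous k -> a <= b -> c <= d ->
  rect_int (fun z => k z - (p + q * z)) a b c d = rect_int k a b c d.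
Proof.
move=> ck ab cd; rewrite /rect_int.
have ca (g : R -> C) : continuous g -> continuous (fun x => p + q * g x).
  by move=> cg; apply: ccontD; [move=> x; exact: cvg_cst|exact: ccontZ].
rewrite !cintB; [|by [exact: ccomp_ver|exact: ccomp_hor|apply: ca; exact: cx_hor|apply: ca; exact: cx_ver]..].
have E (u v : R) (f g : R -> C) z : u <= v -> continuous f -> continuous g ->
   (forall x, f x - g x = z) ->
   cint u v (fun x => p + q * f x) - cint u v (fun x => p + q * g x) = q * (z * toC (v - u)).
  move=> uv cf cg fg; rewrite -cintB; [|exact: ca..].
  rewrite -(cint_cst _ uv) -cintZ; last by move=> x; exact: cvg_cst.
  by apply: eq_cint => x; rewrite -(fg x); ring.
have /(E _ _ _ _ (- (ci R * toC (d - c))) ab (@cx_hor c) (@cx_hor d)) E1 : forall x, cx x c - cx x d = - (ci R * toC (d - c)).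
  by move=> x; rewrite !cxE toCB; ring.
have /(E _ _ _ _ (toC (b - a)) cd (@cx_ver b) (@cx_ver a)) E2 : forall x, cx b x - cx a x = toC (b - a).
  by move=> x; rewrite !cxE toCB; ring.
set A := cint a b _ in E1 *; set B := cint a b _ in E1 *.
set A' := cint c d _ in E2 *; set B' := cint c d _ in E2 *.
transitivity (cint a b (fun x : R => k (cx x c)) - cint a b (fun x : R => k (cx x d)) + ci R * (cint c d (fun y : R => k (cx b y)) - cint c d (fun y : R => k (cx a y))) - ((A - B) + ci R * (A' - B'))); first ring.
by rewrite E1 E2; ring.
Qed.

Lemma cont_subaff (k : C -> C) (p q : C) : continuous k -> continuous (fun z => k z - (p + q * z)).
Proof.
move=> ck z.
by ct; exact: ck.
Qed.

Definition cdiff (k : C -> C) (z : C) := exists L : C, forall e : R, 0 < e ->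
  exists2 d : R, 0 < d & forall z', cabs (z' - z) < d ->
    cabs (k z' - k z - L * (z' - z)) <= e * cabs (z' - z).

(** The left ends increase and the right ends [u n + w / 2^n] decrease, so the supremum of the left
    ends lies in every interval. *)
Lemma nested_itv (u : nat -> R) w : 0 <= w ->
  (forall n, u n <= u n.+1 <= u n + w * 2^-1 ^+ n.+1) ->
  exists l, forall n, u n <= l <= u n + w * 2^-1 ^+ n.
Proof.
move=> w0 uP.
have mono n m : u n <= u (n + m)%N.
  elim: m => [|m IH]; first by rewrite addn0.
  by rewrite addnS (le_trans IH) //; case/andP: (uP (n + m)%N).
have anti n m : u (n + m)%N + w * 2^-1 ^+ (n + m) <= u n + w * 2^-1 ^+ n.
  elim: m => [|m IH]; first by rewrite addn0.
  apply: le_trans IH; rewrite addnS; have /andP[_ h] := uP (n + m)%N.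
  rewrite (le_trans (lerD h (lexx _))) // -addrA lerD2l exprS; lra.
have bd n m : u m <= u n + w * 2^-1 ^+ n.
  have p k : 0 <= w * 2^-1 ^+ k by rewrite mulr_ge0 // exprn_ge0 // invr_ge0.
  have [nm|mn] := leqP n m.
    rewrite -(subnKC nm); apply: le_trans (anti n (m - n)%N); by rewrite lerDl.
  rewrite -(subnKC (ltnW mn)); apply: (le_trans (mono m (n - m)%N)); by rewrite lerDl.
have hs : has_sup (range u).
  split; first by exists (u 0%N), 0%N.
  by exists (u 0%N + w * 2^-1 ^+ 0) => _ [m _ <-]; exact: bd.
exists (sup (range u)) => n; apply/andP; split.
  by apply: sup_upper_bound => //; exists n.
by apply: sup_le_ub; [exact: hs.1|move=> _ [m _ <-]; exact: bd].
Qed.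

(** Continuity is global so that every integral below makes sense, differentiability is local to the
    rectangle. By bisection some quarter always carries at least a quarter of the integral; near the
    limit point the tangent can be subtracted, which leaves [o(4^-n)] over the [n]-th rectangle. *)
Lemma goursat k (a b c d : R) : continuous k -> a <= b -> c <= d ->
  (forall x y, a <= x <= b -> c <= y <= d -> cdiff k (cx x y)) ->
  rect_int k a b c d = 0.
Proof.
move=> ck ab cd dk.
pose w := b - a; pose h := d - c; pose q n : R := 2^-1 ^+ n.
have q0 n : 0 <= q n by rewrite exprn_ge0 // invr_ge0.
have w0 : 0 <= w by rewrite subr_ge0.
have h0 : 0 <= h by rewrite subr_ge0.
pose I n (p : R * R) := cabs (rect_int k p.1 (p.1 + w * q n) p.2 (p.2 + h * q n)).
have lr4 (x a1 a2 a3 a4 : R) : 4 * a1 < x -> 4 * a2 < x -> 4 * a3 < x -> 4 * a4 < x -> a1 + a2 + (a3 + a4) < x by lra.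
(* Otherwise the four quarters, each below a quarter of [I n p], would add up to less than
   [I n p]. *)
have stepP n p : exists p', [/\ I n p <= 4 * I n.+1 p',
    p.1 <= p'.1 <= p.1 + w * q n.+1 & p.2 <= p'.2 <= p.2 + h * q n.+1].
  apply: contrapT => /forallNP H.
  have wq : 0 <= w * q n.+1 by rewrite mulr_ge0.
  have hq : 0 <= h * q n.+1 by rewrite mulr_ge0.
  have lt1 p' : p.1 <= p'.1 <= p.1 + w * q n.+1 -> p.2 <= p'.2 <= p.2 + h * q n.+1 ->
    4 * I n.+1 p' < I n p.
    by move=> h1 h2; rewrite ltNge; apply/negP => h3; apply: (H p').
  have qS : q n = 2 * q n.+1 by rewrite /q exprS mulrA divff ?mul1r.
  have : I n p < I n p.
    rewrite {1}/I (@rect_int_split _ _ (p.1 + w * q n.+1) _ _ (p.2 + h * q n.+1)) //; try by rewrite ?lerDl // lerD2l qS; lra.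
    have -> : p.1 + w * q n = p.1 + w * q n.+1 + w * q n.+1 by rewrite qS; ring.
    have -> : p.2 + h * q n = p.2 + h * q n.+1 + h * q n.+1 by rewrite qS; ring.
    apply: le_lt_trans (cabsD _ _) _.
    apply: le_lt_trans (lerD (cabsD _ _) (cabsD _ _)) _.
    have := lt1 p; have := lt1 (p.1 + w * q n.+1, p.2); have := lt1 (p.1, p.2 + h * q n.+1).
    have := lt1 (p.1 + w * q n.+1, p.2 + h * q n.+1).
    rewrite /I /= !lexx !lerDl wq hq /= => /(_ isT isT) A1 /(_ isT isT) A2 /(_ isT isT) A3 /(_ isT isT) A4.
    exact: lr4 A4 A3 A2 A1.
  by rewrite ltxx.
have wh n : 0 <= (w + h) * q n by rewrite mulr_ge0 // addr_ge0.
pose f := fix f n := if n is m.+1 then sval (cid (stepP m (f m))) else (a, c).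
have fP n := svalP (cid (stepP n (f n))).
have [x0 xP] : exists l, forall n, (f n).1 <= l <= (f n).1 + w * q n.
  by apply: nested_itv => // n; have [] := fP n.
have [y0 yP] : exists l, forall n, (f n).2 <= l <= (f n).2 + h * q n.
  by apply: nested_itv => // n; have [] := fP n.
have In n : I 0%N (a, c) * (q n) ^+ 2 <= I n (f n).
  elim: n => [|n IH]; first by rewrite /q expr0 expr1n mulr1.
  have [h1 _ _] := fP n; move: (le_trans IH h1).
  have -> : f n.+1 = sval (cid (stepP n (f n))) by [].
  have -> : q n = 2 * q n.+1 by rewrite /q exprS mulrA divff ?mul1r.
  have lr5 (x y z : R) : x * (2 * y) ^+ 2 <= 4 * z -> x * y ^+ 2 <= z by rewrite exprMn; lra.
  exact: lr5.
have [L LP] : cdiff k (cx x0 y0).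
  by apply: dk; [have := xP 0%N|have := yP 0%N]; rewrite /= /q expr0 mulr1 /w /h; lra.
(* The sum of sides [(w + h) / 2^n] enters once as a bound for the distance to the limit point and
   once through the perimeter; 4 is the constant of [rect_int_le]. *)
have small e : 0 < e -> I 0%N (a, c) <= e * (4 * (w + h) ^+ 2).
  move=> e0; have [dl dl0 dP] := LP _ e0.
  have [n nP] : exists n, (w + h) * q n < dl.
    have : ((w + h) * q n @[n --> \oo] --> (w + h) * 0)%classic.
      by apply: cvgMr; apply: cvg_expr; rewrite ger0_norm; lra.
    rewrite mulr0 => /cvgrPdist_lt /(_ _ dl0) [N _ NP]; exists N.
    have := NP N (leqnn N); rewrite /= sub0r normrN; apply: le_lt_trans.
    exact: ler_norm.
  have [h1 h2] : 0 <= w * q n /\ 0 <= h * q n by split; exact: mulr_ge0.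
  have qn : 0 < q n ^+ 2 by rewrite exprn_gt0 // exprn_gt0 // invr_gt0.
  rewrite -(ler_pM2r qn) (le_trans (In n)) //.
  have {1}-> : I n (f n) = cabs (rect_int (fun z => k z - ((k (cx x0 y0) - L * cx x0 y0) + L * z))
      (f n).1 ((f n).1 + w * q n) (f n).2 ((f n).2 + h * q n)).
    by rewrite rect_int_affine ?lerDl.
  have xn := xP n; have yn := yP n.
  have le1 x y : (f n).1 <= x <= (f n).1 + w * q n -> (f n).2 <= y <= (f n).2 + h * q n ->
      cabs (cx x y - cx x0 y0) <= (w + h) * q n.
    move=> xx yy; rewrite (le_trans (cabs_le _)) // creD cimD creN cimN !(cre_cx, cim_cx) mulrDl lerD //.
      by rewrite ler_norml; lra.
    by rewrite ler_norml; lra.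
  have B : cabs (rect_int (fun z => k z - ((k (cx x0 y0) - L * cx x0 y0) + L * z))
      (f n).1 ((f n).1 + w * q n) (f n).2 ((f n).2 + h * q n)) <=
    4 * (e * ((w + h) * q n)) * ((f n).1 + w * q n - (f n).1 + ((f n).2 + h * q n - (f n).2)).
    apply: rect_int_le; [|by rewrite lerDl|by rewrite lerDl|].
    - exact: cont_subaff.
    - move=> x y xx yy.
      have -> : k (cx x y) - (k (cx x0 y0) - L * cx x0 y0 + L * cx x y) =
        k (cx x y) - k (cx x0 y0) - L * (cx x y - cx x0 y0) by ring.
      have h3 := le1 _ _ xx yy.
      apply: le_trans (dP _ _) _; first exact: le_lt_trans h3 nP.
      by rewrite ler_wpM2l // ltW.
  apply: le_trans B _.
  rewrite !(addrC _ (_ * q n)) !addrK -mulrDl le_eqVlt; apply/orP; left; apply/eqP; ring.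
have I0 : I 0%N (a, c) = cabs (rect_int k a b c d).
  by rewrite /I /= /q expr0 !mulr1 /w /h !(addrC _ (_ - _)) !subrK.
have : cabs (rect_int k a b c d) = 0.
  apply/eqP; rewrite eq_le cabs_ge0 andbT -I0; apply/ler_addgt0Pr => e e0; rewrite add0r.
  have s0 : 0 < 4 * (w + h) ^+ 2 + 1 by rewrite ltr_wpDl // mulr_ge0 // exprn_ge0 // addr_ge0.
  have := small (e / (4 * (w + h) ^+ 2 + 1)); rewrite divr_gt0 // => /(_ isT) /le_trans; apply.
  by rewrite mulrAC ler_pdivrMr // ler_wpM2l ?ltW //; lra.
by move=> h00; apply/eqP; rewrite -normr_eq0 normCE h00.
Qed.
End goursat.

(** Clearing the quotient admits [h = 0] and turns derivatives into plain estimates. *)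
Lemma is_deriveP (K : numFieldType) (V W : normedModType K) (f : V -> W) (x v : V) (L : W) :
  is_derive x v f L <-> forall e, 0 < e -> exists2 d, 0 < d &
    forall h, `|h| < d -> `|f (h *: v + x) - f x - h *: L| <= e * `|h|.
Proof.
have key h : h != 0 -> `|f (h *: v + x) - f x - h *: L| =
    `|L - h^-1 *: (f (h *: v + x) - f x)| * `|h|.
  move=> h0; rewrite mulrC -normrZ -normrN scalerBr scalerA divff // scale1r.
  by congr `|_|; rewrite opprB.
split=> [[df dfE] e e0|H].
  have cv : h^-1 *: (f (h *: v + x) - f x) @[h --> 0^'] --> L by rewrite -dfE; exact: df.
  have /cvgrPdist_le /(_ _ e0) := cv.
  rewrite near_withinE => /nbhs_ballP[d d0 dP]; exists d => // h hd.
  have [->|h0] := eqVneq h 0.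
    by rewrite !scale0r add0r subrr subr0 !normr0 mulr0.
  rewrite key // ler_wpM2r //; apply: dP => //.
  by rewrite -ball_normE /= sub0r normrN.
have cv : h^-1 *: (f (h *: v + x) - f x) @[h --> 0^'] --> L.
  apply/cvgrPdist_le => e e0; have [d d0 dP] := H e e0.
  rewrite near_withinE; apply/nbhs_ballP; exists d => // h; rewrite -ball_normE /= sub0r normrN => hd h0.
  by rewrite -(ler_pM2r (x := `|h|)) ?normr_gt0 // -key // dP.
apply: DeriveDef; first by apply/cvg_ex; exists L.
exact: cvg_lim cv.
Qed.

(** * The complex exponential *)

Section exponential.
Variable R : realType.
Local Notation C := (Cplx R).

Lemma is_deriveRP (f : R -> R) (x L : R) : is_derive x 1 f L -> forall e : R, 0 < e ->
  exists2 d : R, 0 < d & forall h, `|h| < d -> `|f (x + h) - f x - L * h| <= e * `|h|.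
Proof.
move=> /is_deriveP H e /H[d d0 dP]; exists d => // h /dP.
by rewrite /GRing.scale /= mulr1 (addrC h) (mulrC h).
Qed.

Definition has_cder (k : C -> C) (z L : C) := forall e : R, 0 < e ->
  exists2 d : R, 0 < d & forall h, cabs h < d ->
    cabs (k (z + h) - k z - L * h) <= e * cabs h.
Lemma has_cderP k z L : has_cder k z L <-> is_derive (z : C) (1 : C) k L.
Proof.
split=> [H|/is_deriveP H].
  apply/is_deriveP => _ /gt0_toC[e e0 ->]; have [d d0 dP] := H e e0.
  exists (toC d); rewrite ?toC_gt0 // => h; rewrite !normCE toC_lt -toCM toC_le => /dP.
  by rewrite /GRing.scale /= mulr1 (addrC h) (mulrC h).
move=> e e0; have [|_ /gt0_toC[d d0 ->] dP] := H (toC e); first by rewrite toC_gt0.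
exists d => // h hd; have := dP h; rewrite !normCE toC_lt -toCM toC_le => /(_ hd).
by rewrite /GRing.scale /= mulr1 (addrC h) (mulrC h).
Qed.
Lemma has_cder_cdiff k z L : has_cder k z L -> cdiff k z.
Proof.
move=> H; exists L => e /H[d d0 dP]; exists d => // z' /dP.
by rewrite (addrC z) subrK.
Qed.

Definition cexp (z : C) : C := toC (expR (cre z)) * cx (cos (cim z)) (sin (cim z)).
Lemma cexpD z w : cexp (z + w) = cexp z * cexp w.
Proof.
rewrite /cexp creD cimD expRD cosD sinD toCM mulrACA; congr (_ * _).
by apply: cx_eq; rewrite ?creM ?cimM !(cre_cx, cim_cx) //; rewrite addrC.
Qed.
Lemma cexp0 : cexp 0 = 1.
Proof.
rewrite /cexp -(toC0 R) cre_toC cim_toC expR0 cos0 sin0 toC1 mul1r.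
by rewrite cxE toC0 mulr0 addr0.
Qed.
Lemma cabs_cexp z : cabs (cexp z) = expR (cre z).
Proof.
rewrite /cexp cabsM cabs_toC (ger0_norm (expR_ge0 _)) cabsE cre_cx cim_cx.
by rewrite cos2Dsin2 sqrtr1 mulr1.
Qed.
Lemma cexp_neq0 z : cexp z != 0.
Proof.
by rewrite -normr_eq0 normCE cabs_cexp gt_eqF // toC_gt0 expR_gt0.
Qed.

(** With [h = s + i t], the real part of [exp h - 1 - h] is [(e^s - 1 - s) cos t + (1 + s) (cos t -
    1)] and the imaginary part is [(e^s - 1) sin t + (sin t - t)]; the real derivatives at 0 make
    each piece small. *)
Lemma has_cder_cexp0 : has_cder cexp 0 1.
Proof.
(* The four pieces are at most [e'], [2 e'], [2 e'] and [e'] times [cabs h], so [12 e' <= e] is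
   ample. *)
move=> e e0; pose e' := Num.min (e / 12) 1.
have e'0 : 0 < e' by rewrite lt_min divr_gt0 //= ltr01.
have e'1 : e' <= 1 by rewrite ge_min lexx orbT.
have e'e : 12 * e' <= e.
  have : e' <= e / 12 by rewrite ge_min lexx. by rewrite ler_pdivlMr // mulrC.
have [d1 d10 d1P] := is_deriveRP (is_derive_expR 0) e'0.
have [d2 d20 d2P] := is_deriveRP (is_derive_sin 0) e'0.
have [d3 d30 d3P] := is_deriveRP (is_derive_cos 0) e'0.
exists (Num.min (Num.min d1 d2) (Num.min d3 (e' / 4))) => [|h].
  by rewrite !lt_min d10 d20 d30 divr_gt0.
rewrite !lt_min => /andP[/andP[h1 h2] /andP[h3 h4]].
set s := cre h; set t := cim h.
have ss : `|s| <= cabs h by exact: cre_le.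
have tt : `|t| <= cabs h by exact: cim_le.
have := d1P s (le_lt_trans ss h1); have := d2P t (le_lt_trans tt h2).
have := d3P t (le_lt_trans tt h3).
rewrite !add0r sin0 cos0 expR0 !(oppr0, mul0r, mul1r, addr0) => c1 c2 c3.
have a0 : 0 <= cabs h by exact: cabs_ge0.
have ct : `|cos t| <= 1 by rewrite ler_norml cos_geN1 cos_le1.
have p1 : `|(expR s - 1 - s) * cos t| <= e' * cabs h.
  rewrite normrM -[leRHS]mulr1 ler_pM //; apply: le_trans c3 _.
  by rewrite ler_wpM2l // ltW.
have p2 : `|(1 + s) * (cos t - 1)| <= 2 * (e' * cabs h).
  rewrite normrM ler_pM //; last by apply: le_trans c1 _; rewrite ler_wpM2l // ltW.
  by rewrite (le_trans (ler_normD _ _)) // normr1; lra.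
have p3 : `|expR s - 1| <= e'.
  have -> : expR s - 1 = (expR s - 1 - s) + s by rewrite subrK.
  rewrite (le_trans (ler_normD _ _)) //.
  have : e' * `|s| <= 1 * `|s| by rewrite ler_wpM2r.
  lra.
have p4 : `|sin t| <= 2 * cabs h.
  have -> : sin t = (sin t - t) + t by rewrite subrK.
  rewrite (le_trans (ler_normD _ _)) //.
  have : e' * `|t| <= 1 * `|t| by rewrite ler_wpM2r.
  lra.
have p5 : `|(expR s - 1) * sin t| <= e' * (2 * cabs h).
  by rewrite normrM ler_pM.
have p6 : `|sin t - t| <= e' * cabs h.
  by apply: le_trans c2 _; rewrite ler_wpM2l // ltW.
rewrite cexp0 ?mul1r (le_trans (cabs_le _)) //.
have -> : cre (cexp h - 1 - h) = (expR s - 1 - s) * cos t + (1 + s) * (cos t - 1).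
  rewrite /cexp !creD !creN -(toC1 R) creM !(cre_cx,cim_cx,cre_toC,cim_toC) -/s -/t; ring.
have -> : cim (cexp h - 1 - h) = (expR s - 1) * sin t + (sin t - t).
  rewrite /cexp !cimD !cimN -(toC1 R) cimM !(cre_cx,cim_cx,cre_toC,cim_toC) -/s -/t; ring.
have := ler_normD ((expR s - 1 - s) * cos t) ((1 + s) * (cos t - 1)).
have := ler_normD ((expR s - 1) * sin t) (sin t - t).
have : 12 * e' * cabs h <= e * cabs h by rewrite ler_wpM2r.
move: p1 p2 p5 p6; set A := `|_ * _|; set B := `|_ * _|; set D := `|_ * _|; set E := `|_ - t|.
move=> p1 p2 p5 p6 h5 h6 h7. rewrite (le_trans (lerD h7 h6)) //; apply: le_trans h5.
have ec : 0 <= e' * cabs h by rewrite mulr_ge0 // ltW.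
clear h6 h7; move: p1 p2 p5 p6 ec; rewrite (mulrCA e' 2) -mulrA.
move: (e' * cabs h) A B D E => *; lra.
Qed.
Lemma is_derive_cexp (z : C) : is_derive z (1 : C) cexp (cexp z).
Proof.
apply/has_cderP => e e0.
have e1 : 0 < e / expR (cre z) by rewrite divr_gt0 // expR_gt0.
have [d d0 dP] := has_cder_cexp0 e1; exists d => // h /dP.
rewrite add0r cexp0 cexpD mul1r => h1.
have -> : cexp z * cexp h - cexp z - cexp z * h = cexp z * (cexp h - 1 - h) by ring.
rewrite cabsM cabs_cexp; apply: le_trans (ler_wpM2l (expR_ge0 _) h1) _.
by rewrite mulrA mulrCA divff ?mulr1 // gt_eqF // expR_gt0.
Qed.
Lemma differentiable_cexp (z : C) : differentiable cexp z.
Proof. by apply/derivable1_diffP; have [] := is_derive_cexp z. Qed.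
End exponential.

Section mean_value.
Variable R : realType.
Local Notation C := (Cplx R).
Local Notation pi2 := (2 * pi : R).

Definition cis (t : R) : C := cexp (cx 0 t).
Lemma cabs_cis t : cabs (cis t) = 1.
Proof. by rewrite /cis cabs_cexp cre_cx expR0. Qed.
Lemma cis_cont : continuous cis.
Proof.
move=> t; apply: (@ct_comp _ _ _ _ _ (fun t => cx 0 t) (@cexp R)); first exact: cx_ver.
by apply: differentiable_continuous; exact: differentiable_cexp.
Qed.
Lemma cexp_polar (s t : R) : cexp (cx s t) = toC (expR s) * cis t.
Proof.
by rewrite /cis /cexp !(cre_cx, cim_cx) expR0 toC1 mul1r.
Qed.
Lemma cis_2pi : cis pi2 = cis 0.
Proof. by rewrite /cis /cexp !(cre_cx, cim_cx) mulr_natl cos2pi sin2pi cos0 sin0. Qed.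

(** At 0 only continuity is asked, so that the lemma applies directly to a difference quotient
    completed by the derivative. Circle means are the same for all small radii and tend to the value
    at the centre. *)
Lemma mean_value (g : C -> C) (r r' : R) : 0 < r -> r < r' ->
  continuous_at 0 g ->
  (forall z, z != 0 -> cabs z < r' -> differentiable g z) ->
  cint 0 pi2 (fun t => g (toC r * cis t)) = toC pi2 * g 0.
Proof.
move=> r0 rr' cg dg.
have r'0 : 0 < r' by exact: lt_trans rr'.
have p0 : 0 <= pi2 by rewrite mulr_ge0 // pi_ge0.
have gc z : cabs z < r' -> continuous_at z g.
  have [->|z0] := eqVneq z 0; first by [].
  by move=> zr; apply: differentiable_continuous; exact: dg.
(* A radius strictly between [r] and [r']: the half-plane [x < s1] contains the line over the circle
   of radius [r], and [exp] maps its closure into the disc of radius [r']. *)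
pose s1 := ln ((r + r') / 2).
have m0 : 0 < (r + r') / 2 by rewrite divr_gt0 // addr_gt0.
have es1 : expR s1 = (r + r') / 2 by rewrite lnK // posrE.
have es1r : expR s1 < r' by rewrite es1; lra.
pose s0 := ln r.
have es0 : expR s0 = r by rewrite lnK // posrE.
have s01 : s0 < s1 by rewrite -ltr_expR es0 es1; lra.
(* [g \o cexp] is [2 pi i]-periodic, so Goursat makes its integral over vertical
   segments independent of the abscissa; [Num.min] only extends it continuously. *)
pose k z := g (cexp (cx (Num.min (cre z) s1) (cim z))).
have kd x y : x < s1 -> cdiff k (cx x y).
  move=> xs.
  have d1 : differentiable (fun z => g (cexp z)) (cx x y).
    apply: (differentiable_comp (differentiable_cexp _)); apply: dg; first exact: cexp_neq0.
    by rewrite cabs_cexp cre_cx (lt_trans _ es1r) // ltr_expR.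
  have /has_cderP H : is_derive (cx x y) (1 : C) (fun z => g (cexp z)) ('D_1 (fun z => g (cexp z)) (cx x y)).
    by apply: derivableP; apply/derivable1_diffP.
  apply: (@has_cder_cdiff _ _ _ ('D_1 (fun z => g (cexp z)) (cx x y))) => e /H[d d00 dP].
  exists (Num.min d (s1 - x)); first by rewrite lt_min d00 subr_gt0.
  move=> h; rewrite lt_min => /andP[hd hs].
  have kE z : cre z <= s1 -> k z = g (cexp z) by move=> zs; rewrite /k min_l // cx_re_im.
  have h1 : cre (cx x y + h) <= s1.
    by rewrite creD cre_cx -lerBrDl (le_trans (ler_norm _)) // (le_trans (cre_le h)) // ltW.
  have h2 : cre (cx x y) <= s1 by rewrite cre_cx ltW.
  by rewrite (kE _ h1) (kE _ h2); exact: dP.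
have kc : continuous k.
  move=> z; rewrite /k.
  apply: (@ct_comp _ _ _ _ _ (fun z => cexp (cx (Num.min (cre z) s1) (cim z))) g).
    apply: (@ct_comp _ _ _ _ _ (fun z => (cx (Num.min (cre z) s1) (cim z))) (@cexp R)).
      apply: cx_cont; last exact: cim_cont.
      apply: (@continuous_min _ _ (@cre R) (fun=> s1)); [exact: cre_cont|exact: ct_cst].
    by apply: differentiable_continuous; exact: differentiable_cexp.
  apply: gc; rewrite cabs_cexp cre_cx (le_lt_trans _ es1r) // ler_expR ge_min lexx orbT //.
pose h s := cint 0 pi2 (fun t => k (cx s t)).
have hs s s' : s <= s' -> s' < s1 -> h s = h s'.
  move=> ss ss1; have := @goursat _ k s s' 0 pi2 kc ss p0.
  rewrite /rect_int; have -> : (fun x => k (cx x pi2)) = (fun x => k (cx x 0)).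
    apply/funext => x; rewrite /k !cre_cx !cim_cx !cexp_polar cis_2pi //.
  rewrite subrr add0r => H.
  have /H : forall x y, s <= x <= s' -> 0 <= y <= pi2 -> cdiff k (cx x y).
    by move=> x y /andP[_ xs] _; apply: kd; exact: le_lt_trans ss1.
  move=> H2; apply/eqP; rewrite eq_sym -subr_eq0; apply/eqP.
  by apply: (mulfI (ci_neq0 R)); rewrite mulr0.
have kE s t : s <= s1 -> k (cx s t) = g (toC (expR s) * cis t).
  by move=> ss; rewrite /k cre_cx cim_cx min_l // cexp_polar.
have hk s : continuous (fun t => k (cx s t)) by apply: ccomp_ver.
have h0 : cint 0 pi2 (fun t => g (toC r * cis t)) = h s0.
  by apply: eq_cint => t; rewrite kE ?es0 // ltW.
rewrite h0; apply/eqP; rewrite -subr_eq0 -normr_eq0 normCE; apply/eqP.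
suff : cabs (h s0 - toC pi2 * g 0) <= 0.
  move=> le0; rewrite -(toC0 R); congr toC; apply/eqP; by rewrite eq_le le0 cabs_ge0.
apply/ler_addgt0Pr => e e0; rewrite add0r.
(* [cint_le] over [[0, 2 pi]] turns a bound [e'] into [4 pi e']. *)
pose e' := e / (4 * pi + 1).
have pp : 0 < 4 * pi + 1 :> R by rewrite ltr_wpDl // mulr_ge0 // pi_ge0.
have e'0 : 0 < e' by rewrite divr_gt0.
have /continuous_epsP /(_ (toC e')) := cg.
rewrite toC_gt0 => /(_ e'0) [_ /gt0_toC[d d0 ->] dP].
pose s := Num.min (ln (d / 2)) s0.
have sd : expR s < d.
  have : expR s <= expR (ln (d / 2)) by rewrite ler_expR ge_min lexx.
  rewrite lnK ?posrE ?divr_gt0 //; lra.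
have ss0 : s <= s0 by rewrite ge_min lexx orbT.
have -> : toC pi2 * g 0 = cint 0 pi2 (fun=> g 0) by rewrite cint_cst // subr0 mulrC.
rewrite -(hs s s0) //.
have H : forall x, 0 <= x <= pi2 -> cabs (k (cx s x) - g 0) <= e'.
  move=> x _; rewrite kE; last by rewrite (le_trans ss0) // ltW.
  have := dP (toC (expR s) * cis x); rewrite add0r normrN !normCE !toC_lt.
  rewrite cabsM cabs_cis mulr1 cabs_toC ger0_norm ?expR_ge0 // => /(_ sd) /ltW.
  by rewrite -(cabsN (g 0 - _)) opprB.
have cc : continuous (fun t => k (cx s t) - g 0).
  move=> t; apply: (ctB (f := fun t => k (cx s t))); [exact: hk|exact: ct_cst].
have := cint_le cc p0 H; rewrite cintB; last by [move=> t; exact: ct_cst]. 2: exact: hk.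
move/le_trans; apply; rewrite subr0.
have <- : e' * (4 * pi + 1) = e by rewrite /e' divfK // gt_eqF.
lra.
Qed.
End mean_value.

(** * Differentials through explicit estimates *)

Section differentials.
Variables (K : numFieldType) (V W : normedModType K).
Implicit Types (f g : V -> W) (x : V).

Lemma diff_eps f x : differentiable f x -> forall e, 0 < e -> exists2 d, 0 < d &
  forall h, `|h| < d -> `|f (h + x) - f x - 'd f x h| <= e * `|h|.
Proof.
move=> /diff_locallyP [cd /eqaddoP E] e e0.
have /nbhs_ballP[d d0 dP] := E e e0.
exists d => // h hd; have /= := dP h; rewrite -ball_normE /= sub0r normrN => /(_ hd).
by rewrite !fctE /= opprD addrA.
Qed.

(** The bound [M] stands in for continuity of the candidate [L], and uniqueness of the differential
    identifies the directional derivatives as well. *)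
Lemma diff_intro f x (L : V -> W) (M : K) : linear L ->
  (forall h, `|L h| <= M * `|h|) ->
  (forall e, 0 < e -> exists2 d, 0 < d &
    forall h, `|h| < d -> `|f (h + x) - f x - L h| <= e * `|h|) ->
  differentiable f x /\ forall h, 'D_h f x = L h.
Proof.
move=> linL bL H.
pose L' : {linear V -> W} := HB.pack L (GRing.isLinear.Build _ _ _ _ L linL).
have M0 : 0 < `|M| + 1 by rewrite ltr_wpDl.
have cL : continuous L'.
  move=> y; apply/continuous_epsP => e e0; exists (e / (`|M| + 1)); first by rewrite divr_gt0.
  move=> z yz; rewrite -linearB /=; apply: le_lt_trans (bL _) _.
  have [->|yz0] := eqVneq (y - z) 0; first by rewrite normr0 mulr0.
  have r : M * `|y - z| <= (`|M| + 1) * `|y - z|.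
    (* [M] is any element of the field; the bound at the nonzero vector [y - z] forces it to be
       real, hence comparable. *)
    have Mr : M \is Num.real.
      have := le_trans (normr_ge0 _) (bL (y - z)); rewrite pmulr_lge0 ?normr_gt0 //; exact: ger0_real.
    by rewrite ler_wpM2r // (le_trans (real_ler_norm Mr)) // lerDl.
  by apply: le_lt_trans r _; rewrite mulrC -ltr_pdivlMr.
have E : f \o shift x = cst (f x) + L' +o_ 0 id.
  apply/eqaddoP => e e0; have [d d0 dP] := H e e0.
  apply/nbhs_ballP; exists d => // h; rewrite -ball_normE /= sub0r normrN => hd.
  by rewrite !fctE /= opprD addrA; exact: dP.
have dE := diff_unique cL E.
have df : differentiable f x.
  apply/diff_locallyP; split; first by rewrite dE.
  by rewrite dE.
by split=> // h; rewrite deriveE // dE.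
Qed.

Lemma diff_bounded f x : differentiable f x -> exists M, forall h, `|'d f x h| <= M * `|h|.
Proof.
move=> df; have [M M0 H] := linear_lipschitz (diff_continuous df).
by exists M => h; exact: H.
Qed.

End differentials.

Section real_norm.
Variable R : realType.
Local Notation C := (Cplx R).

(** Norms over the complex field are complex numbers; their real parts allow real order
    arguments. *)
Definition nrm (V : normedModType C) (v : V) : R := cre `|v|.
Lemma nrmE (V : normedModType C) (v : V) : `|v| = toC (nrm v).
Proof. exact: ge0_toC. Qed.
Lemma nrm_ge0 (V : normedModType C) (v : V) : 0 <= nrm v.
Proof. by rewrite -toC_ge0 -nrmE. Qed.
Lemma nrmZ (V : normedModType C) (a : C) (v : V) : nrm (a *: v) = cabs a * nrm v.
Proof. by apply: toC_inj; rewrite toCM -!nrmE -normCE normrZ. Qed.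
Lemma nrmD (V : normedModType C) (u v : V) : nrm (u + v) <= nrm u + nrm v.
Proof. by rewrite -toC_le toCD -!nrmE ler_normD. Qed.
Lemma nrmN (V : normedModType C) (v : V) : nrm (- v) = nrm v.
Proof. by rewrite /nrm normrN. Qed.
Lemma nrm0 (V : normedModType C) : nrm (0 : V) = 0.
Proof. by apply: toC_inj; rewrite -nrmE normr0. Qed.
Lemma nrm_eq0 (V : normedModType C) (v : V) : (nrm v == 0) = (v == 0).
Proof. by rewrite -[in RHS]normr_eq0 nrmE -(toC0 R) (inj_eq (@toC_inj R)). Qed.
Lemma nrmC (z : C) : nrm z = cabs z.
Proof. by apply: toC_inj; rewrite -nrmE. Qed.

(** Derivatives are local. This is the device for differentiating an identity that holds on an open
    set only. *)
Lemma near_eq_diff (V W : normedModType C) (f g : V -> W) (x : V) (r : R) : 0 < r ->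
  (forall y, nrm (y - x) < r -> f y = g y) -> differentiable f x ->
  differentiable g x /\ forall h, 'D_h g x = 'D_h f x.
Proof.
move=> r0 fg df; have [M MP] := diff_bounded df.
have fg' h : nrm h < r -> f (h + x) = g (h + x) by move=> hr; apply: fg; rewrite addrK.
have fgx : f x = g x by apply: fg; rewrite subrr nrm0.
have linL : linear ('d f x) by move=> a u v; exact: linearP.
have [] := @diff_intro _ _ _ g x _ M linL MP; last first.
  by move=> dg E; split=> // h; rewrite E deriveE.
move=> _ /gt0_toC[e e0 ->]; have [|_ /gt0_toC[d d0 ->] dP] := diff_eps df (e := toC e).
  by rewrite toC_gt0.
exists (toC (Num.min d r)) => [|h]; first by rewrite toC_gt0 lt_min d0.
rewrite nrmE toC_lt lt_min => /andP[hd hr]; rewrite -fg' // -fgx -nrmE; apply: dP.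
by rewrite nrmE toC_lt.
Qed.

Lemma open_nrm (V : normedModType C) (U : set V) (x : V) : open U -> U x ->
  exists2 d : R, 0 < d & forall y, nrm (y - x) < d -> U y.
Proof.
move=> oU Ux; have /nbhs_ballP[_ /gt0_toC[d d0 ->] dP] := open_nbhs_nbhs (conj oU Ux).
exists d => // y yx; apply: dP.
by rewrite -ball_normE /= -normrN opprB nrmE toC_lt.
Qed.
Lemma nrm_open (V : normedModType C) (x : V) (d : R) : open [set y | nrm (y - x) < d].
Proof.
have -> : [set y | nrm (y - x) < d] = [set y | `|x - y| < toC d].
  by apply/seteqP; split=> y /=; rewrite -normrN opprB nrmE toC_lt.
have [d0|d0] := ltP 0 d.
  have -> : [set y | `|x - y| < toC d] = ball x (toC d) by rewrite -ball_normE.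
  by apply: ball_open; rewrite toC_gt0.
have -> : [set y | `|x - y| < toC d] = set0; last exact: open0.
by apply/seteqP; split=> y //=; rewrite nrmE toC_lt ltNge (le_trans d0) // nrm_ge0.
Qed.
Lemma cont_nrm (V W : normedModType C) (f : V -> W) (x : V) : continuous_at x f <->
  forall e : R, 0 < e -> exists2 d : R, 0 < d & forall y, nrm (y - x) < d -> nrm (f y - f x) < e.
Proof.
split=> [/continuous_epsP H e e0|H].
  have [|_ /gt0_toC[d d0 ->] dP] := H (toC e); first by rewrite toC_gt0.
  exists d => // y yx; have := dP y.
  by rewrite -normrN opprB nrmE toC_lt => /(_ yx); rewrite -normrN opprB nrmE toC_lt.
apply/continuous_epsP => _ /gt0_toC[e e0 ->]; have [d d0 dP] := H e e0.
exists (toC d); rewrite ?toC_gt0 // => y.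
by rewrite -normrN opprB nrmE toC_lt => /dP; rewrite -(nrmN (f y - _)) opprB nrmE toC_lt.
Qed.

Section onevar.
Variable V : normedModType C.
Implicit Types (f : V -> C) (x v : V).

Lemma is_derive_line f x v (z : C) : derivable f (x + z *: v) v ->
  is_derive z (1 : C) (fun z => f (x + z *: v)) ('D_v f (x + z *: v)).
Proof.
move=> df; apply/is_deriveP => e e0.
have /is_deriveP /(_ e e0)[d d0 dP] := derivableP df.
exists d => // h /dP; have E : h *: (1 : C) = h by exact: mulr1.
by rewrite E scalerDl addrCA.
Qed.

Lemma is_derive_seg f x v (t : R) (L : C) : is_derive (x + toC t *: v) v f L ->
  is_derive t (1 : R) (fun t => cre (f (x + toC t *: v))) (cre L) /\
  is_derive t (1 : R) (fun t => cim (f (x + toC t *: v))) (cim L).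
Proof.
move=> /is_deriveP H.
have Eh (h : R) : h *: (1 : R) = h by exact: mulr1.
have ES (h y : R) : h *: y = h * y by [].
have EC (h y : C) : h *: y = h * y by [].
split; apply/is_deriveP => e e0.
  have [|_ /gt0_toC[d d0 ->] dP] := H (toC e); first by rewrite toC_gt0.
  exists d => // h hd; have := dP (toC h); rewrite !normCE !cabs_toC toC_lt -toCM toC_le => /(_ hd).
  apply: le_trans; apply: le_trans (cre_le _).
  by rewrite Eh ES EC toCD scalerDl addrCA !(creD, creN, creM, cre_toC, cim_toC) mul0r subr0.
have [|_ /gt0_toC[d d0 ->] dP] := H (toC e); first by rewrite toC_gt0.
exists d => // h hd; have := dP (toC h); rewrite !normCE !cabs_toC toC_lt -toCM toC_le => /(_ hd).
apply: le_trans; apply: le_trans (cim_le _).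
by rewrite Eh ES EC toCD scalerDl addrCA !(cimD, cimN, cimM, cre_toC, cim_toC) mul0r addr0.
Qed.

Lemma real_mvt (g g' : R -> R) (K : R) :
  (forall t : R, 0 <= t <= 1 -> is_derive t (1 : R) g (g' t)) ->
  (forall t : R, 0 <= t <= 1 -> `|g' t| <= K) -> `|g 1 - g 0| <= K.
Proof.
move=> dg gK; have [||c] := @MVT _ g g' 0 1 ltr01.
- by move=> t; rewrite in_itv /= => /andP[t0 t1]; apply: dg; rewrite !ltW.
- apply: derivable_within_continuous => t; rewrite in_itv /= => t01.
  by have [] := dg t t01.
rewrite in_itv /= => /andP[c0 c1] ->; rewrite subr0 mulr1.
by apply: gK; rewrite !ltW.
Qed.

(** The mean value theorem fails for complex values; it is applied to real and imaginary parts along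
    the segment, whence the factor 2. *)
Lemma mvt_ineq f x v (K : R) :
  (forall t : R, 0 <= t <= 1 -> derivable f (x + toC t *: v) v) ->
  (forall t : R, 0 <= t <= 1 -> cabs ('D_v f (x + toC t *: v)) <= K) ->
  cabs (f (x + v) - f x) <= 2 * K.
Proof.
move=> df fK; rewrite (le_trans (cabs_le _)) // mulr_natl mulr2n.
have E0 : f x = f (x + toC 0 *: v) by rewrite toC0 scale0r addr0.
have E1 : f (x + v) = f (x + toC 1 *: v) by rewrite toC1 scale1r.
rewrite E0 E1 !creD !cimD !creN !cimN lerD //.
  apply: (@real_mvt (fun t => cre (f (x + toC t *: v))) (fun t => cre ('D_v f (x + toC t *: v)))).
    by move=> t /df /derivableP /is_derive_seg [].
  by move=> t /fK; apply: le_trans; exact: cre_le.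
apply: (@real_mvt (fun t => cim (f (x + toC t *: v))) (fun t => cim ('D_v f (x + toC t *: v)))).
  by move=> t /df /derivableP /is_derive_seg [].
by move=> t /fK; apply: le_trans; exact: cim_le.
Qed.
End onevar.
End real_norm.

(** * Cauchy's formula along complex lines *)

Section cauchy.
Variable R : realType.
Local Notation C := (Cplx R).
Local Notation pi2 := (2 * pi : R).

Lemma pi2_gt0 : 0 < pi2. Proof. by rewrite mulr_gt0 // pi_gt0. Qed.

Lemma diff_derv (V W : normedModType C) (f : V -> W) (x v : V) : differentiable f x -> derivable f x v.
Proof. by move=> df; apply: diff_derivable. Qed.
Arguments diff_derv {V W f x} v _.

Section line.
Variable V : normedModType C.
Implicit Types (f : V -> C) (x v : V).

Definition dline f x v (r : R) := forall z : C, cabs z < r -> differentiable f (x + z *: v).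

Lemma dline_le f x v r s : s <= r -> dline f x v r -> dline f x v s.
Proof. by move=> sr H z zs; apply: H; exact: lt_le_trans sr. Qed.
Lemma dline_shift f x v r s (z : C) : cabs z + s <= r -> dline f x v r -> dline f (x + z *: v) v s.
Proof.
move=> zr H w ws; rewrite -addrA -scalerDl; apply: H.
by rewrite (le_lt_trans (cabsD _ _)) // (lt_le_trans _ zr) // ltrD2l.
Qed.
Lemma circ_neq0 (r t : R) : 0 < r -> toC r * cis t != 0.
Proof.
move=> r0; rewrite mulf_neq0 //; last exact: cexp_neq0.
by rewrite gt_eqF // toC_gt0.
Qed.
Lemma cabs_circ (r t : R) : 0 < r -> cabs (toC r * cis t) = r.
Proof. by move=> r0; rewrite cabsM cabs_cis mulr1 cabs_toC ger0_norm // ltW. Qed.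
Lemma cabsV (z : C) : cabs z^-1 = (cabs z)^-1.
Proof. by apply: toC_inj; rewrite toCV -!normCE normfV. Qed.
Lemma circ_cont (r : R) : continuous (fun t => toC r * cis t).
Proof. by move=> t; ct; exact: cis_cont. Qed.
Lemma circV_cont (r : R) : 0 < r -> continuous (fun t => (toC r * cis t)^-1).
Proof.
move=> r0 t; apply: (@ct_comp _ _ _ _ _ (fun t => toC r * cis t) (fun z : C => z^-1)).
  exact: circ_cont.
by apply: inv_continuous; exact: circ_neq0.
Qed.
Lemma line_cont x v : continuous (fun z : C => x + z *: v).
Proof. by move=> z; ct. Qed.
Lemma circ_int_cont f x v r r' : 0 < r -> r < r' -> dline f x v r' ->
  continuous (fun t => (f (x + (toC r * cis t) *: v) - f x) * (toC r * cis t)^-1).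
Proof.
move=> r0 rr H t; ct; last exact: circV_cont.
apply: (@ct_comp _ _ _ _ _ (fun t => x + (toC r * cis t) *: v) f).
  apply: (@ct_comp _ _ _ _ _ (fun t => toC r * cis t) (fun z : C => x + z *: v)).
    exact: circ_cont.
  exact: line_cont.
by apply: differentiable_continuous; apply: H; rewrite cabs_circ.
Qed.

Lemma diff_line f x v (z : C) : differentiable f (x + z *: v) ->
  differentiable (fun z : C => f (x + z *: v)) z.
Proof.
move=> df; apply/derivable1_diffP; have /is_derive_line [] // := diff_derv v df.
Qed.

(** Mean value property of the difference quotient of [z -> f (x + z v)], whose value at the centre
    is the derivative. *)
Lemma cauchy_formula f x v r r' : 0 < r -> r < r' -> dline f x v r' ->
  toC pi2 * 'D_v f x =
  cint 0 pi2 (fun t => (f (x + (toC r * cis t) *: v) - f x) * (toC r * cis t)^-1).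
Proof.
move=> r0 rr H.
pose g (z : C) := f (x + z *: v).
have g0 : g 0 = f x by rewrite /g scale0r addr0.
pose q (z : C) := if z == 0 then 'D_v f x else (g z - g 0) * z^-1.
have dg z : cabs z < r' -> differentiable g z by move=> zr; apply: diff_line; exact: H.
have H0 : differentiable f (x + (0 : C) *: v) by apply: H; rewrite cabs0 (lt_trans r0).
have E0 : x + (0 : C) *: v = x by rewrite scale0r addr0.
have dg0 : is_derive (0 : C) (1 : C) g ('D_v f x).
  by have := is_derive_line (diff_derv v H0); rewrite E0.
have <- : q 0 = 'D_v f x by rewrite /q eqxx.
rewrite -(@mean_value _ q r r' r0 rr).
- by apply: eq_cint => t; rewrite /q (negbTE (circ_neq0 _ r0)) g0.
- apply/cont_nrm => e e0; move/has_cderP : dg0 => /(_ (e / 2)); rewrite divr_gt0 // => /(_ isT)[d d0 dP].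
  exists d => // h; rewrite subr0 !nrmC => hd; have [->|h0] := eqVneq h 0.
    by rewrite subrr cabs0.
  have -> : q h - q 0 = (g h - g 0 - 'D_v f x * h) * h^-1.
    by rewrite /q (negbTE h0) eqxx [RHS]mulrBl mulfK.
  have := dP h hd; rewrite add0r => h1.
  have h2 : 0 < cabs h by rewrite -toC_gt0 -normCE normr_gt0.
  by rewrite cabsM cabsV ltr_pdivrMr // (le_lt_trans h1) // ltr_pM2r //; lra.
- move=> z z0 zr.
  have d1 : differentiable (fun z => (g z - g 0) * z^-1) z.
    apply: differentiableM; last by apply: differentiable_Rinv.
    by apply: differentiableB; [exact: dg | exact: differentiable_cst].
  have h2 : 0 < cabs z by rewrite -toC_gt0 -normCE normr_gt0.
  apply: (proj1 (near_eq_diff h2 _ d1)) => w; rewrite nrmC /q.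
  have [-> |//] := eqVneq w 0.
  by rewrite sub0r cabsN ltxx.
Qed.

(** Cauchy's formula on the circle of radius [r / 2]: a difference of at most [2 M], divided by
    [r / 2], doubled by [cint_le]. *)
Lemma deriv_bound f x v r M : 0 < r -> dline f x v r ->
  (forall z, cabs z < r -> cabs (f (x + z *: v)) <= M) -> cabs ('D_v f x) <= 8 * M / r.
Proof.
move=> r0 H fM; have r20 : 0 < r / 2 by rewrite divr_gt0.
have r2r : r / 2 < r by lra.
have E := cauchy_formula r20 r2r H.
have p0 := pi2_gt0.
have fx : cabs (f x) <= M by rewrite -[x in f x]addr0 -(scale0r v); apply: fM; rewrite cabs0.
have b : forall t : R, 0 <= t <= pi2 ->
   cabs ((f (x + (toC (r / 2) * cis t) *: v) - f x) * (toC (r / 2) * cis t)^-1) <= 2 * M / (r / 2).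
  move=> t _; rewrite cabsM cabsV cabs_circ // ler_wpM2r ?invr_ge0 ?(ltW r20) //.
  rewrite (le_trans (cabsB _ _)) // mulr_natl mulr2n lerD // fM // cabs_circ //.
have := cint_le (circ_int_cont r20 r2r H) (ltW p0) b.
rewrite -E cabsM cabs_toC (ger0_norm (ltW p0)) subr0 mulrA mulrC ler_pM2r // => /le_trans; apply.
by rewrite invf_div le_eqVlt; apply/orP; left; apply/eqP; field; rewrite gt_eqF.
Qed.

Lemma deriv_scale f x v (c : C) : differentiable f x -> 'D_(c *: v) f x = c * 'D_v f x.
Proof. by move=> df; rewrite !deriveE // linearZ. Qed.

Section quad.
Variables (f : V -> C) (x v : V) (r M : R).
Hypotheses (r4 : 4 <= r) (H : dline f x v r)
  (fM : forall z, cabs z < r -> cabs (f (x + z *: v)) <= M).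
Let r0 : 0 < r. Proof. by apply: lt_le_trans r4. Qed.
Let r2r : r / 2 < r. Proof. by rewrite ltr_pdivrMr // ltr_pMr // ltr1n. Qed.

Lemma line_deriv_bound (z : C) : cabs z < r / 2 -> cabs ('D_v f (x + z *: v)) <= 16 * (M / r).
Proof.
move=> zr; have r20 : 0 < r / 2 by rewrite divr_gt0.
have -> : 16 * (M / r) = 8 * M / (r / 2) by field; rewrite gt_eqF.
apply: deriv_bound => //.
  by apply: dline_shift H; lra.
move=> w wr; rewrite -addrA -scalerDl; apply: fM.
rewrite (le_lt_trans (cabsD _ _)) //; lra.
Qed.

Lemma line_lip (z w : C) : cabs z < r / 2 -> cabs w < r / 2 ->
  cabs (f (x + w *: v) - f (x + z *: v)) <= 32 * (M / r) * cabs (w - z).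
Proof.
move=> zr wr.
have -> : x + w *: v = (x + z *: v) + (w - z) *: v by rewrite -addrA -scalerDl addrCA subrr addr0.
have conv (t : R) : 0 <= t <= 1 -> cabs (z + toC t * (w - z)) < r / 2.
  move=> /andP[t0 t1]; have -> : z + toC t * (w - z) = toC (1 - t) * z + toC t * w.
    by rewrite toCB toC1; ring.
  rewrite (le_lt_trans (cabsD _ _)) // !cabsM !cabs_toC !ger0_norm ?subr_ge0 //.
  have a1 : (1 - t) * cabs z + t * cabs w <= (1 - t) * Num.max (cabs z) (cabs w) + t * Num.max (cabs z) (cabs w).
    by rewrite lerD // ler_wpM2l ?subr_ge0 // le_max lexx ?orbT.
  rewrite (le_lt_trans a1) // -mulrDl subrK mul1r gt_max zr //.
have E (t : R) : x + z *: v + toC t *: ((w - z) *: v) = x + (z + toC t * (w - z)) *: v.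
  by rewrite scalerA -addrA -scalerDl.
have -> : 32 * (M / r) * cabs (w - z) = 2 * (16 * (M / r) * cabs (w - z)) by ring.
apply: mvt_ineq => t t01; rewrite E.
  by apply: diff_derivable; apply: H; exact: lt_trans (conv t t01) r2r.
rewrite deriv_scale; last by apply: H; exact: lt_trans (conv t t01) r2r.
by rewrite cabsM mulrC ler_wpM2r ?cabs_ge0 // line_deriv_bound // conv.
Qed.

(** Cauchy's formulas at [x + z v] and at [x], both with radius [r / 8], are subtracted. By
    [line_lip] the integrand is at most [64 (M / r) |z|] over [r / 8], and [cint_le] doubles
    this. *)
Lemma line_deriv_lip (z : C) : cabs z <= 1 ->
  cabs ('D_v f (x + z *: v) - 'D_v f x) <= 1024 * (M / r / r) * cabs z.
Proof.
move=> z1.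
have z2 : cabs z < r / 2 by rewrite (le_lt_trans z1) // ltr_pdivlMr // mul1r (lt_le_trans _ r4) // ltr_nat.
have s0 : 0 < r / 8 by rewrite divr_gt0.
have ss : r / 8 < r / 4 by lra.
have Hx : dline f x v (r / 4) by apply: dline_le H; lra.
have h4 : 1 + r / 4 <= r by move: r4 => r4'; lra.
have Hz : dline f (x + z *: v) v (r / 4).
  by apply: dline_shift H; apply: le_trans h4; rewrite lerD2r.
have p0 := pi2_gt0.
have E : toC pi2 * ('D_v f (x + z *: v) - 'D_v f x) =
  cint 0 pi2 (fun t => (f (x + z *: v + (toC (r / 8) * cis t) *: v) - f (x + z *: v)) * (toC (r / 8) * cis t)^-1 -
    (f (x + (toC (r / 8) * cis t) *: v) - f x) * (toC (r / 8) * cis t)^-1).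
  apply: etrans (mulrBr _ _ _) _.
  apply: etrans (congr2 (fun a b => a - b) (cauchy_formula s0 ss Hz) (cauchy_formula s0 ss Hx)) _.
  apply: esym; apply: cintB; first exact: (circ_int_cont s0 ss Hz).
  exact: (circ_int_cont s0 ss Hx).
have cc : continuous (fun t => (f (x + z *: v + (toC (r / 8) * cis t) *: v) - f (x + z *: v)) * (toC (r / 8) * cis t)^-1 -
    (f (x + (toC (r / 8) * cis t) *: v) - f x) * (toC (r / 8) * cis t)^-1).
  move=> t; apply: ctB; first exact: (circ_int_cont s0 ss Hz).
  exact: (circ_int_cont s0 ss Hx).
have b : forall t : R, 0 <= t <= pi2 -> cabs ((f (x + z *: v + (toC (r / 8) * cis t) *: v) - f (x + z *: v)) * (toC (r / 8) * cis t)^-1 -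
    (f (x + (toC (r / 8) * cis t) *: v) - f x) * (toC (r / 8) * cis t)^-1) <= 512 * (M / r / r) * cabs z.
  move=> t _; set c := toC (r / 8) * cis t.
  have cr : cabs c = r / 8 by rewrite cabs_circ.
  rewrite -mulrBl cabsM cabsV cr.
  have -> : f (x + z *: v + c *: v) - f (x + z *: v) - (f (x + c *: v) - f x) =
     (f (x + (z + c) *: v) - f (x + c *: v)) - (f (x + z *: v) - f (x + 0 *: v)).
    rewrite scale0r addr0 scalerDl addrA; ring.
  have l1 : cabs (f (x + (z + c) *: v) - f (x + c *: v)) <= 32 * (M / r) * cabs (z + c - c).
    apply: line_lip; first by rewrite cr; lra.
    rewrite (le_lt_trans (cabsD _ _)) // cr; apply: (le_lt_trans (lerD z1 (lexx _))); move: r4 => r4'; lra.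
  have l2 : cabs (f (x + z *: v) - f (x + 0 *: v)) <= 32 * (M / r) * cabs (z - 0).
    apply: line_lip; first by rewrite cabs0 divr_gt0.
    exact: z2.
  rewrite addrK in l1; rewrite subr0 in l2.
  have l3 := le_trans (cabsB _ _) (lerD l1 l2).
  have -> : 512 * (M / r / r) * cabs z = (32 * (M / r) * cabs z + 32 * (M / r) * cabs z) / (r / 8).
    by field; rewrite gt_eqF.
  by rewrite ler_wpM2r // invr_ge0 ltW.
have := cint_le cc (ltW p0) b.
rewrite -E cabsM cabs_toC (ger0_norm (ltW p0)) subr0 mulrA mulrC ler_pM2r // => /le_trans; apply.
by rewrite le_eqVlt; apply/orP; left; apply/eqP; ring.
Qed.

(** Mean value inequality for [z -> f (x + z v) - z D_v f x]. The constant involves only [M] and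
    [r], so the remainder is uniform in a parameter, as differentiation under the integral sign
    requires. *)
Lemma line_quad : cabs (f (x + v) - f x - 'D_v f x) <= 2048 * (M / r / r).
Proof.
pose g (z : C) := f (x + z *: v) - z * 'D_v f x.
have -> : f (x + v) - f x - 'D_v f x = g (0 + 1) - g 0.
  by rewrite /g add0r scale1r mul1r scale0r addr0 mul0r subr0; ring.
have -> : 2048 * (M / r / r) = 2 * (1024 * (M / r / r)) by ring.
have M0 : 0 <= M by apply: le_trans (cabs_ge0 _) (fM (z := 0) _); rewrite cabs0.
have dg (t : R) : 0 <= t <= 1 -> is_derive (toC t) (1 : C) g ('D_v f (x + toC t *: v) - 'D_v f x).
  move=> /andP[t0 t1].
  have d1 : is_derive (toC t) (1 : C) (fun z : C => f (x + z *: v)) ('D_v f (x + toC t *: v)).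
    apply: is_derive_line; apply: diff_derivable; apply: H.
    by rewrite cabs_toC ger0_norm // (le_lt_trans t1) // (lt_le_trans _ r4) // ltr1n.
  have d2 : is_derive (toC t) (1 : C) (fun z : C => z * 'D_v f x) ('D_v f x).
    apply/has_cderP => e e0; exists 1 => // h _.
    have -> : (toC t + h) * 'D_v f x - toC t * 'D_v f x - 'D_v f x * h = 0 by ring.
    by rewrite cabs0 mulr_ge0 ?cabs_ge0 // ltW.
  exact: is_deriveB.
have E1 (t : R) : (0 : C) + toC t *: (1 : C) = toC t by rewrite add0r; exact: mulr1.
apply: mvt_ineq => t t01; rewrite E1; have [d1 d2] := dg t t01 => //.
rewrite d2; move: t01 => /andP[t0 t1].
have := @line_deriv_lip (toC t); rewrite cabs_toC ger0_norm // => /(_ t1) /le_trans; apply.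
have r0' : 0 <= r by exact: ltW.
have h : 0 <= M / r / r by rewrite divr_ge0 // divr_ge0.
apply: ler_piMr; [exact: mulr_ge0 (ler0n _ _) h|exact: t1].
Qed.
End quad.
End line.
End cauchy.
Arguments diff_derv {R V W f x} v _.

(** * Derivatives of holomorphic maps *)

Section parametric_integral.
Variable R : realType.
Local Notation C := (Cplx R).

Section ballquad.
Variable V : normedModType C.
Variables (f : V -> C) (x : V) (d M : R).
Hypotheses (d0 : 0 < d) (H : forall y, nrm (y - x) < d -> differentiable f y /\ cabs (f y) <= M).

Let lineP h (z : C) : cabs z < d / nrm h -> h != 0 -> nrm (x + z *: h - x) < d.
Proof.
move=> zd h0; rewrite addrAC subrr add0r nrmZ -ltr_pdivlMr //.
by rewrite lt_neqAle nrm_ge0 eq_sym nrm_eq0 h0.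
Qed.
Lemma ball_bound0 : 0 <= M.
Proof. by have [|_] := H (y := x); [rewrite subrr nrm0|apply: le_trans; exact: cabs_ge0]. Qed.
Lemma ball_deriv_bound h : cabs ('D_h f x) <= 8 * M / d * nrm h.
Proof.
have [->|h0] := eqVneq h 0; first by rewrite derive0 cabs0 nrm0 mulr0.
have n0 : 0 < nrm h by rewrite lt_neqAle nrm_ge0 eq_sym nrm_eq0 h0.
have -> : 8 * M / d * nrm h = 8 * M / (d / nrm h) by field; rewrite !gt_eqF.
apply: deriv_bound; first by rewrite divr_gt0.
  by move=> z zr; apply: (proj1 (H _)); exact: lineP.
by move=> z zr; apply: (proj2 (H _)); exact: lineP.
Qed.
(** The line in direction [h] stays in the ball for [|z| < d / nrm h], and [nrm h <= d / 4] makes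
    this radius at least 4, as [line_quad] asks. *)
Lemma ball_quad h : nrm h <= d / 4 ->
  cabs (f (x + h) - f x - 'D_h f x) <= 2048 * (M / d / d) * (nrm h * nrm h).
Proof.
move=> hd; have [->|h0] := eqVneq h 0.
  by rewrite derive0 addr0 subrr subr0 cabs0 nrm0 !mulr0.
have n0 : 0 < nrm h by rewrite lt_neqAle nrm_ge0 eq_sym nrm_eq0 h0.
have -> : 2048 * (M / d / d) * (nrm h * nrm h) = 2048 * (M / (d / nrm h) / (d / nrm h)).
  by field; rewrite !gt_eqF.
apply: line_quad.
- by rewrite ler_pdivlMr // mulrC -ler_pdivlMr.
- by move=> z zr; apply: (proj1 (H _)); exact: lineP.
- by move=> z zr; apply: (proj2 (H _)); exact: lineP.
Qed.
End ballquad.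

Section param.
Variable V : normedModType C.
Variables (Phi : R -> V -> C) (x0 : V) (d M a b : R).
Hypotheses (ab : a <= b).
Hypothesis H : forall t y, nrm (y - x0) < d -> differentiable (Phi t) y /\ cabs (Phi t y) <= M.
Hypothesis cPhi : forall y, nrm (y - x0) < d -> continuous (Phi^~ y).

Variable y : V.
Hypothesis yd : nrm (y - x0) < d.
Let e := d - nrm (y - x0).
Let e0 : 0 < e. Proof. by rewrite subr_gt0. Qed.
Let e4 : e / 4 < e. Proof. by rewrite ltr_pdivrMr // ltr_pMr // ltr1n. Qed.
Let inb z : nrm (z - y) < e -> nrm (z - x0) < d.
Proof.
move=> ze; have -> : z - x0 = (z - y) + (y - x0) by rewrite addrA subrK.
by rewrite (le_lt_trans (nrmD _ _)) // -ltrBrDr.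
Qed.
Let He t z : nrm (z - y) < e -> differentiable (Phi t) z /\ cabs (Phi t z) <= M.
Proof. by move=> /inb; exact: H. Qed.
Let quad0 : exists2 K : R, 0 <= K & forall t h, nrm h <= e / 4 ->
  cabs (Phi t (y + h) - Phi t y - 'D_h (Phi t) y) <= K * (nrm h * nrm h).
Proof.
exists (2048 * (M / e / e)).
  have M0 := @ball_bound0 V (Phi 0) y e M e0 (@He 0).
  apply: mulr_ge0; [exact: ler0n|by rewrite !divr_ge0 // ltW].
by move=> t h; exact: (@ball_quad V (Phi t) y e M e0 (@He t) h).
Qed.

(** By [ball_quad] a difference quotient with one fixed step [u] is close to the derivative for all
    [t] at once; it is continuous in [t], so the derivative is. *)
Lemma param_deriv_cont h : continuous (fun t => 'D_h (Phi t) y).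
Proof.
have [K K0 quad] := quad0; move=> t0; have n0 := nrm_ge0 h.
have dfy t : differentiable (Phi t) y by have [] := @He t y; rewrite ?subrr ?nrm0.
apply/continuous_epsP => _ /gt0_toC[q q0 ->].
pose u := Num.min (e / 4 / (nrm h + 1)) (q / 4 / (K * (nrm h * nrm h) + 1)).
have p1 : 0 < nrm h + 1 by rewrite ltr_wpDl.
have p2 : 0 < K * (nrm h * nrm h) + 1 by rewrite ltr_wpDl // mulr_ge0 // mulr_ge0.
have u0 : 0 < u by rewrite lt_min !divr_gt0.
have u1 : u * nrm h <= e / 4.
  have : u <= e / 4 / (nrm h + 1) by rewrite ge_min lexx.
  rewrite ler_pdivlMr // => h1; apply: le_trans h1; rewrite ler_wpM2l ?(ltW u0) // lerDl ler01 //.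
have u2 : u * (K * (nrm h * nrm h)) < q / 3.
  have : u <= q / 4 / (K * (nrm h * nrm h) + 1) by rewrite ge_min lexx orbT.
  rewrite ler_pdivlMr // mulrDr mulr1 => h1; apply: (@le_lt_trans _ _ (q / 4)); last by lra.
  by apply: le_trans h1; rewrite lerDl ltW.
pose w t := (Phi t (y + toC u *: h) - Phi t y) * (toC u)^-1.
have nu : nrm (toC u *: h) = u * nrm h by rewrite nrmZ cabs_toC ger0_norm // ltW.
have u00 : toC u != 0 by rewrite gt_eqF // toC_gt0.
have close t : cabs (w t - 'D_h (Phi t) y) < q / 3.
  have := @quad t (toC u *: h); rewrite nu => /(_ u1).
  rewrite deriv_scale // => h1.
  have -> : w t - 'D_h (Phi t) y = (Phi t (y + toC u *: h) - Phi t y - toC u * 'D_h (Phi t) y) * (toC u)^-1.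
    by rewrite [RHS]mulrBl mulrAC divff // mul1r.
  rewrite cabsM cabsV cabs_toC ger0_norm ?(ltW u0) // ltr_pdivrMr // (le_lt_trans h1) //.
  have -> : K * (u * nrm h * (u * nrm h)) = u * (K * (nrm h * nrm h)) * u by ring.
  by rewrite ltr_pM2r.
have cw : continuous w.
  have i1 : nrm (y + toC u *: h - x0) < d.
    by apply: inb; rewrite addrAC subrr add0r nu (le_lt_trans u1 e4).
  move=> t; apply: ctM; last exact: ct_cst.
  by apply: ctB; [exact: (cPhi i1)|exact: (cPhi yd)].
have /continuous_epsP /(_ (toC (q / 3))) := cw t0.
rewrite toC_gt0 divr_gt0 // => /(_ isT)[r r0 rP]; exists r => // t /rP.
rewrite !normCE !toC_lt => h3.
have tri (w0 w1 A B : C) : cabs (A - B) <= cabs (w0 - w1) + cabs (w0 - A) + cabs (w1 - B).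
  have -> : A - B = (w0 - w1) - (w0 - A) + (w1 - B) by ring.
  by rewrite (le_trans (cabsD _ _)) // lerD2r cabsB.
apply: le_lt_trans (tri (w t0) (w t) _ _) _.
have -> : q = q / 3 + q / 3 + q / 3 by lra.
by apply: ltrD; [apply: ltrD|].
Qed.

(** The quadratic remainder is bounded uniformly in [t], hence survives integration. *)
Lemma param_int : differentiable (fun y => cint a b (Phi^~ y)) y /\
  forall h, 'D_h (fun y => cint a b (Phi^~ y)) y = cint a b (fun t => 'D_h (Phi t) y).
Proof.
have dfy t : differentiable (Phi t) y by have [] := @He t y; rewrite ?subrr ?nrm0.
pose L h := cint a b (fun t => 'D_h (Phi t) y).
have linL : linear L.
  move=> k u v; have -> : k *: L u = k * L u by [].
  rewrite /L -cintZ; last exact: param_deriv_cont.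
  rewrite -cintD; last exact: param_deriv_cont.
    by apply: eq_cint => t; rewrite !deriveE // linearP.
  by apply: ccontZ; exact: param_deriv_cont.
apply: (@diff_intro _ _ _ _ _ L (toC (2 * (8 * M / e * (b - a))))) => //.
  move=> h; rewrite normCE nrmE -toCM toC_le.
  have -> : 2 * (8 * M / e * (b - a)) * nrm h = 2 * (8 * M / e * nrm h * (b - a)) by ring.
  apply: cint_le => //; first exact: param_deriv_cont.
  by move=> t _; exact: (@ball_deriv_bound V (Phi t) y e M e0 (@He t) h).
have [K K0 quad] := quad0; move=> _ /gt0_toC[q q0 ->].
pose r := Num.min (e / 4) (q / (2 * K * (b - a) + 1)).
have ba : 0 <= b - a by rewrite subr_ge0.
have p2 : 0 < 2 * K * (b - a) + 1 by rewrite ltr_wpDl // !mulr_ge0.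
exists (toC r); first by rewrite toC_gt0 lt_min !divr_gt0.
move=> h; rewrite nrmE toC_lt lt_min => /andP[h1 h2].
have i1 : nrm (h + y - x0) < d by apply: inb; rewrite addrK (lt_trans h1 e4) //.
rewrite normCE -toCM toC_le.
have c1 := cPhi i1; have c2 := cPhi yd; have c3 := @param_deriv_cont h.
have c12 : continuous (fun t => Phi t (h + y) - Phi t y) by move=> t; apply: ctB; [exact: c1|exact: c2].
have -> : cint a b (Phi^~ (h + y)) - cint a b (Phi^~ y) - L h =
  cint a b (fun t => Phi t (h + y) - Phi t y - 'D_h (Phi t) y).
  exact: etrans (congr1 (fun z => z - L h) (esym (cintB a b c1 c2))) (esym (cintB a b c12 c3)).
have cc : continuous (fun t => Phi t (h + y) - Phi t y - 'D_h (Phi t) y).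
  by move=> t; apply: ctB; [apply: ctB; [exact: c1|exact: c2]|exact: c3].
have H1 : cabs (cint a b (fun t => Phi t (h + y) - Phi t y - 'D_h (Phi t) y)) <=
    2 * (K * (nrm h * nrm h) * (b - a)).
  by apply: cint_le => // t _; rewrite (addrC h); apply: quad; exact: ltW.
apply: le_trans H1 _.
move: h2; rewrite ltr_pdivlMr // mulrDr mulr1 => h2.
have -> : 2 * (K * (nrm h * nrm h) * (b - a)) = nrm h * (2 * K * (b - a)) * nrm h by ring.
rewrite ler_wpM2r ?nrm_ge0 // ltW // (le_lt_trans _ h2) // lerDl nrm_ge0 //.
Qed.
End param.
End parametric_integral.

Section holomorphic_derivatives.
Variable R : realType.
Local Notation C := (Cplx R).
Local Notation pi2 := (2 * pi : R).
Variable V : normedModType C.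
Implicit Types (f : V -> C) (x v : V).

Lemma diff_shift f x (a : V) : differentiable f (x + a) ->
  differentiable (fun y => f (y + a)) x /\ forall h, 'D_h (fun y => f (y + a)) x = 'D_h f (x + a).
Proof.
move=> df; have [M MP] := diff_bounded df.
have linL : linear ('d f (x + a)) by move=> k u v; exact: linearP.
have [] := @diff_intro _ _ _ (fun y => f (y + a)) x _ M linL MP; last first.
  move=> dg E; split; [exact: dg|move=> h; exact: etrans (E h) (esym (deriveE h df))].
by move=> e /(diff_eps df)[d d0 dP]; exists d => // h /dP; rewrite addrA.
Qed.

Lemma diffBZ f g x (k : C) : differentiable f x -> differentiable g x ->
  differentiable (fun y => (f y - g y) * k) x /\
  forall h, 'D_h (fun y => (f y - g y) * k) x = ('D_h f x - 'D_h g x) * k.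
Proof.
move=> df dg.
have dB : differentiable (fun y => f y - g y) x by exact: differentiableB.
have E : (fun y => (f y - g y) * k) = k *: (fun y => f y - g y).
  by apply/funext => y; rewrite mulrC.
rewrite E; split; first exact: differentiableZ.
move=> h; rewrite deriveZ; last exact: diff_derivable.
rewrite [RHS]mulrC; congr (k * _).
by rewrite -deriveB //; exact: diff_derivable.
Qed.

Section local.
Variables (f : V -> C) (x0 : V) (d M : R).
Hypotheses (d0 : 0 < d) (H : forall y, nrm (y - x0) < d -> differentiable f y /\ cabs (f y) <= M).
Variable v : V.
(** Radius for Cauchy's formula in direction [v]: circles of radius below [2 crad] around points of
    the ball [d / 3] stay in the ball [d]. The added 1 covers [v = 0]. *)
Definition crad (d : R) (v : V) : R := d / (3 * (nrm v + 1)).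
Let r := crad d v.
Lemma crad_gt0 : 0 < crad d v.
Proof. by rewrite /crad divr_gt0 // mulr_gt0 // ltr_wpDl // nrm_ge0. Qed.
Lemma crad_small : 3 * (crad d v * nrm v) <= d.
Proof.
rewrite /crad; have p : 0 < nrm v + 1 by rewrite ltr_wpDl // nrm_ge0.
have -> : 3 * (d / (3 * (nrm v + 1)) * nrm v) = d * (nrm v / (nrm v + 1)) by field; rewrite gt_eqF.
by rewrite ler_piMr ?(ltW d0) // ler_pdivrMr // mul1r lerDl.
Qed.
Lemma crad_ball y (z : C) : nrm (y - x0) < d / 3 -> cabs z < 2 * crad d v -> nrm (y + z *: v - x0) < d.
Proof.
move=> yd zr; rewrite addrAC (le_lt_trans (nrmD _ _)) // nrmZ.
have h1 : cabs z * nrm v <= 2 * crad d v * nrm v by rewrite ler_wpM2r ?nrm_ge0 // ltW.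
have := crad_small; move: h1 yd; move: (cabs z * nrm v) (nrm _) (crad d v) (nrm v) => *; lra.
Qed.

(** Near [x0] Cauchy's formula writes [D_v f] as an integral whose integrand is differentiable in
    the base point, and [param_int] differentiates it. The result has [D_h f] in the place of [f],
    which is the key to symmetry. *)
Lemma deriv_diff : differentiable ('D_v f) x0 /\
  forall h, 'D_h ('D_v f) x0 = (toC pi2)^-1 *
    cint 0 pi2 (fun t => ('D_h f (x0 + (toC r * cis t) *: v) - 'D_h f x0) * (toC r * cis t)^-1).
Proof.
have r0 : 0 < r by exact: crad_gt0.
have rr : r < 2 * r by rewrite ltr_pMl // ltr1n.
have p0 := pi2_gt0 R.
have d30 : 0 < d / 3 by rewrite divr_gt0.
pose Phi t y := (f (y + (toC r * cis t) *: v) - f y) * (toC r * cis t)^-1.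
have dl y : nrm (y - x0) < d / 3 -> dline f y v (2 * r).
  by move=> yd z zr; apply: (proj1 (H _)); exact: crad_ball.
have inb y t : nrm (y - x0) < d / 3 -> nrm (y + (toC r * cis t) *: v - x0) < d.
  by move=> yd; apply: crad_ball => //; rewrite cabs_circ.
have inb0 y : nrm (y - x0) < d / 3 -> nrm (y - x0) < d.
  by move=> yd; apply: lt_trans yd _; rewrite ltr_pdivrMr // ltr_pMr // ltr1n.
have PhiP t y : nrm (y - x0) < d / 3 -> [/\ differentiable (Phi t) y, cabs (Phi t y) <= (M + M) / r &
   forall h, 'D_h (Phi t) y = ('D_h f (y + (toC r * cis t) *: v) - 'D_h f y) * (toC r * cis t)^-1].
  move=> yd; have [d1 b1] := H (inb y t yd); have [d2 b2] := H (inb0 y yd).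
  have [d3 E3] := diff_shift d1; have [d4 E4] := diffBZ (toC r * cis t)^-1 d3 d2.
  split.
  exact d4. 
2: { move=> h. have E5 := (congr1 (fun z => (z - 'D_h f y) * (toC r * cis t)^-1) (E3 h)). 
  have E6 := E4 h. 
  exact (etrans E6 E5). }
  rewrite cabsM cabsV cabs_circ // ler_wpM2r ?invr_ge0 ?(ltW r0) //.
  by rewrite (le_trans (cabsB _ _)) // lerD.
have x0b : nrm (x0 - x0) < d / 3 by rewrite subrr nrm0.
have [dF EF] := @param_int R V Phi x0 (d / 3) ((M + M) / r) 0 pi2 (ltW p0)
  (fun t y yd => let: And3 a b c := PhiP t y yd in conj a b)
  (fun y yd => circ_int_cont r0 rr (dl y yd)) x0 x0b.
have pn : toC pi2 != 0 by rewrite gt_eqF // toC_gt0.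
have dF2 : differentiable (fun y => (cint 0 pi2 (Phi^~ y) - 0) * (toC pi2)^-1) x0.
  exact: (proj1 (diffBZ (toC pi2)^-1 dF (differentiable_cst (0 : C) x0))).
have EF2 := proj2 (diffBZ (toC pi2)^-1 dF (differentiable_cst (0 : C) x0)).
have [] := near_eq_diff (g := 'D_v f) d30 _ dF2.
  move=> y yd; rewrite subr0 /Phi -(cauchy_formula r0 rr (dl y yd)).
  by rewrite mulrC mulKf.
move=> d1 E1; split; first exact d1.
have gen (p q s k : C) : p = s -> q = 0 -> (p - q) * k = k * s.
  by move=> -> ->; rewrite subr0 mulrC.
move=> h; refine (eq_trans (E1 h) (eq_trans (EF2 h) (eq_trans (gen _ _ _ _ (EF h) (derive_cst _ _ _)) _))).
refine (congr1 (fun z => (toC pi2)^-1 * z) _); apply: eq_cint => t.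
have [_ _ E5] := PhiP t x0 x0b; exact (E5 h).
Qed.
End local.

Lemma local_bound f (U : set V) x : open U -> holomorphic_on U f -> U x ->
  exists d M : R, 0 < d /\ forall y, nrm (y - x) < d -> [/\ U y, differentiable f y & cabs (f y) <= M].
Proof.
move=> oU hf Ux; have [d1 d10 d1P] := open_nrm oU Ux.
have /cont_nrm /(_ 1 ltr01)[d2 d20 d2P] := differentiable_continuous (hf x Ux).
exists (Num.min d1 d2), (cabs (f x) + 1); split; first by rewrite lt_min d10.
move=> y; rewrite lt_min => /andP[/d1P Uy /d2P]; rewrite nrmC => h.
split=> //; first exact: hf.
have -> : f y = f x + (f y - f x) by ring.
by rewrite (le_trans (cabsD _ _)) // lerD2l ltW.
Qed.

Lemma holo_derive f (U : set V) v : open U -> holomorphic_on U f -> holomorphic_on U ('D_v f).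
Proof.
move=> oU hf x Ux; have [d [M [d0 H]]] := local_bound oU hf Ux.
by have [] := deriv_diff d0 (fun y yd => let: And3 a b c := H y yd in conj b c) v.
Qed.

(** The integral that [deriv_diff] gives for [D_w (D_v f)] is Cauchy's formula for [D_v] applied to
    [D_w f]. *)
Lemma holo_schwarz f (U : set V) v w x : open U -> holomorphic_on U f -> U x ->
  'D_w ('D_v f) x = 'D_v ('D_w f) x.
Proof.
move=> oU hf Ux; have [d [M [d0 H]]] := local_bound oU hf Ux.
have [_ E] := deriv_diff d0 (fun y yd => let: And3 a b c := H y yd in conj b c) v.
refine (eq_trans (E w) _).
have r0 := crad_gt0 d0 v.
have rr : crad d v < 2 * crad d v by rewrite ltr_pMl // ltr1n.
have dl : dline ('D_w f) x v (2 * crad d v).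
  move=> z zr; apply: (@holo_derive f U w oU hf); have [] // := H (x + z *: v).
  by apply: crad_ball zr => //; rewrite subrr nrm0 divr_gt0.
refine (eq_trans (congr1 (fun z => (toC pi2)^-1 * z) (esym (cauchy_formula r0 rr dl))) _).
have pn : toC pi2 != 0 by rewrite gt_eqF // toC_gt0; exact: pi2_gt0.
exact: (mulKf pn).
Qed.
End holomorphic_derivatives.

(** * Matrix-valued maps and closed 1-forms *)

Section matrix_calculus.
Variables (K : numFieldType) (V : normedModType K).
Implicit Types (x h : V).

Lemma diff_bigsum (W : normedModType K) (I : Type) (r : seq I) (F : I -> V -> W) x :
  (forall i, differentiable (F i) x) -> differentiable (fun y => \sum_(i <- r) F i y) x.
Proof.
move=> dF; elim: r => [|i r IH].
  have -> : (fun y => \sum_(i <- [::]) F i y) = cst 0 by apply/funext => y; rewrite big_nil.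
  exact: differentiable_cst.
have -> : (fun y => \sum_(j <- i :: r) F j y) = F i + (fun y => \sum_(j <- r) F j y).
  by apply/funext => y; rewrite big_cons.
exact: differentiableD.
Qed.
Lemma diff_bigprod (I : Type) (r : seq I) (F : I -> V -> K) x :
  (forall i, differentiable (F i) x) -> differentiable (fun y => \prod_(i <- r) F i y) x.
Proof.
move=> dF; elim: r => [|i r IH].
  have -> : (fun y => \prod_(i <- [::]) F i y) = cst 1 by apply/funext => y; rewrite big_nil.
  exact: differentiable_cst.
have -> : (fun y => \prod_(j <- i :: r) F j y) = F i * (fun y => \prod_(j <- r) F j y).
  by apply/funext => y; rewrite big_cons.
exact: differentiableM.
Qed.

Lemma diff_entry m n (M : V -> 'M[K]_(m, n)) x i j : differentiable M x ->
  differentiable (fun y => M y i j) x.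
Proof.
move=> dM; apply: (differentiable_comp (g := fun A : 'M[K]_(m, n) => A i j)) => //.
exact: differentiable_coord.
Qed.
Lemma derive_entry m n (M : V -> 'M[K]_(m, n)) x h i j : differentiable M x ->
  'D_h (fun y => M y i j) x = ('D_h M x) i j.
Proof.
move=> dM; rewrite !deriveE //; last exact: diff_entry.
have E := @diff_comp _ _ _ _ M (fun A : 'M[K]_(m, n) => A i j) x dM (differentiable_coord _ _ _).
have -> : (fun y => M y i j) = (fun A : 'M[K]_(m, n) => A i j) \o M by [].
rewrite E /=.
have cc : continuous (fun A : 'M[K]_(m, n) => A i j).
  by move=> A; apply: differentiable_continuous; exact: differentiable_coord.
have lin : linear (fun A : 'M[K]_(m, n) => A i j) by move=> k A B; rewrite !mxE.
pose L : {linear 'M[K]_(m, n) -> K} := HB.pack (fun A : 'M[K]_(m, n) => A i j) (GRing.isLinear.Build _ _ _ _ _ lin).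
by rewrite -[fun A : 'M[K]_(m, n) => A i j]/(L : _ -> _) diff_lin.
Qed.
Lemma diff_mx m n (M : V -> 'M[K]_(m, n)) x :
  (forall i j, differentiable (fun y => M y i j) x) -> differentiable M x.
Proof.
move=> dM; have -> : M = (fun y => \sum_(i < m) \sum_(j < n) M y i j *: delta_mx i j).
  by apply/funext => y; exact: matrix_sum_delta.
apply: diff_bigsum => i; apply: diff_bigsum => j.
exact: differentiableZl.
Qed.
Lemma derive_sumE (I : Type) (r : seq I) (F : I -> V -> K) x h :
  (forall i, differentiable (F i) x) ->
  'D_h (fun y => \sum_(i <- r) F i y) x = \sum_(i <- r) 'D_h (F i) x.
Proof.
move=> dF; elim: r => [|i r IH].
  have -> : (fun y => \sum_(i <- [::]) F i y) = cst 0 by apply/funext => y; rewrite big_nil.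
  by rewrite big_nil derive_cst.
have -> : (fun y => \sum_(j <- i :: r) F j y) = F i + (fun y => \sum_(j <- r) F j y).
  by apply/funext => y; rewrite big_cons.
rewrite big_cons -IH deriveD //; first exact: diff_derivable.
by apply: diff_derivable; exact: diff_bigsum.
Qed.
Lemma diff_mul m n p (A : V -> 'M[K]_(m, n)) (B : V -> 'M[K]_(n, p)) x :
  differentiable A x -> differentiable B x -> differentiable (fun y => A y *m B y) x.
Proof.
move=> dA dB; apply: diff_mx => i j.
have -> : (fun y => (A y *m B y) i j) = (fun y => \sum_k A y i k * B y k j).
  by apply/funext => y; rewrite mxE.
by apply: diff_bigsum => k; apply: differentiableM; exact: diff_entry.
Qed.
Lemma derive_mul m n p (A : V -> 'M[K]_(m, n)) (B : V -> 'M[K]_(n, p)) x h :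
  differentiable A x -> differentiable B x ->
  'D_h (fun y => A y *m B y) x = 'D_h A x *m B x + A x *m 'D_h B x.
Proof.
move=> dA dB; apply/matrixP => i j; rewrite -derive_entry; last exact: diff_mul.
have -> : (fun y => (A y *m B y) i j) = (fun y => \sum_k A y i k * B y k j).
  by apply/funext => y; rewrite mxE.
rewrite derive_sumE => [|k]; last by apply: differentiableM; exact: diff_entry.
rewrite !mxE -big_split /=; apply: eq_bigr => k _.
have dAk : derivable (fun y => A y i k) x h by apply: diff_derivable; exact: diff_entry.
have dBk : derivable (fun y => B y k j) x h by apply: diff_derivable; exact: diff_entry.
rewrite -(derive_entry h i k dA) -(derive_entry h k j dB).
apply: etrans (deriveM dAk dBk) _; rewrite addrC; congr (_ + _); exact: mulrC.
Qed.
Lemma diff_det n (A : V -> 'M[K]_n) x : differentiable A x -> differentiable (fun y => \det (A y)) x.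
Proof.
move=> dA; apply: diff_bigsum => s; apply: differentiableM; first exact: differentiable_cst.
by apply: diff_bigprod => i; exact: diff_entry.
Qed.
Lemma diff_adj n (A : V -> 'M[K]_n) x : differentiable A x -> differentiable (fun y => \adj (A y)) x.
Proof.
move=> dA; apply: diff_mx => i j.
have -> : (fun y => (\adj (A y)) i j) = (fun y => cofactor (A y) j i) by apply/funext => y; rewrite mxE.
apply: differentiableM; first exact: differentiable_cst.
apply: diff_det; apply: diff_mx => k l.
have -> : (fun y => (row' j (col' i (A y))) k l) = (fun y => A y (lift j k) (lift i l)).
  by apply/funext => y; rewrite !mxE.
exact: diff_entry.
Qed.
End matrix_calculus.

Section matrix_inverse.
Variable R : realType.
Local Notation C := (Cplx R).
Variable V : normedModType C.
Implicit Types (x h : V).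
Lemma near_unit n (A : V -> 'M[C]_n) x : differentiable A x -> A x \in unitmx ->
  exists2 d : R, 0 < d & forall y, nrm (y - x) < d -> A y \in unitmx.
Proof.
move=> dA; rewrite unitmxE unitfE => u.
have := differentiable_continuous (diff_det dA) => /cont_nrm H.
have n0 : 0 < cabs (\det (A x)) by rewrite -toC_gt0 -normCE normr_gt0.
have [d d0 dP] := H _ n0; exists d; first exact d0.
move=> y /dP h; rewrite unitmxE unitfE; apply/eqP => E.
by move: h; rewrite nrmC E sub0r cabsN ltxx.
Qed.
Lemma diff_inv n (A : V -> 'M[C]_n) x : differentiable A x -> A x \in unitmx ->
  differentiable (fun y => invmx (A y)) x.
Proof.
move=> dA u; have [d d0 dP] := near_unit dA u.
have d1 : differentiable (fun y => (\det (A y))^-1 *: \adj (A y)) x.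
  apply: diff_mx => i j.
  have -> : (fun y => ((\det (A y))^-1 *: \adj (A y)) i j) = (fun y => (\det (A y))^-1 * (\adj (A y)) i j).
    by apply/funext => y; rewrite mxE.
  apply: differentiableM; last by apply: diff_entry; exact: diff_adj.
  apply: differentiableV; first exact: diff_det.
  by move: u; rewrite unitmxE unitfE.
by apply: (proj1 (near_eq_diff d0 _ d1)) => y /dP uy; rewrite /invmx uy.
Qed.
Lemma derive_inv n (A : V -> 'M[C]_n) x h : differentiable A x -> A x \in unitmx ->
  'D_h (fun y => invmx (A y)) x = - (invmx (A x) *m 'D_h A x *m invmx (A x)).
Proof.
move=> dA u; have [d d0 dP] := near_unit dA u.
have d1 : differentiable (fun y => A y *m invmx (A y)) x by apply: diff_mul => //; exact: diff_inv.
have [_ E] := near_eq_diff d0 (fun y yd => mulmxV (dP y yd)) d1.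
have := E h; rewrite derive_mul //; last exact: diff_inv.
rewrite (derive_cst (1%:M : 'M[C]_n) x h) => /esym H.
have : invmx (A x) *m ('D_h A x *m invmx (A x) + A x *m 'D_h (fun y => invmx (A y)) x) = 0 by rewrite H mulmx0.
by rewrite mulmxDr !mulmxA mulVmx // mul1mx => /eqP; rewrite addrC addr_eq0 => /eqP.
Qed.
Lemma holo_derive_mx m n (M : V -> 'M[C]_(m, n)) (U : set V) v : open U ->
  holomorphic_on U M -> holomorphic_on U ('D_v M).
Proof.
move=> oU hM x Ux; apply: diff_mx => i j.
have [d d0 dP] := open_nrm oU Ux.
have hij : holomorphic_on U (fun y => M y i j) by move=> y Uy; apply: diff_entry; exact: hM.
have d1 := @holo_derive R V _ U v oU hij x Ux.
by apply: (proj1 (near_eq_diff d0 _ d1)) => y /dP Uy; rewrite derive_entry //; exact: hM.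
Qed.
Lemma holo_schwarz_mx m n (M : V -> 'M[C]_(m, n)) (U : set V) v w x : open U ->
  holomorphic_on U M -> U x -> 'D_w ('D_v M) x = 'D_v ('D_w M) x.
Proof.
move=> oU hM Ux; apply/matrixP => i j.
have hij : holomorphic_on U (fun y => M y i j) by move=> y Uy; apply: diff_entry; exact: hM.
have [d d0 dP] := open_nrm oU Ux.
have key u u' : ('D_u ('D_u' M) x) i j = 'D_u ('D_u' (fun y => M y i j)) x.
  have d1 := @holo_derive_mx _ _ M U u' oU hM x Ux.
  refine (eq_trans (esym (derive_entry u i j d1)) _).
  have [_ E] := near_eq_diff (f := fun y => ('D_u' M y) i j) (g := 'D_u' (fun y => M y i j)) d0
    (fun y yd => esym (derive_entry u' i j (hM y (dP y yd)))) (diff_entry i j d1).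
  exact (esym (E u)).
refine (eq_trans (key w v) (eq_trans _ (esym (key v w)))).
exact: (@holo_schwarz R V _ U v w x oU hij Ux).
Qed.
End matrix_inverse.

(** * Closed 1-forms near a point *)

Section closed_forms.
Variable R : realType.
Local Notation C := (Cplx R).

Section affine.
Variable V : normedModType C.
Lemma diff_affine (f : V -> C) (x0 x : V) (k : C) : differentiable f (x0 + k *: (x - x0)) ->
  differentiable (fun y => f (x0 + k *: (y - x0))) x /\
  forall h, 'D_h (fun y => f (x0 + k *: (y - x0))) x = k * 'D_h f (x0 + k *: (x - x0)).
Proof.
move=> df; have [M MP] := diff_bounded df.
set z := x0 + k *: (x - x0) in df MP *.
have linL : linear (fun h => k * 'd f z h).
  by move=> a u v; rewrite linearP mulrDr; congr (_ + _); rewrite mulrCA.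
have bL h : `|k * 'd f z h| <= (`|k| * M) * `|h|.
  by rewrite normrM -mulrA ler_wpM2l.
have [] := @diff_intro _ _ _ (fun y => f (x0 + k *: (y - x0))) x _ _ linL bL; last first.
  move=> dg E; split; [exact dg|move=> h; refine (eq_trans (E h) _)].
  exact (congr1 (fun w => k * w) (esym (deriveE h df))).
move=> _ /gt0_toC[e e0 ->].
have k0 : 0 < cabs k + 1 by rewrite ltr_wpDl // cabs_ge0.
have e1 : 0 < toC (e / (cabs k + 1)) by rewrite toC_gt0 divr_gt0.
have [_ /gt0_toC[d d0 ->] dP] := diff_eps df e1.
exists (toC (d / (cabs k + 1))); first by rewrite toC_gt0 divr_gt0.
move=> h; rewrite nrmE toC_lt => hd.
have n0 := nrm_ge0 h.
have kh : nrm (k *: h) <= (cabs k + 1) * nrm h by rewrite nrmZ ler_wpM2r // lerDl ler01.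
have := dP (k *: h); rewrite !nrmE toC_lt => H.
have /H : nrm (k *: h) < d.
  by rewrite (le_lt_trans kh) // mulrC -ltr_pdivlMr.
have -> : k *: h + z = x0 + k *: (h + x - x0).
  by rewrite /z addrCA -scalerDr addrA.
rewrite -!toCM !toC_le linearZ /= => H1.
apply: le_trans H1 _; rewrite -mulrA ler_wpM2l ?(ltW e0) //.
by rewrite mulrC ler_pdivrMr // mulrC.
Qed.
End affine.

(** Extends the integrand of the Poincare lemma to all real parameters, where the integral lemmas
    ask for continuity and bounds. *)
Definition clamp (t : R) : R := Num.max 0 (Num.min 1 t).
Lemma clamp_itv t : 0 <= clamp t <= 1.
Proof. by rewrite /clamp le_max lexx /= ge_max ler01 ge_min lexx. Qed.
Lemma clampE t : 0 <= t <= 1 -> clamp t = t.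
Proof. by move=> /andP[t0 t1]; rewrite /clamp min_r // max_r. Qed.
Lemma clamp_cont : continuous clamp.
Proof.
move=> t; have c1 : continuous_at t (fun t : R => Num.min 1 t).
  by refine (@continuous_min _ _ (fun=> 1) (fun t => t) t _ _); [exact: ct_cst|exact: ct_id].
by refine (@continuous_max _ _ (fun=> 0) (fun t : R => Num.min 1 t) t _ c1); exact: ct_cst.
Qed.

Section poincare.
Variable d : nat.
Local Notation V := 'rV[C]_d.
Variables (U : set V) (x0 : V) (th : 'I_d -> V -> C).
Hypotheses (oU : open U) (Ux0 : U x0) (hth : forall i, holomorphic_on U (th i)).
Hypothesis closed_th : forall i j x, U x ->
  'D_(delta_mx 0 i) (th j) x = 'D_(delta_mx 0 j) (th i) x.

Lemma derive_sum_delta (f : V -> C) x u : differentiable f x ->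
  'D_u f x = \sum_i u 0 i * 'D_(delta_mx 0 i) f x.
Proof.
move=> df; rewrite deriveE // {1}[u]matrix_sum_delta big_ord1 linear_sum.
by apply: eq_bigr => i _; rewrite linearZ deriveE.
Qed.

Lemma common_ball : exists e M : R, 0 < e /\ forall y, nrm (y - x0) < e ->
  U y /\ forall i, cabs (th i y) <= M /\ cabs ((y - x0) 0 i) <= 1.
Proof.
have H i : exists2 e : R, 0 < e & forall y, nrm (y - x0) < e -> [/\ U y,
    cabs (th i y) <= cabs (th i x0) + 1 & cabs ((y - x0) 0 i) <= 1].
  have [e1 e10 e1P] := open_nrm oU Ux0.
  have /cont_nrm /(_ 1 ltr01)[e2 e20 e2P] := differentiable_continuous (hth i Ux0).
  have c3 : continuous_at x0 (fun y : V => y 0 i).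
    by apply: differentiable_continuous; exact: differentiable_coord.
  have /cont_nrm /(_ 1 ltr01)[e3 e30 e3P] := c3.
  exists (Num.min e1 (Num.min e2 e3)); first by rewrite !lt_min e10 e20.
  move=> y; rewrite !lt_min => /and3P[/e1P Uy /e2P h2 /e3P h3]; split=> //.
    have -> : th i y = th i x0 + (th i y - th i x0) by ring.
    by rewrite (le_trans (cabsD _ _)) // lerD2l -nrmC ltW.
  by rewrite !mxE -nrmC ltW.
pose e i := sval (cid2 (H i)).
have eP i := s2valP' (cid2 (H i)).
have e0 i : 0 < e i := s2valP (cid2 (H i)).
have [e1 e10 e1P] := open_nrm oU Ux0.
exists (Num.min e1 (\big[Num.min/1]_i e i)), (\sum_i (cabs (th i x0) + 1)); split.
  rewrite lt_min e10 /=; apply: (big_ind (fun z => 0 < z)) => //.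
  by move=> a b a0 b0; rewrite lt_min a0.
move=> y; rewrite lt_min => /andP[/e1P Uy ye]; split=> // i.
have yi : nrm (y - x0) < e i.
  by apply: lt_le_trans ye _; rewrite (bigD1 i) //= ge_min lexx.
have [_ h1 h2] := eP i y yi; split=> //; apply: le_trans h1 _.
rewrite (bigD1 i) //= lerDl sumr_ge0 // => j _; rewrite addr_ge0 ?cabs_ge0 //.
Qed.

(** The primitive is [int_0^1 sum_i (y - x0)_i th_i (x0 + t (y - x0)) dt]. By closedness the
    derivative of the integrand along the [j]-th coordinate is [d/dt (t th_j (x0 + t (y - x0)))],
    which integrates to [th_j y]. *)
Lemma poincare : exists (e : R) (h : V -> C), 0 < e /\ forall y, nrm (y - x0) < e ->
  [/\ U y, differentiable h y & forall i, 'D_(delta_mx 0 i) h y = th i y].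
Proof.
have [e [M [e0 eP]]] := common_ball.
pose pt t y := x0 + toC (clamp t) *: (y - x0) : V.
pose Phi t (y : V) := \sum_i (y - x0) 0 i * th i (pt t y).
have ptb t y : nrm (y - x0) < e -> nrm (pt t y - x0) < e.
  move=> ye; rewrite /pt addrAC subrr add0r nrmZ cabs_toC.
  have /andP[c0 c1] := clamp_itv t.
  by rewrite ger0_norm // (le_lt_trans _ ye) // ler_piMl ?nrm_ge0.
have dcoord y i : differentiable (fun y : V => (y - x0) 0 i) y /\
    forall w, 'D_w (fun y : V => (y - x0) 0 i) y = w 0 i.
  have dd : differentiable (fun y : V => y - x0) y.
    by apply: differentiableB; [exact: ex_diff|exact: differentiable_cst].
  split; first exact: diff_entry.
  move=> w; rewrite derive_entry //; congr (_ _ _).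
  rewrite deriveB; [|exact: derivable_id|exact: derivable_cst].
  by rewrite derive_id derive_cst subr0.
have dterm t y i : nrm (y - x0) < e -> differentiable (fun y => th i (pt t y)) y /\
    forall w, 'D_w (fun y => th i (pt t y)) y = toC (clamp t) * 'D_w (th i) (pt t y).
  move=> ye; apply: diff_affine; apply: hth.
  by have [] := eP _ (ptb t y ye).
have dprod t y i : nrm (y - x0) < e -> differentiable (fun y => (y - x0) 0 i * th i (pt t y)) y /\
    forall w, 'D_w (fun y => (y - x0) 0 i * th i (pt t y)) y =
      w 0 i * th i (pt t y) + (y - x0) 0 i * (toC (clamp t) * 'D_w (th i) (pt t y)).
  move=> ye; have [d1 E1] := dcoord y i; have [d2 E2] := dterm t y i ye.
  split; first exact: differentiableM d1 d2.
  move=> w; have := @deriveM _ _ (fun y : V => (y - x0) 0 i) (fun y => th i (pt t y)) y w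
     (diff_derv w d1) (diff_derv w d2).
  rewrite (E1 w) (E2 w) => E; refine (eq_trans E _).
  by rewrite addrC; congr (_ + _); exact: mulrC.
have H t y : nrm (y - x0) < e -> differentiable (Phi t) y /\ cabs (Phi t y) <= \sum_(i < d) M.
  move=> ye; split.
    by apply: diff_bigsum => i; have [] := dprod t y i ye.
  rewrite /Phi; have [_ b1] := eP y ye; have [_ b2] := eP _ (ptb t y ye).
  have : forall i, cabs ((y - x0) 0 i * th i (pt t y)) <= M.
    move=> i; have [_ h1] := b1 i; have [h2 _] := b2 i.
    by rewrite cabsM -[leRHS]mul1r ler_pM ?cabs_ge0.
  move=> bi; elim/big_rec2: _ => [|i u w _ uw]; first by rewrite cabs0.
  by rewrite (le_trans (cabsD _ _)) // lerD.
have cth y i : nrm (y - x0) < e -> continuous (fun t => th i (pt t y)).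
  move=> ye t; apply: (@ct_comp _ _ _ _ _ (fun t => pt t y) (th i)).
    rewrite /pt; ct.
    apply: (@ct_comp _ _ _ _ _ clamp (@toC R)); [exact: clamp_cont|exact: toC_cont].
  by apply: differentiable_continuous; apply: hth; have [] := eP _ (ptb t y ye).
have cPhi y : nrm (y - x0) < e -> continuous (Phi^~ y).
  move=> ye t; rewrite /Phi.
  have : forall s : seq 'I_d, continuous_at t (fun t => \sum_(i <- s) (y - x0) 0 i * th i (pt t y)).
    elim=> [|i s IH].
      have -> : (fun t => \sum_(i <- [::]) (y - x0) 0 i * th i (pt t y)) = (fun=> 0) by apply/funext => u; rewrite big_nil.
      exact: ct_cst.
    have -> : (fun t => \sum_(j <- i :: s) (y - x0) 0 j * th j (pt t y)) =
      (fun t => (y - x0) 0 i * th i (pt t y) + \sum_(j <- s) (y - x0) 0 j * th j (pt t y)).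
      by apply/funext => u; rewrite big_cons.
    apply: ctD; last exact: IH.
    by apply: ctM; [exact: ct_cst|exact: cth].
  exact.
exists e, (fun y => cint 0 1 (Phi^~ y)); split=> // y ye.
have [dh Eh] := param_int ler01 H cPhi ye.
split; [by have [] := eP y ye|exact: dh|move=> j].
refine (eq_trans (Eh _) _).
have cD := @param_deriv_cont _ _ _ _ _ _ H cPhi y ye (delta_mx 0 j).
pose g (z : C) := z * th j (x0 + z *: (y - x0)).
have DE t : 'D_(delta_mx 0 j) (Phi t) y =
    th j (pt t y) + toC (clamp t) * 'D_(y - x0) (th j) (pt t y).
  have Uz : U (pt t y) by have [] := eP _ (ptb t y ye).
  refine (eq_trans (derive_sumE _ _ (fun i => proj1 (dprod t y i ye))) _).
  rewrite (eq_bigr _ (fun i _ => proj2 (dprod t y i ye) (delta_mx 0 j))) big_split /=.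
  congr (_ + _).
    rewrite (bigD1 j) //= mxE !eqxx mul1r big1 ?addr0 // => i ij.
    by rewrite mxE (negbTE ij) andbF mul0r.
  rewrite (derive_sum_delta (y - x0) (hth j Uz)) mulr_sumr; apply: eq_bigr => i _.
  by rewrite (closed_th j i Uz) mulrCA.
have g1 : g (toC 1) = th j y by rewrite /g toC1 mul1r scale1r addrCA subrr addr0.
have g0 : g (toC 0) = 0 by rewrite /g toC0 mul0r.
rewrite -g1 -[g _]subr0 -g0.
refine (@cint_FTC R 0 1 (fun t => g (toC t)) _ cD ler01 _) => t t01.
have Ept : pt t y = x0 + toC t *: (y - x0) by rewrite /pt clampE.
have EL := DE t; rewrite Ept (clampE t01) in EL.
have Uz : U (x0 + toC t *: (y - x0)).
  by have [] := eP _ (ptb t y ye); rewrite /pt clampE.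
have dg : is_derive (0 + toC t *: (1 : C)) (1 : C) g
    (th j (x0 + toC t *: (y - x0)) + toC t * 'D_(y - x0) (th j) (x0 + toC t *: (y - x0))).
  have -> : 0 + toC t *: (1 : C) = toC t by rewrite add0r; exact: mulr1.
  have d1 := is_derive_line (diff_derv (y - x0) (hth j Uz)).
  have d2 := is_derive_id (toC t) (1 : C).
  have := is_deriveM d2 d1.
  have -> : id (toC t) *: 'D_(y - x0) (th j) (x0 + toC t *: (y - x0)) +
     th j (x0 + toC t *: (y - x0)) *: (1 : C) = th j (x0 + toC t *: (y - x0)) + toC t * 'D_(y - x0) (th j) (x0 + toC t *: (y - x0)).
    by rewrite addrC; congr (_ + _); exact: mulr1.
  exact.
have [s1 s2] := is_derive_seg dg.
have Eg (s : R) : g (0 + toC s *: (1 : C)) = g (toC s) by rewrite add0r; congr g; exact: mulr1.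
have E1 : (fun t0 : R => cre (g (0 + toC t0 *: (1 : C)))) = (fun t0 : R => cre (g (toC t0))).
  by apply/funext => s; rewrite Eg.
have E2 : (fun t0 : R => cim (g (0 + toC t0 *: (1 : C)))) = (fun t0 : R => cim (g (toC t0))).
  by apply/funext => s; rewrite Eg.
split; [exact (eq_ind _ (fun F => is_derive t (1 : R) F _) (eq_ind_r (fun L => is_derive t (1 : R) _ (cre L)) s1 EL) _ E1)|exact (eq_ind _ (fun F => is_derive t (1 : R) F _) (eq_ind_r (fun L => is_derive t (1 : R) _ (cim L)) s2 EL) _ E2)].
Qed.

(* [exp (- h)] for a potential [h] *)
Lemma exp_primitive : exists (e : R) (D : V -> C), 0 < e /\ forall y, nrm (y - x0) < e ->
  [/\ U y, differentiable D y, D y != 0 & forall i, 'D_(delta_mx 0 i) D y = - (th i y * D y)].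
Proof.
have [e [h [e0 H]]] := poincare; exists e, (fun y => cexp (- h y)); split=> // y ye.
have [Uy dh Eh] := H y ye.
have dn : differentiable (fun y => - h y) y by apply: differentiableN.
have dD : differentiable (fun y => cexp (- h y)) y.
  by apply: (differentiable_comp dn); exact: differentiable_cexp.
split=> //; first exact: cexp_neq0.
move=> i; rewrite deriveE //.
have -> : 'd (fun y => cexp (- h y)) y = 'd (@cexp R) (- h y) \o 'd (fun y => - h y) y :> (V -> C).
  exact: diff_comp dn (differentiable_cexp _).
rewrite /= -(deriveE _ dn) -deriveE; last exact: differentiable_cexp.
have dEn : 'D_(delta_mx 0 i) (fun y => - h y) y = - th i y.
  by refine (eq_trans (deriveN _) _); [exact: diff_derivable|rewrite Eh].
rewrite dEn -[- th i y]mulr1.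
have E1 (a : C) : a * 1 = a *: (1 : C) by [].
rewrite E1 deriv_scale; last exact: differentiable_cexp.
have [_ ->] := is_derive_cexp (- h y).
by rewrite mulNr.
Qed.
End poincare.
End closed_forms.

(** * Formal series of matrices *)

Import -(notations, coercions) Stdlib.setoid_ring.Ncring.
Import -(notations, coercions) Stdlib.setoid_ring.Ncring_tac.

(** * Identities in noncommutative rings *)

Section nc.
Variable A : pzRingType.
Local Instance nc_ops : @Ring_ops A 0 1 (@GRing.add A) (@GRing.mul A) (fun x y => x - y) (@GRing.opp A) (@eq A) := {}.
Local Instance nc_ring : @Ring A _ _ _ _ _ _ _ nc_ops.
Proof.
split; try exact _.
all: try by move=> x y -> u v ->.
all: try by move=> x y ->.
all: intros.
- exact (add0r _).
- exact (addrC _ _).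
- exact (addrA _ _ _).
- exact (mul1r _).
- exact (mulr1 _).
- exact (mulrA _ _ _).
- exact (mulrDl _ _ _).
- exact (mulrDr _ _ _).
- reflexivity.
- exact (subrr _).
Qed.
Ltac ncr := non_commutative_ring.
Implicit Types x y z : A.

(** Gauge invariance of flatness: [oa], [ob] are two components of a connection, primes mark their
    transforms by [g], and [ga], [daob] and the like are derivatives. The third and fourth
    hypotheses are the first two differentiated, with a common mixed derivative [gab]. *)
Lemma nc_flat_gauge (g oa ob oa' ob' ga gb daob dboa daob' dboa' gab : A) :
  g * oa' = oa * g + ga -> g * ob' = ob * g + gb ->
  gb * oa' + g * dboa' = dboa * g + oa * gb + gab ->
  ga * ob' + g * daob' = daob * g + ob * ga + gab ->
  daob - dboa + (oa * ob - ob * oa) = 0 ->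
  g * (daob' - dboa' + (oa' * ob' - ob' * oa')) = 0.
Proof.
move=> e1 e2 e3 e4 e5.
have h1 : ga = g * oa' - oa * g by rewrite e1; ncr.
have h2 : gb = g * ob' - ob * g by rewrite e2; ncr.
have h3 : g * dboa' = dboa * g + oa * gb + gab - gb * oa' by rewrite -e3; ncr.
have h4 : g * daob' = daob * g + ob * ga + gab - ga * ob' by rewrite -e4; ncr.
have -> : g * (daob' - dboa' + (oa' * ob' - ob' * oa')) =
  g * daob' - g * dboa' + g * oa' * ob' - g * ob' * oa' by ncr.
rewrite h3 h4 h1 h2.
have -> : daob * g + ob * (g * oa' - oa * g) + gab - (g * oa' - oa * g) * ob' -
  (dboa * g + oa * (g * ob' - ob * g) + gab - (g * ob' - ob * g) * oa') +
  g * oa' * ob' - g * ob' * oa' = (daob - dboa + (oa * ob - ob * oa)) * g by ncr.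
by rewrite e5 mul0r.
Qed.

(* [X] is the residual of the [x]-equation at order [k], [Z] that of the [w]-equation at order [k+1] *)
Lemma nc_residual (L c th B b F F' G dF dF' X Z : A) :
  L * c = c * L -> b * c = c * b -> th * L - L * th = c * B - B * c ->
  (L * F - F * L) + B * F' - F' * b = 0 ->
  (c * F - F * c) + (L * dF - dF * L) + ((B * th - th * B) * F' + B * dF') - dF' * b = 0 ->
  (F * c - c * F) + dF' + th * F' = 0 ->
  X = (G * c - c * G) + dF + th * F ->
  Z = (L * G - G * L) + B * F - F * (b - 1) ->
  Z * c - c * Z = L * X - X * L.
Proof.
move=> e1 e2 e3 e4 e5 e6 -> ->.
have h6 : dF' = - ((F * c - c * F) + th * F') by apply/eqP; rewrite -subr_eq0 -e6; apply/eqP; ncr.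
have h4 : L * F - F * L = F' * b - B * F' by apply/eqP; rewrite -subr_eq0 -e4; apply/eqP; ncr.
have h5 : L * dF - dF * L = dF' * b - (c * F - F * c) - ((B * th - th * B) * F' + B * dF').
  by apply/eqP; rewrite -subr_eq0 -e5; apply/eqP; ncr.
apply/eqP; rewrite -subr_eq0; apply/eqP.
transitivity ((G * (c * L - L * c) - (c * L - L * c) * G) +
  (B * (F * c - c * F) - (c * B - B * c) * F - (F * c - c * F) * b - F * (b * c - c * b) + (F * c - c * F))
  - (L * dF - dF * L) - ((L * th - th * L) * F + th * (L * F - F * L))); first ncr.
rewrite e1 e2 h4 h5 h6 (_ : L * th - th * L = - (c * B - B * c)); last by rewrite -e3; ncr.
ncr.
Qed.

(* the diagonal of the right-hand side vanishes when [c] and [L] are diagonal *)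
Lemma nc_residual_diag (L c th B b F G dF X : A) :
  th * L - L * th = c * B - B * c ->
  X = (G * c - c * G) + dF + th * F ->
  (L * G - G * L) + B * F - F * b = 0 ->
  B * X - X * b = ((B * th - th * B) * F + B * dF - dF * b) +
     ((B * G * c - c * (B * G)) + ((th * G) * L - L * (th * G))) - (G * c - c * G) * b.
Proof.
move=> e1 -> e2.
have h2 : B * F - F * b = - (L * G - G * L) by apply/eqP; rewrite -subr_eq0 -e2; apply/eqP; ncr.
apply/eqP; rewrite -subr_eq0; apply/eqP.
transitivity (th * (B * F - F * b) + c * (B * G) - (th * G) * L + L * (th * G) - B * (c * G)); first ncr.
rewrite h2.
transitivity ((c * B - B * c - (th * L - L * th)) * G); first ncr.
by rewrite e1 subrr mul0r.
Qed.
End nc.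

(** Course-of-values recursion through the lists of values already built. The hypothesis on [step]
    makes the default [x0] beyond the end of a list harmless. *)
Lemma strong_rec (T : Type) (x0 : T) (step : nat -> (nat -> T) -> T) :
  (forall k f g, (forall j, (j < k)%N -> f j = g j) -> step k f = step k g) ->
  exists f : nat -> T, forall k, f k = step k f.
Proof.
move=> H.
pose g := fix g n := if n is m.+1 then rcons (g m) (step m (nth x0 (g m))) else [::].
have sg n : size (g n) = n by elim: n => //= n IH; rewrite size_rcons IH.
have st n m j : (j < n)%N -> nth x0 (g (n + m)%N) j = nth x0 (g n) j.
  move=> jn; elim: m => [|m IH]; first by rewrite addn0.
  by rewrite addnS /= nth_rcons sg (leq_trans jn) ?leq_addr.
exists (fun k => nth x0 (g k.+1) k) => k.
rewrite /= nth_rcons sg ltnn eqxx; apply: H => j jk.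
by rewrite -(subnKC jk) st.
Qed.

Section formal.
Variables (R : realType) (n : nat).
Local Notation C := (Cplx R).
Local Notation M := 'M[C]_n.+1.
Implicit Types S T U : nat -> M.

Let P k S : {poly M} := \poly_(i < k.+1) S i.
Let fmulP k j S T : (j <= k)%N -> (P k S * P k T)`_j = fmul S T j.
Proof.
move=> jk; rewrite coefM /fmul; apply: eq_bigr => i _.
have h1 : (i < k.+1)%N by apply: leq_trans (ltn_ord i) _.
have h2 : (j - i < k.+1)%N by rewrite ltnS (leq_trans (leq_subr _ _) jk).
by rewrite !coef_poly h1 h2.
Qed.
(** Coefficient [k] only sees the truncations at degree [k], so associativity comes from polynomials
    with matrix coefficients. *)
Lemma fmulA S T U : fmul S (fmul T U) =1 fmul (fmul S T) U.
Proof.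
move=> k; transitivity ((P k S * (P k T * P k U))`_k).
  rewrite coefM; apply: eq_bigr => i _; rewrite fmulP ?leq_subr // coef_poly ltn_ord //.
rewrite mulrA coefM; apply: eq_bigr => i _; rewrite fmulP; last by rewrite -ltnS.
have h2 : (k - i < k.+1)%N by rewrite ltnS leq_subr.
by rewrite coef_poly h2.
Qed.
Lemma fmul1l S : fmul (fone R n.+1) S =1 S.
Proof.
move=> k; rewrite /fmul big_ord_recl /= mul1mx subn0 big1 ?addr0 // => i _.
by rewrite /fone /= raddf0 mul0mx.
Qed.
Lemma fmul1r S : fmul S (fone R n.+1) =1 S.
Proof.
move=> k; rewrite /fmul big_ord_recr /= subnn /fone /= mulmx1 big1 ?add0r // => i _.
by rewrite subn_eq0 leqNgt ltn_ord /= raddf0 mulmx0.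
Qed.
Lemma eq_fmul S S' T T' k : S =1 S' -> T =1 T' -> fmul S T k = fmul S' T' k.
Proof. by move=> ES ET; apply: eq_bigr => i _; rewrite ES ET. Qed.
Lemma fmulDr S T T' k : fmul S (fun j => T j + T' j) k = fmul S T k + fmul S T' k.
Proof. by rewrite /fmul -big_split; apply: eq_bigr => i _; rewrite mulmxDr. Qed.

Lemma formal_linv S : S 0%N \in unitmx -> exists T, fmul T S =1 fone R n.+1.
Proof.
move=> u.
pose step k (T : nat -> M) := ((fone R n.+1 k) - \sum_(j < k) T j *m S (k - j)%N) *m invmx (S 0%N).
have [|T TE] := @strong_rec M 0 step.
  move=> k f g fg; rewrite /step; congr ((_ - _) *m _); apply: eq_bigr => j _.
  by rewrite fg.
exists T => k; rewrite /fmul big_ord_recr /= subnn TE /step mulmxKV //.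
by rewrite addrC subrK.
Qed.
Lemma formal_rinv S : S 0%N \in unitmx -> exists T, fmul S T =1 fone R n.+1.
Proof.
move=> u.
pose step k (T : nat -> M) := invmx (S 0%N) *m ((fone R n.+1 k) - \sum_(j < k) S j.+1 *m T (k - j.+1)%N).
have [|T TE] := @strong_rec M 0 step.
  move=> k f g fg; rewrite /step; congr (_ *m (_ - _)); apply: eq_bigr => j _.
  by rewrite fg // ltn_subrL /= (leq_ltn_trans _ (ltn_ord j)).
exists T => k; rewrite /fmul big_ord_recl /= subn0 TE /step mulKVmx //.
by rewrite subrK.
Qed.
Lemma formal_inv S : S 0%N \in unitmx -> exists T,
  fmul S T =1 fone R n.+1 /\ fmul T S =1 fone R n.+1.
Proof.
move=> u; have [T1 h1] := formal_linv u; have [T2 h2] := formal_rinv u.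
exists T1; split=> //; suff E : T1 =1 T2.
  by move=> k; rewrite -h2; apply: eq_fmul.
move=> k; rewrite -fmul1r -(eq_fmul (T := fmul S T2) k (frefl T1) h2).
by rewrite fmulA (eq_fmul k h1 (frefl T2)) fmul1l.
Qed.
(** A gauge equation may be checked in the form [M0 S + dS = S N], free of the inverse series. *)
Lemma formal_gauge S T N M0 dS k : fmul T S =1 fone R n.+1 ->
  (forall j, fmul M0 S j + dS j = fmul S N j) ->
  fmul T (fmul M0 S) k + fmul T dS k = N k.
Proof.
move=> TS H; rewrite -fmulDr (eq_fmul k (frefl T) H) fmulA (eq_fmul k TS (frefl N)).
exact: fmul1l.
Qed.
End formal.

(** * Normal forms and flatness *)

Section normal_form_curvature.
Variable R : realType.
Local Notation C := (Cplx R).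

Section pairs.
Variables (K : numFieldType) (V W : normedModType K).
Lemma snd_cont : continuous (@snd V W).
Proof.
move=> p; apply/continuous_epsP => e e0; exists e => // q.
by rewrite prod_normE comparable_gt_max ?real_comparable // => /andP[].
Qed.
Lemma fst_cont : continuous (@fst V W).
Proof.
move=> p; apply/continuous_epsP => e e0; exists e => // q.
by rewrite prod_normE comparable_gt_max ?real_comparable // => /andP[].
Qed.
Lemma diff_snd (U : normedModType K) (F : W -> U) (p : V * W) : differentiable F p.2 ->
  differentiable (fun q : V * W => F q.2) p.
Proof.
move=> dF; have d1 : differentiable (@snd V W) p by apply: linear_differentiable; exact: snd_cont.
exact (@differentiable_comp _ _ _ _ (@snd V W) F p d1 dF).
Qed.
Lemma diff_fst (U : normedModType K) (F : V -> U) (p : V * W) : differentiable F p.1 ->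
  differentiable (fun q : V * W => F q.1) p.
Proof.
move=> dF; have d1 : differentiable (@fst V W) p by apply: linear_differentiable; exact: fst_cont.
exact (@differentiable_comp _ _ _ _ (@fst V W) F p d1 dF).
Qed.
Lemma derive_pair_snd (U : normedModType K) (F : V * W -> U) w x u :
  'D_(0, u) F (w, x) = 'D_u (fun y => F (w, y)) x.
Proof.
have E : (fun h : K => h^-1 *: ((F \o shift (w, x)) (h *: (0, u)) - F (w, x))) =
         (fun h : K => h^-1 *: (((fun y => F (w, y)) \o shift x) (h *: u) - (fun y => F (w, y)) x)).
  apply/funext => h; congr (_ *: (_ - _)).
  by rewrite /shift /=; congr F; rewrite [LHS]surjective_pairing /= scaler0 add0r.
exact: (congr1 (fun g : K -> U => lim (g @ 0^')) E).
Qed.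
Lemma derive_pair_fst (U : normedModType K) (F : V * W -> U) w x u :
  'D_(u, 0) F (w, x) = 'D_u (fun y => F (y, x)) w.
Proof.
have E : (fun h : K => h^-1 *: ((F \o shift (w, x)) (h *: (u, 0)) - F (w, x))) =
         (fun h : K => h^-1 *: (((fun y => F (y, x)) \o shift w) (h *: u) - (fun y => F (y, x)) w)).
  apply/funext => h; congr (_ *: (_ - _)).
  by rewrite /shift /=; congr F; rewrite [LHS]surjective_pairing /= scaler0 add0r.
exact: (congr1 (fun g : K -> U => lim (g @ 0^')) E).
Qed.
End pairs.

Lemma derive_scale_cst (V : normedModType C) (k : C -> C) (M : V) (w L : C) : is_derive w (1 : C) k L ->
  'D_1 (fun z => k z *: M) w = L *: M.
Proof.
move=> [dk kE]; have dk' : differentiable k w by apply/derivable1_diffP.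
rewrite deriveE; last exact: differentiableZl.
by have -> := diffZl M dk'; rewrite -deriveE // kE.
Qed.

Section nf.
Variables (d n : nat) (A : 'rV[C]_d -> 'M[C]_n) (B : 'M[C]_n) (Cf : 'I_d -> 'rV[C]_d -> 'M[C]_n).

Lemma nf_deriv_None w x u : differentiable A x ->
  'D_(0, u) (normal_form A B Cf None) (w, x) = w ^- 2 *: 'D_u A x.
Proof.
move=> dA; refine (eq_trans (derive_pair_snd _ _ _ _) _); rewrite /normal_form /=.
have dAv := diff_derivable (v := u) dA.
have E : (fun y => w ^- 2 *: (A y + w *: B)) = w ^- 2 *: (A + cst (w *: B)) by [].
have dc : derivable (cst (w *: B) : 'rV[C]_d -> _) x u by exact: derivable_cst.
refine (eq_trans (congr1 (fun f => 'D_u f x) E) (eq_trans (deriveZ (w ^- 2) (derivableD dAv dc)) _)).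
refine (congr1 (fun z => w ^- 2 *: z) (eq_trans (deriveD dAv dc) _)).
exact (eq_trans (congr1 (fun z => 'D_u A x + z) (derive_cst _ _ _)) (addr0 _)).
Qed.
Lemma nf_deriv_Some w x u i : differentiable (Cf i) x ->
  'D_(0, u) (normal_form A B Cf (Some i)) (w, x) = - (w^-1 *: 'D_u (Cf i) x).
Proof.
move=> dA; refine (eq_trans (derive_pair_snd _ _ _ _) _); rewrite /normal_form /=.
have dAv := diff_derivable (v := u) dA.
have E : (fun y => - (w^-1 *: Cf i y)) = - (w^-1 *: Cf i) by [].
refine (eq_trans (congr1 (fun f => 'D_u f x) E) (eq_trans (deriveN (@derivableZ _ _ _ (Cf i) w^-1 x u dAv)) _)).
exact (congr1 -%R (deriveZ w^-1 dAv)).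
Qed.
Lemma nf_deriv_w w x i : w != 0 ->
  'D_(1, 0) (normal_form A B Cf (Some i)) (w, x) = w ^- 2 *: Cf i x.
Proof.
move=> w0; refine (eq_trans (derive_pair_fst _ _ _ _) _); rewrite /normal_form /=.
have E : (fun y : C => - (y^-1 *: Cf i x)) = (fun y => (- y^-1) *: Cf i x).
  by apply/funext => y; rewrite scaleNr.
have d1 : derivable (fun y : C => y) w 1 by exact: derivable_id.
have H := is_deriveN (DeriveDef (derivableV w0 d1) (deriveV w0 d1)).
have E2 : - (- w ^- 2 *: 'D_1 (fun y : C => y) w) = w ^- 2.
  rewrite (_ : 'D_1 (fun y : C => y) w = 1); last exact: derive_id.
  by rewrite scaleNr opprK; exact: mulr1.
rewrite E2 in H.
exact (eq_trans (congr1 (fun f => 'D_1 f w) E) (derive_scale_cst _ H)).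
Qed.
Lemma scalemxC p (a b : C) (X Y : 'M[C]_p) : (a *: X) *m (b *: Y) = (a * b) *: (X *m Y).
Proof. by rewrite -scalemxAl -scalemxAr scalerA. Qed.

(** The terms of order [w^-2] and [w^-3] separate: their coefficients are the equation for [dA] and
    the commutation of [A] with [C]. *)
Lemma nf_flat_mixed w x i : w != 0 -> differentiable A x ->
  'D_(coord_vec R None) (normal_form A B Cf (Some i)) (w, x) -
  'D_(coord_vec R (Some i)) (normal_form A B Cf None) (w, x) +
  (normal_form A B Cf None (w, x) *m normal_form A B Cf (Some i) (w, x) -
   normal_form A B Cf (Some i) (w, x) *m normal_form A B Cf None (w, x)) =
  w ^- 2 *: (Cf i x - 'D_(delta_mx 0 i) A x - (B *m Cf i x - Cf i x *m B)) -
  w ^- 3 *: (A x *m Cf i x - Cf i x *m A x).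
Proof.
move=> w0 dA; rewrite nf_deriv_w // nf_deriv_None // /normal_form /=.
set X := Cf i x; set Y := A x; set Z := 'D_ _ _ _.
rewrite mulmxN mulNmx !scalemxC mulmxDl mulmxDr -scalemxAl -scalemxAr.
have -> : w ^- 2 / w = w ^- 3 by rewrite -invfM -exprSr.
have -> : w^-1 / w ^+ 2 = w ^- 3 by rewrite mulrC -invfM -exprSr.
have E3 : w ^- 3 * w = w ^- 2 by rewrite exprSr invfM mulfVK.
rewrite -E3; move: (Y *m X) (X *m Y) (B *m X) (X *m B) (w ^- 3) => P Q S T a; clearbody X Z.
by apply/matrixP => k l; rewrite !mxE; ring.
Qed.
End nf.
End normal_form_curvature.

Section integrable_normal_forms.
Variable R : realType.
Local Notation C := (Cplx R).

Lemma disc_open (r : C) : open (disc r).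
Proof.
rewrite (_ : disc r = [set y | `|0 - y| < r]); last first.
  by apply/seteqP; split=> y /=; rewrite /disc /= sub0r normrN.
have [r0|r0] := boolP (0 < r).
  have -> : [set y : C | `|0 - y| < r] = ball 0 r by rewrite -ball_normE.
  by apply: ball_open.
have -> : [set y : C | `|0 - y| < r] = set0; last exact: open0.
by apply/seteqP; split=> y //=; move=> h; move: r0; rewrite (le_lt_trans _ h).
Qed.
Lemma open_prodX (V W : normedModType C) (A : set V) (B : set W) : open A -> open B -> open (A `*` B).
Proof.
move=> oA oB; have -> : A `*` B = (@fst V W) @^-1` A `&` (@snd V W) @^-1` B by [].
apply: openI; apply: open_comp => // p _; [exact: fst_cont|exact: snd_cont].
Qed.
Lemma punctured_open (r : C) : open (punctured_disc r).
Proof.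
have -> : punctured_disc r = disc r `&` [set z | z != 0] by [].
apply: openI; first exact: disc_open.
have -> : [set z : C | z != 0] = ~` [set 0].
  by apply/seteqP; split=> z /=; [move/eqP|move=> h; apply/eqP].
by apply: closed_openC; apply: (accessible_closed_set1 (T := C)); apply: hausdorff_accessible; exact: norm_hausdorff.
Qed.

Lemma pole_conn_diff (d n : nat) (r : C) (X : set 'rV[C]_d) (Om : mxform R d n) a p : open X ->
  pole_order2 r X Om -> (punctured_disc r `*` X) p -> differentiable (Om a) p.
Proof.
move=> oX [N [hN NE]] pp.
have [e e0 eP] := open_nrm (open_prodX (@punctured_open r) oX) pp.
have dN : differentiable (N a) p by apply: hN; move: pp => [[? ?] ?].
have d1 : differentiable (fun q : C * 'rV[C]_d => q.1 ^- 2 *: N a q) p.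
  apply: diff_mx => i j.
  have -> : (fun q : C * 'rV[C]_d => (q.1 ^- 2 *: N a q) i j) = (fun q => q.1 ^- 2) * (fun q => N a q i j).
    by apply/funext => q; rewrite mxE.
  apply: differentiableM; last exact: diff_entry.
  apply: (@diff_fst _ C 'rV[C]_d C (fun w : C => w ^- 2)).
  apply: (@differentiableV _ _ (fun w : C => w ^+ 2)).
    have -> : (fun w : C => w ^+ 2) = (fun w : C => w) * (fun w : C => w) by apply/funext => w; rewrite expr2.
    by apply: differentiableM; exact: ex_diff.
  by move: pp => [[_ w0] _]; rewrite expf_neq0.
apply: (proj1 (near_eq_diff e0 _ d1)) => q /eP qP.
by rewrite (NE a q qP).
Qed.

Section structure.
Variables (n : nat) (Ao Bo : 'M[C]_n.+1) (E : integrable_deformation Ao Bo).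
Variables (V : set 'rV[C]_(pdim E)) (A : 'rV[C]_(pdim E) -> 'M[C]_n.+1)
   (Cf : 'I_(pdim E) -> 'rV[C]_(pdim E) -> 'M[C]_n.+1).
Hypothesis nf : is_normal_form V A Cf.

Lemma nf_diff a p : (punctured_disc (wradius E) `*` V) p -> differentiable (normal_form A Bo Cf a) p.
Proof.
move: nf => [[oV _ _] [[hA hC _] _]] [[_ w0] Vx].
have dw : differentiable (fun q : C * 'rV[C]_(pdim E) => q.1) p.
  by apply: (@diff_fst _ C 'rV[C]_(pdim E) C (fun w : C => w)); exact: ex_diff.
have dV : differentiable (fun q : C * 'rV[C]_(pdim E) => q.1^-1) p by apply: differentiableV.
apply: diff_mx => i j; case: a => [k|] /=.
  have -> : (fun q : C * 'rV[C]_(pdim E) => (- (q.1^-1 *: Cf k q.2)) i j) =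
     - ((fun q => q.1^-1) * (fun q => (Cf k q.2) i j)).
    by apply/funext => q; rewrite !mxE.
  apply: differentiableN; apply: differentiableM => //.
  by apply: diff_entry; apply: (@diff_snd _ C 'rV[C]_(pdim E)); exact: hC.
have -> : (fun q : C * 'rV[C]_(pdim E) => (q.1 ^- 2 *: (A q.2 + q.1 *: Bo)) i j) =
     (fun q => q.1^-1 ) * (fun q => q.1^-1) * ((fun q => (A q.2) i j) + (fun q => q.1) * cst (Bo i j)).
  by apply/funext => q; rewrite !mxE expr2 invfM.
apply: differentiableM; first exact: differentiableM.
apply: differentiableD; last by apply: differentiableM => //; exact: differentiable_cst.
by apply: diff_entry; apply: (@diff_snd _ C 'rV[C]_(pdim E)); exact: hA.
Qed.

(** Differentiating the gauge relation [rel] brings in second derivatives of the frame [G]; by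
    [holo_schwarz_mx] they are symmetric, so [nc_flat_gauge] applies. *)
Lemma nf_flat p : (punctured_disc (wradius E) `*` V) p -> flat_at (normal_form A Bo Cf) p.
Proof.
move=> pp a b.
move: (nf) => [[oV _ VX] [_ [G [hG uG _ gG]]]].
have oO := open_prodX (@disc_open (wradius E)) oV.
have [e e0 eP] := open_nrm (open_prodX (@punctured_open (wradius E)) oV) pp.
have pd : (disc (wradius E) `*` V) p by move: pp => [[? ?] ?].
have dG : differentiable G p by exact: hG.
have dDG c : differentiable ('D_(coord_vec R c) G) p by exact: (holo_derive_mx _ oO hG).
have dcon c : differentiable (conn E c) p.
  apply: (@pole_conn_diff _ _ (wradius E) (base E) (conn E) c p (@base_open _ _ _ _ E) (@conn_pole _ _ _ _ E)).
  by move: pp => [? ?]; split=> //; exact: VX.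
have dnf c := nf_diff c pp.
have rel c q : (punctured_disc (wradius E) `*` V) q ->
    G q *m normal_form A Bo Cf c q = conn E c q *m G q + 'D_(coord_vec R c) G q.
  move=> qq; rewrite -gG // /gauge mulmxDr !mulmxA mulmxV ?mul1mx //.
  by apply: uG; move: qq => [[? ?] ?].
have drel c k : 'D_k G p *m normal_form A Bo Cf c p + G p *m 'D_k (normal_form A Bo Cf c) p =
   'D_k (conn E c) p *m G p + conn E c p *m 'D_k G p + 'D_k ('D_(coord_vec R c) G) p.
  have d1 : differentiable (fun q => conn E c q *m G q) p by exact: diff_mul.
  have d2 : differentiable ((fun q => conn E c q *m G q) + 'D_(coord_vec R c) G) p by exact: differentiableD.
  have [_ EE] := near_eq_diff (g := fun q => G q *m normal_form A Bo Cf c q) e0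
    (fun q qq => esym (rel c q (eP q qq))) d2.
  refine (eq_trans (esym (derive_mul k dG (dnf c))) (eq_trans (EE k) _)).
  refine (eq_trans (deriveD (diff_derivable d1) (diff_derivable (dDG c))) _).
  exact (congr1 (fun z => z + _) (derive_mul k (dcon c) dG)).
have fl := conn_flat (i := E) (p := p) _ a b.
have {}fl := fl (conj (proj1 pp) (VX _ (proj2 pp))).
have sw := @holo_schwarz_mx R _ _ _ G _ (coord_vec R b) (coord_vec R a) p oO hG pd.
have r3 := drel a (coord_vec R b); have r4 := drel b (coord_vec R a).
rewrite sw in r4.
have key := @nc_flat_gauge 'M[C]_n.+1 (G p) _ _ _ _ _ _ _ _ _ _ _ (rel a p pp) (rel b p pp) r3 r4 fl.
have uGp := uG p pd.
by rewrite -[LHS](mulKmx uGp); apply: etrans (congr1 (mulmx (invmx (G p))) key) (mulmx0 _ _).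
Qed.

Lemma structure_eqs x i : V x ->
  A x *m Cf i x = Cf i x *m A x /\
  'D_(delta_mx 0 i) A x = Cf i x + (Cf i x *m Bo - Bo *m Cf i x).
Proof.
move=> Vx; move: (nf) => [[oV _ VX] [[hA hC _] _]].
have [r r0 rE] := gt0_toC (wradius_gt0 E).
set T := Cf i x - 'D_(delta_mx 0 i) A x - (Bo *m Cf i x - Cf i x *m Bo).
set Q := A x *m Cf i x - Cf i x *m A x.
(* Multiplied by [w^3], the mixed curvature is [w T - Q], affine in [w]; its zeros [r / 2] and
   [r / 3] force both coefficients to vanish. *)
have eq w : w != 0 -> cabs w < r -> w *: T = Q.
  move=> w0 wr; have pp : (punctured_disc (wradius E) `*` V) (w, x).
    by split=> //; split=> //=; rewrite rE normCE toC_lt.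
  have := nf_flat pp None (Some i); rewrite nf_flat_mixed //; last exact: hA.
  rewrite -/T -/Q => /(congr1 (fun z => w ^+ 3 *: z)).
  have u3 : w ^+ 3 != 0 by rewrite expf_neq0.
  have u2 : w ^+ 2 != 0 by rewrite expf_neq0.
  rewrite scaler0 scalerBr !scalerA divff // scale1r exprSr mulrAC divff // mul1r.
  by move=> /eqP; rewrite subr_eq0 => /eqP.
have h1 := eq (toC (r / 2)); have h2 := eq (toC (r / 3)).
have p2 : 0 < r / 2 by rewrite divr_gt0.
have p3 : 0 < r / 3 by rewrite divr_gt0.
have {}h1 : toC (r / 2) *: T = Q.
  apply: h1; first by rewrite gt_eqF // toC_gt0.
  by rewrite cabs_toC gtr0_norm // ltr_pdivrMr // ltr_pMr // ltr1n.
have {}h2 : toC (r / 3) *: T = Q.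
  apply: h2; first by rewrite gt_eqF // toC_gt0.
  by rewrite cabs_toC gtr0_norm // ltr_pdivrMr // ltr_pMr // ltr1n.
have T0 : T = 0.
  have : (toC (r / 2) - toC (r / 3)) *: T = 0 by rewrite scalerBl h1 h2 subrr.
  move=> /eqP; rewrite scaler_eq0 -toCB => /orP[|/eqP //].
  by rewrite gt_eqF // toC_gt0; lra.
have Q0 : Q = 0 by rewrite -h1 T0 scaler0.
split; first by apply/eqP; rewrite -subr_eq0 -/Q Q0.
apply/esym/eqP; rewrite -subr_eq0 -T0 /T; apply/eqP.
by move: (Bo *m _) (_ *m Bo) => ? ?; apply/matrixP => ? ?; rewrite !mxE; ring.
Qed.
End structure.

Section mk.
Variables (n d : nat) (Ao Bo : 'M[C]_n.+1) (X : set 'rV[C]_d) (x0 : 'rV[C]_d)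
  (A : 'rV[C]_d -> 'M[C]_n.+1) (Cf : 'I_d -> 'rV[C]_d -> 'M[C]_n.+1).
Hypotheses (oX : open X) (cX : connected X) (Xx0 : X x0)
  (hA : holomorphic_on X A) (hC : forall i, holomorphic_on X (Cf i)) (A0 : A x0 = Ao).
Hypothesis AC : forall x i, X x -> A x *m Cf i x = Cf i x *m A x.
Hypothesis dA : forall x i, X x -> 'D_(delta_mx 0 i) A x = Cf i x + (Cf i x *m Bo - Bo *m Cf i x).
Hypothesis CC : forall x i j, X x -> Cf i x *m Cf j x = Cf j x *m Cf i x.
Hypothesis dC : forall x i j, X x -> 'D_(delta_mx 0 i) (Cf j) x = 'D_(delta_mx 0 j) (Cf i) x.

Lemma mk_pole : pole_order2 1 X (normal_form A Bo Cf).
Proof.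
exists (fun a p => if a is Some i then - (p.1 *: Cf i p.2) else A p.2 + p.1 *: Bo); split.
  move=> a p [_ Xp].
  have dw : differentiable (fun q : C * 'rV[C]_d => q.1) p.
    by apply: (@diff_fst _ C 'rV[C]_d C (fun w : C => w)); exact: ex_diff.
  case: a => [i|].
    apply: diff_mx => k l.
    have -> : (fun q : C * 'rV[C]_d => (- (q.1 *: Cf i q.2)) k l) = - ((fun q => q.1) * (fun q => Cf i q.2 k l)).
      by apply/funext => q; rewrite !mxE.
    apply: differentiableN; apply: differentiableM => //.
    by apply: diff_entry; apply: (@diff_snd _ C 'rV[C]_d); exact: hC.
  apply: differentiableD; last exact: differentiableZl.
  by apply: (@diff_snd _ C 'rV[C]_d); exact: hA.
move=> a p [[_ w0] _]; case: a => [i|] //=.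
rewrite scalerN scalerA; congr (- (_ *: _)).
by rewrite expr2 invfM -mulrA mulVf ?mulr1.
Qed.

Lemma mk_flat p : (punctured_disc 1 `*` X) p -> flat_at (normal_form A Bo Cf) p.
Proof.
case: p => w x [[_ w0] Xx] a b.
have mixed i := @nf_flat_mixed R d n.+1 A Bo Cf w x i w0 (hA Xx).
have mixed0 i : 'D_(coord_vec R None) (normal_form A Bo Cf (Some i)) (w, x) -
  'D_(coord_vec R (Some i)) (normal_form A Bo Cf None) (w, x) +
  (normal_form A Bo Cf None (w, x) *m normal_form A Bo Cf (Some i) (w, x) -
   normal_form A Bo Cf (Some i) (w, x) *m normal_form A Bo Cf None (w, x)) = 0.
  have e1 : A x *m Cf i x - Cf i x *m A x = 0 by rewrite (AC i Xx) subrr.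
  have e2 : Cf i x - 'D_(delta_mx 0 i) A x - (Bo *m Cf i x - Cf i x *m Bo) = 0.
    rewrite (dA i Xx); move: (Cf i x) (Bo *m _) (_ *m Bo) => ? ? ?.
    by apply/matrixP => ? ?; rewrite !mxE; ring.
  refine (eq_trans (mixed i) (eq_trans (congr2 (fun u v => w ^- 2 *: u - w ^- 3 *: v) e2 e1) _)).
  by rewrite !scaler0 subr0.
case: a b => [i|] [j|].
- have e1 := @nf_deriv_Some R d n.+1 A Bo Cf w x (delta_mx 0 i) j (hC j Xx).
  have e2 := @nf_deriv_Some R d n.+1 A Bo Cf w x (delta_mx 0 j) i (hC i Xx).
  have e3 : normal_form A Bo Cf (Some i) (w, x) *m normal_form A Bo Cf (Some j) (w, x) -
     normal_form A Bo Cf (Some j) (w, x) *m normal_form A Bo Cf (Some i) (w, x) = 0.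
    have gen (P Q : 'M[C]_n.+1) (z : C) : P *m Q = Q *m P ->
        (- (z *: P)) *m (- (z *: Q)) - (- (z *: Q)) *m (- (z *: P)) = 0.
      by move=> PQ; rewrite !mulmxN !mulNmx !opprK !scalemxC PQ subrr.
    exact: gen (CC i j Xx).
  refine (eq_trans (congr2 (fun u v => u - v + _) e1 e2) _).
  by rewrite e3 addr0 dC // subrr.
- have := mixed0 i; set a := 'D_ _ _ _; set b := 'D_ _ _ _; set c := _ *m _; set e := _ *m _.
  move=> /(congr1 -%R); rewrite oppr0 => <-.
  by move: a b c e => *; apply/matrixP => ? ?; rewrite !mxE; ring.
- exact: mixed0.
- by rewrite !subrr addr0.
Qed.

Lemma mk_frame_holo : holomorphic_on (disc 1) (fun _ : C => 1%:M : 'M[C]_n.+1).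
Proof. by move=> w _; exact: differentiable_cst. Qed.
Lemma mk_frame_unit (w : C) : disc 1 w -> (1%:M : 'M[C]_n.+1) \in unitmx.
Proof. by move=> _; exact: unitmx1. Qed.
Lemma mk_restr (w : C) : punctured_disc 1 w ->
  invmx (1%:M : 'M[C]_n.+1) *m normal_form A Bo Cf None (w, x0) *m 1%:M
    + invmx (1%:M : 'M[C]_n.+1) *m 'D_1 (fun _ : C => 1%:M : 'M[C]_n.+1) w
    = w ^- 2 *: (Ao + w *: Bo).
Proof.
move=> _; rewrite invmx1 mulmx1 !mul1mx /= A0.
exact (eq_trans (congr1 (fun z => _ + z) (derive_cst _ _ _)) (addr0 _)).
Qed.

(** Opposite direction to [structure_eqs]: solutions of all structure equations, those among the
    [C_i] included, give a deformation over the unit disc with the identity as frame. *)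
Definition nf_def : integrable_deformation Ao Bo :=
  @IntegrableDeformation R n.+1 Ao Bo d X x0 1 (normal_form A Bo Cf) (fun _ => 1%:M)
    oX cX Xx0 ltr01 mk_pole mk_flat mk_frame_holo mk_frame_unit mk_restr.

Lemma nf_def_normal : @is_normal_form R n.+1 Ao Bo nf_def X A Cf.
Proof.
split; first by split.
split; first by split.
exists (fun _ => 1%:M); split.
- by move=> p _; exact: differentiable_cst.
- by move=> p _; exact: unitmx1.
- by [].
- move=> a p _; rewrite /gauge /= invmx1 mulmx1 !mul1mx.
  exact (eq_trans (congr1 (fun z => _ + z) (derive_cst _ _ _)) (addr0 _)).
Qed.
End mk.
End integrable_normal_forms.

(** * Formal simplification at a point *)

Section formal_simplification.
Variable R : realType.
Local Notation C := (Cplx R).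
Section fs.
Variable n : nat.
Local Notation M := 'M[C]_n.+1.

Lemma fmul2l (X Y : M) (S : nat -> M) k : fmul (fun j => [:: X; Y]`_j) S k =
  X *m S k + (if k is k'.+1 then Y *m S k' else 0).
Proof.
case: k => [|k]; first by rewrite /fmul big_ord_recl big_ord0 !addr0.
rewrite /fmul !big_ord_recl /= subSS !subn0 big1 ?addr0 // => i _.
by rewrite nth_nil mul0mx.
Qed.
Lemma fmul2r (X Y : M) (S : nat -> M) k : fmul S (fun j => [:: X; Y]`_j) k =
  S k *m X + (if k is k'.+1 then S k' *m Y else 0).
Proof.
case: k => [|k]; first by rewrite /fmul big_ord_recl big_ord0 !addr0.
rewrite /fmul !big_ord_recr /= subnn subSnn /= big1 ?add0r 1?addrC // => i _.
have -> : (k.+1 - i)%N = (k - i.+1)%N.+2.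
  by rewrite subnSK // subSn // ltnW.
by rewrite /= nth_nil mulmx0.
Qed.

Variables (Ao Bo : M) (E : integrable_deformation Ao Bo).
Variables (V : set 'rV[C]_(pdim E)) (A : 'rV[C]_(pdim E) -> M) (Cf : 'I_(pdim E) -> 'rV[C]_(pdim E) -> M).
Hypothesis nf : is_normal_form V A Cf.
Variables (U : set 'rV[C]_(pdim E)) (Phi : nat -> 'rV[C]_(pdim E) -> M)
  (delta : 'rV[C]_(pdim E) -> 'rV[C]_n.+1) (b : 'rV[C]_n.+1).
Hypotheses (oU : open U) (Upt : U (pt E)) (UV : U `<=` V)
  (hPhi : forall k, holomorphic_on U (Phi k)) (uPhi : forall x, U x -> Phi 0%N x \in unitmx)
  (hd : holomorphic_on U delta).
Local Notation dD i x := ('D_(delta_mx 0 i) (fun y => diag_mx (delta y)) x).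
Hypothesis w0 : forall x, U x -> A x *m Phi 0%N x = Phi 0%N x *m diag_mx (delta x).
Hypothesis wS : forall x k, U x -> A x *m Phi k.+1 x + Bo *m Phi k x + Phi k x *+ k =
  Phi k.+1 x *m diag_mx (delta x) + Phi k x *m diag_mx b.
Hypothesis x0 : forall x i, U x -> Cf i x *m Phi 0%N x = Phi 0%N x *m dD i x.
Hypothesis xS : forall x i k, U x -> - (Cf i x *m Phi k.+1 x) + 'D_(delta_mx 0 i) (Phi k) x =
  - (Phi k.+1 x *m dD i x).

(** The hypotheses are the successive coefficients in [w] of the gauge equation, multiplied by [w^2]
    and freed of the inverse series. In this form differentiation shifts the order by one in [dw]
    and by two in [dx_i]. *)
Lemma fs_intro : fs_type Ao Bo E.
Proof.
exists V, A, Cf; split=> //.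
have inv x : U x -> exists T, fmul (Phi^~ x) T =1 fone R n.+1 /\ fmul T (Phi^~ x) =1 fone R n.+1.
  by move=> /uPhi; exact: formal_inv.
(* Inverse series are available only over [U]; elsewhere [Psi] takes the value 0. *)
pose Psi k x := if pselect (U x) is left Ux then sval (cid (inv x Ux)) k else 0.
exists U, Phi, Psi, delta, b; split; first by split.
split; first by split.
move=> x Ux.
have PE : Psi^~ x =1 sval (cid (inv x Ux)).
  move=> k; rewrite /Psi; case: pselect => // Ux'.
  by rewrite (Prop_irrelevance Ux Ux').
have [P1 P2] := svalP (cid (inv x Ux)).
have Q1 : fmul (Phi^~ x) (Psi^~ x) =1 fone R n.+1 by move=> k; rewrite (eq_fmul k (frefl _) PE) P1.
have Q2 : fmul (Psi^~ x) (Phi^~ x) =1 fone R n.+1 by move=> k; rewrite (eq_fmul k PE (frefl _)) P2.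
split=> // a k; apply: formal_gauge => // j.
case: a => [i|].
  rewrite (fmul2l 0 (- Cf i x)) (fmul2r 0 (- dD i x)) mul0mx mulmx0 !add0r.
  case: j => [|[|j]] /=; first by rewrite addr0.
    by rewrite addr0 mulNmx mulmxN x0.
  by rewrite mulNmx mulmxN xS.
rewrite (fmul2l (A x) Bo) (fmul2r (diag_mx (delta x)) (diag_mx b)).
case: j => [|j] /=; first by rewrite !addr0 w0.
by rewrite wS.
Qed.
End fs.

Lemma diagonalizable_form (n : nat) (Ao : 'M[C]_n.+1) : diagonalizable Ao ->
  exists (P : 'M[C]_n.+1) (u : 'rV[C]_n.+1), P \in unitmx /\ invmx P *m Ao *m P = diag_mx u.
Proof.
move=> [P uP /(diagonalizable_forLR uP)[D ->]].
exists (invmx P), D; rewrite unitmx_inv; split=> //.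
by rewrite mxpoly.conjumx ?unitmx_inv // !invmxK !mulmxA mulmxV // mul1mx -mulmxA mulmxV // mulmx1.
Qed.

(** The minimal polynomial of a diagonal matrix has as degree the number of distinct entries;
    regularity makes this degree maximal. *)
Lemma regular_inj (n : nat) (Ao P : 'M[C]_n.+1) (u : 'rV[C]_n.+1) : regular_mx Ao ->
  P \in unitmx -> invmx P *m Ao *m P = diag_mx u -> injective (u 0).
Proof.
move=> reg uP E.
have uPi : invmx P \in unitmx by rewrite unitmx_inv.
have : size (mxminpoly (diag_mx u)) = n.+2.
  have -> : diag_mx u = mxpoly.conjmx (invmx P) Ao by rewrite mxpoly.conjumx // invmxK E.
  by rewrite mxminpoly_uconj // reg size_char_poly.
rewrite mxminpoly_diag size_prod_XsubC => -[sz].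
apply/injectiveP; rewrite /injectiveb /dinjectiveb.
rewrite -[uniq _]negbK -ltn_size_undup sz -leqNgt.
by rewrite size_map -cardE card_ord.
Qed.

Lemma regular_PNR (n : nat) (Ao Bo : 'M[C]_n.+1) : regular_mx Ao -> diagonalizable Ao -> PNR Ao Bo.
Proof.
move=> reg /diagonalizable_form [P [u [uP E]]]; have inj := regular_inj reg uP E.
exists P, u; split=> //; first by move=> i j /eqP ij /inj.
move=> i j /inj -> m; rewrite subrr => /esym /eqP.
by rewrite intr_eq0 => /eqP.
Qed.

Section point.
Variables (n : nat) (Ao Bo : 'M[C]_n.+1).
Local Notation M := 'M[C]_n.+1.

(** Order [k] of the equation fixes the entries of [F k.+1] with [u_i <> u_j] and leaves those with
    [u_i = u_j] free. The latter are spent on solvability at order [k + 1], with divisor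
    [B_ii - B_jj + k + 1], nonzero by [dstar]. *)
Lemma formal_diag (u : 'rV[C]_n.+1) (B : M) :
  (forall i j, i != j -> u 0 i = u 0 j -> B i j = 0) ->
  (forall i j, u 0 i = u 0 j -> forall m : int, B i i - B j j = m%:~R -> m = 0) ->
  exists F : nat -> M, F 0%N = 1%:M /\
    forall k, diag_mx u *m F k.+1 + B *m F k + F k *+ k =
      F k.+1 *m diag_mx u + F k *m diag_mx (\row_i B i i).
Proof.
move=> star dstar; pose b := (\row_i B i i) : 'rV[C]_n.+1.
pose rhs k (F : M) := B *m F + k%:R *: F - F *m diag_mx b.
pose nc k (F : M) : M := \matrix_(i, j) (if u 0 i == u 0 j then 0 else - (rhs k F i j) / (u 0 i - u 0 j)).
pose step k (F : M) : M := \matrix_(i, j) (if u 0 i == u 0 j then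
   - (\sum_l B i l * nc k F l j * (u 0 i != u 0 l)%:R) / (B i i - B j j + k.+1%:R) else nc k F i j).
pose F := fix F k : M := if k is k'.+1 then step k' (F k') else 1%:M.
exists F; split=> // k.
suff H : forall i j, (u 0 i - u 0 j) * F k.+1 i j + rhs k (F k) i j = 0.
  apply/eqP; rewrite -subr_eq0; apply/eqP/matrixP => i j; rewrite [RHS]mxE -(H i j).
  rewrite -scaler_nat mul_diag_mx mul_mx_diag /rhs !mxE; ring.
(* Solvability: where [u_i - u_j] vanishes, the remaining terms must vanish too. Since [star] kills
   [B_il] for [l <> i] with [u_l = u_i], only the diagonal term and the already known entries are
   left in the sum over [l]. *)
have resc i j : u 0 i = u 0 j -> rhs k (F k) i j = 0.
  move=> uij; rewrite /rhs mul_mx_diag !mxE.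
  have Bsum G : (forall l, l != i -> u 0 i = u 0 l -> B i l = 0) ->
    \sum_l B i l * G l = B i i * G i + \sum_l B i l * G l * (u 0 i != u 0 l)%:R.
    move=> h; rewrite (bigD1 i) //= [in RHS](bigD1 i) //= eqxx mulr0 add0r; congr (_ + _).
    apply: eq_bigr => l li; have [ul|ul] := eqVneq (u 0 i) (u 0 l); last by rewrite mulr1.
    by rewrite (h l li ul) !mul0r.
  rewrite Bsum; last by move=> l li; apply: star; rewrite eq_sym.
  case: k => [|k] /=.
    rewrite mul0r addr0 big1 => [|l _].
      rewrite addr0 mxE; have [->|ij] := eqVneq i j; first by rewrite mulrC subrr.
      by rewrite mulr0 mul0r subr0.
    rewrite mxE; have [->|lj] := eqVneq l j; first by rewrite uij eqxx !mulr0.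
    by rewrite mulr0 mul0r.
  have -> : \sum_l B i l * step k (F k) l j * (u 0 i != u 0 l)%:R =
     \sum_l B i l * nc k (F k) l j * (u 0 i != u 0 l)%:R.
    apply: eq_bigr => l _; have [_|ul] := eqVneq (u 0 i) (u 0 l); first by rewrite !mulr0.
    by rewrite [step _ _ _ _]mxE -uij eq_sym (negbTE ul).
  rewrite /F -/F [step k (F k) i j]mxE uij eqxx -/F.
  set s := \sum_l _; have nz : B i i - B j j + k.+1%:R != 0.
    apply/eqP => /eqP; rewrite addr_eq0 => /eqP h.
    have := dstar i j uij (- (k.+1 : int)); rewrite h mulrNz => /(_ erefl) /eqP.
    by rewrite oppr_eq0.
  set z := B i i - B j j + k.+1%:R in nz *.
  have -> : B i i * (- s / z) + s + k.+1%:R * (- s / z) - (- s / z) * B j j = s - s / z * z by rewrite /z; ring.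
  by rewrite divfK // subrr.
move=> i j; have [uij|uij] := eqVneq (u 0 i) (u 0 j).
  by rewrite resc // uij subrr mul0r addr0.
rewrite [F k.+1 i j]mxE (negbTE uij) mxE (negbTE uij).
by rewrite mulrCA divff ?subr_eq0 // mulr1 addNr.
Qed.

Lemma setT_rV0 : [set: 'rV[C]_0] = [set 0].
Proof. by apply/seteqP; split=> x // _; rewrite /= thinmx0. Qed.

Lemma rV0_connected : connected [set: 'rV[C]_0].
Proof. by rewrite setT_rV0; exact: connected1. Qed.
Let hA0 : holomorphic_on [set: 'rV[C]_0] (fun=> Ao).
Proof. by move=> x _; exact: differentiable_cst. Qed.
Let I0 (T : Prop) (i : 'I_0) : T.
Proof. by case: i. Qed.
(** With zero parameters there are no components [C_i], and every condition on them is void. *)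
Definition point_def : integrable_deformation Ao Bo :=
  @nf_def R n 0 Ao Bo setT 0 (fun=> Ao) (fun _ _ => 0) openT rV0_connected I hA0
    (fun i => I0 _ i) erefl (fun _ i _ => I0 _ i) (fun _ i _ => I0 _ i)
    (fun _ i _ _ => I0 _ i) (fun _ i _ _ => I0 _ i).

Lemma point_fs : PNR Ao Bo -> fs_type Ao Bo point_def.
Proof.
move=> [P [u [uP E star dstar]]].
have [F [F0 FS]] := formal_diag star dstar.
have AP : Ao *m P = P *m diag_mx u by rewrite -E !mulmxA mulmxV // mul1mx.
apply: (@fs_intro n Ao Bo point_def setT (fun=> Ao) (fun _ _ => 0) _ setT (fun k _ => P *m F k) (fun=> u)
  (\row_i (invmx P *m Bo *m P) i i)) => //.
- exact: nf_def_normal.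
- exact: openT.
- by move=> k x _; exact: differentiable_cst.
- by move=> x _; rewrite F0 mulmx1.
- by move=> x _; rewrite F0 mulmx1.
- move=> x k _.
  transitivity (P *m (diag_mx u *m F k.+1 + invmx P *m Bo *m P *m F k + F k *+ k)).
    rewrite !mulmxDr; apply: (congr2 +%R); [apply: (congr2 +%R)|].
    + by rewrite !mulmxA AP.
    + by rewrite !mulmxA mulmxV // mul1mx.
    + by rewrite -[F k *+ k]scaler_nat -scalemxAr scaler_nat.
  by rewrite FS mulmxDr !mulmxA.
- by move=> x [].
- by move=> x [].
Qed.

Lemma point_not_generic : (0 < n)%N -> ~ generic_dtype Ao Bo point_def.
Proof.
move=> n0 [V [A [Cf [_ [_ [f [_ H]]]]]]].
have ij : (ord0 : 'I_n.+1) != ord_max by apply/eqP => /(congr1 val) /= e; rewrite -e in n0.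
apply: (H _ _ ij) => v.
have v0 : v = 0 by exact: (thinmx0 (v : 'rV[C]_0)).
rewrite v0; exact (eq_trans (linear0 _) (esym (linear0 _))).
Qed.
End point.
End formal_simplification.

(** * Generic deformations are formally simplifiable *)

Section eigenframes.
Variable R : realType.
Local Notation C := (Cplx R).

(* [k] vanishes on no neighbourhood of [x], so [x] is a limit of zeros of [g]. *)
Lemma mul_zero_cancel (V : normedModType C) (U : set V) (k g : V -> C) (x v : V) : open U -> U x ->
  differentiable k x -> 'D_v k x != 0 -> continuous_at x g ->
  (forall y, U y -> k y * g y = 0) -> g x = 0.
Proof.
move=> oU Ux dk dk0 /cont_nrm cg kg; apply: contrapT => /eqP gx.
have gx0 : 0 < nrm (g x) by rewrite lt_neqAle nrm_ge0 eq_sym nrm_eq0 gx.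
have [e1 e10 e1P] := cg _ gx0; have [e2 e20 e2P] := open_nrm oU Ux.
have m0 : 0 < Num.min e1 e2 by rewrite lt_min e10.
have k0 y : nrm (y - x) < Num.min e1 e2 -> 0 = k y.
  rewrite lt_min => /andP[/e1P h /e2P /kg /eqP]; rewrite mulf_eq0 => /orP[/eqP -> //|/eqP gy].
  by move: h; rewrite gy sub0r nrmN ltxx.
have [_ E] := near_eq_diff m0 k0 (differentiable_cst (0 : C) x).
by move: dk0; rewrite (eq_trans (E v) (derive_cst _ _ _)) eqxx.
Qed.

Lemma diff_diag (V : normedModType C) n (f : V -> 'rV[C]_n) x : differentiable f x ->
  differentiable (fun y => diag_mx (f y)) x.
Proof.
move=> df; apply: diff_mx => i j.
have -> : (fun y => (diag_mx (f y)) i j) = (fun y => if i == j then f y 0 i else 0).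
  by apply/funext => y; rewrite mxE; case: eqP.
by case: eqP => _; [exact: diff_entry|exact: differentiable_cst].
Qed.
Lemma derive_diag (V : normedModType C) n (f : V -> 'rV[C]_n) x v : differentiable f x ->
  'D_v (fun y => diag_mx (f y)) x = diag_mx ('D_v f x).
Proof.
move=> df; apply/matrixP => i j.
refine (eq_trans (esym (derive_entry v i j (diff_diag df))) _); rewrite mxE.
have [<-|ij] := eqVneq i j.
  refine (eq_trans _ (derive_entry v 0 i df)).
  by congr ('D_v _ x); apply/funext => y; rewrite mxE eqxx.
have -> : (fun y => (diag_mx (f y)) i j) = cst 0.
  by apply/funext => y; rewrite mxE (negbTE ij).
by rewrite derive_cst.
Qed.

Lemma entry_comm_diag n (u : 'rV[C]_n) (M : 'M[C]_n) i j :
  (M *m diag_mx u - diag_mx u *m M) i j = M i j * (u 0 j - u 0 i).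
Proof. by rewrite mul_diag_mx mul_mx_diag !mxE; ring. Qed.
Lemma entry_diag_comm n (u : 'rV[C]_n) (M : 'M[C]_n) i j :
  (diag_mx u *m M - M *m diag_mx u) i j = (u 0 i - u 0 j) * M i j.
Proof. by rewrite mul_diag_mx mul_mx_diag !mxE; ring. Qed.

Lemma nc_dBc (A : pzRingType) (g gi dg b : A) : g * gi = 1 ->
  (- (gi * dg * gi) * b + gi * 0) * g + gi * b * dg = gi * b * g * (gi * dg) - gi * dg * (gi * b * g).
Proof.
move=> h; rewrite mulr0 addr0 [RHS]addrC; congr (_ + _); first by rewrite !mulNr !mulrA.
by rewrite !mulrA -(mulrA (gi * b)) h mulr1.
Qed.
(** [a g = g L] says that [g] is an eigenframe. Its derivative, conjugated by [g] and combined with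
    the structure equation for [da], relates [theta = gi dg] to the conjugates [cB] of [c] and [bc]
    of [b]. *)
Lemma nc_dA (A : pzRingType) (g gi dg a da c cB b bc L dL : A) : gi * g = 1 -> g * gi = 1 ->
  a * g = g * L -> da * g + a * dg = dg * L + g * dL ->
  da = c + (c * b - b * c) -> cB = gi * c * g -> bc = gi * b * g ->
  gi * dg * L - L * (gi * dg) = cB - dL + (cB * bc - bc * cB).
Proof.
move=> h1 h2 e1 e2 e3 e4 e5.
have La : L * gi = gi * a by rewrite -[L]mul1r -h1 -(mulrA gi) -e1 -!mulrA h2 mulr1.
have e6 : gi * da * g = gi * dg * L + dL - L * (gi * dg).
  have := congr1 (fun z => gi * z) e2; rewrite !mulrDr !mulrA h1 mul1r => e7.
  by rewrite -e7 La addrK.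
have -> : gi * dg * L - L * (gi * dg) = gi * da * g - dL by rewrite e6 addrAC addrK.
have -> : cB * bc = gi * c * b * g.
  by rewrite e4 e5 !mulrA -(mulrA (gi * c)) h2 mulr1.
have -> : bc * cB = gi * b * c * g.
  by rewrite e4 e5 !mulrA -(mulrA (gi * b)) h2 mulr1.
by rewrite e4 e3 mulrDr mulrBr mulrDl mulrBl !mulrA addrAC.
Qed.
Lemma nc_comm_conj (A : pzRingType) (g gi a c L : A) : gi * g = 1 -> g * gi = 1 ->
  a * g = g * L -> a * c = c * a -> gi * c * g * L - L * (gi * c * g) = 0.
Proof.
move=> h1 h2 e1 e2.
have La : L * gi = gi * a by rewrite -[L]mul1r -h1 -(mulrA gi) -e1 -!mulrA h2 mulr1.
by rewrite -mulrA -e1 !mulrA La -(mulrA gi a) e2 !mulrA subrr.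
Qed.

Section frame.
Variables (d n : nat).
Local Notation V := 'rV[C]_d.
Local Notation M := 'M[C]_n.+1.
Variables (U : set V) (A : V -> M) (Cv : V -> V -> M) (B : M) (S : V -> M) (f : V -> 'rV[C]_n.+1)
  (vv : 'I_n.+1 -> 'I_n.+1 -> V).
Definition fd p q (y : V) : C := f y 0 p - f y 0 q.
(* The component along [v] of the form [S^-1 dS]. *)
Definition th v x : M := invmx (S x) *m 'D_v S x.
Definition Bc x : M := invmx (S x) *m B *m S x.
Hypotheses (oU : open U) (hA : holomorphic_on U A) (hC : forall v, holomorphic_on U (Cv v))
  (hS : holomorphic_on U S) (hf : holomorphic_on U f) (uS : forall x, U x -> S x \in unitmx).
Hypothesis AS : forall x, U x -> A x *m S x = S x *m diag_mx (f x).
Hypothesis AC : forall v x, U x -> A x *m Cv v x = Cv v x *m A x.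
Hypothesis dA : forall v x, U x -> 'D_v A x = Cv v x + (Cv v x *m B - B *m Cv v x).
Hypothesis nz : forall p q x, U x -> p != q -> 'D_(vv p q) (fd p q) x != 0.

Lemma holo_fd p q : holomorphic_on U (fd p q).
Proof. by move=> x /hf dfx; apply: differentiableB; exact: diff_entry. Qed.
Lemma derive_fd v p q x : U x -> 'D_v (fd p q) x = ('D_v f x) 0 p - ('D_v f x) 0 q.
Proof.
move=> /hf dfx; have dp := diff_derv v (diff_entry 0 p dfx); have dq := diff_derv v (diff_entry 0 q dfx).
refine (eq_trans (deriveB dp dq) _).
exact (congr2 (fun a b => a - b) (derive_entry v 0 p dfx) (derive_entry v 0 q dfx)).
Qed.
Lemma derive_fdC v p q x : U x -> 'D_v (fd q p) x = - 'D_v (fd p q) x.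
Proof. by move=> Ux; rewrite !derive_fd // opprB. Qed.
Lemma holo_th v : holomorphic_on U (th v).
Proof.
move=> x Ux; apply: diff_mul; first by apply: diff_inv; [exact: hS|exact: uS].
exact: (holo_derive_mx v oU hS).
Qed.
Lemma holo_Bc : holomorphic_on U Bc.
Proof.
move=> x Ux; apply: diff_mul; last exact: hS.
apply: diff_mul; last exact: differentiable_cst.
by apply: diff_inv; [exact: hS|exact: uS].
Qed.
Lemma derive_Bc v x : U x -> 'D_v Bc x = Bc x *m th v x - th v x *m Bc x.
Proof.
move=> Ux; have dS := hS Ux; have u := uS Ux; have di := diff_inv dS u.
have db : differentiable (cst B : V -> M) x by exact: differentiable_cst.
refine (eq_trans (derive_mul v (diff_mul di db) dS) _).
refine (eq_trans (congr1 (fun z => z *m S x + _) (derive_mul v di db)) _).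
rewrite (_ : 'D_v (cst B : V -> M) x = 0); last exact: derive_cst.
rewrite derive_inv //; exact: nc_dBc (mulmxV u).
Qed.
Lemma frame_eq v x : U x ->
  th v x *m diag_mx (f x) - diag_mx (f x) *m th v x =
  (invmx (S x) *m Cv v x *m S x) - diag_mx ('D_v f x) +
  ((invmx (S x) *m Cv v x *m S x) *m Bc x - Bc x *m (invmx (S x) *m Cv v x *m S x)).
Proof.
move=> Ux; have dS := hS Ux; have u := uS Ux; have dAx := hA Ux; have dfx := hf Ux.
have [e e0 eP] := open_nrm oU Ux.
have [_ E] := near_eq_diff (f := fun y => S y *m diag_mx (f y)) (g := fun y => A y *m S y) e0
  (fun y yd => esym (AS (eP y yd))) (diff_mul dS (diff_diag dfx)).
have e2 : 'D_v A x *m S x + A x *m 'D_v S x = 'D_v S x *m diag_mx (f x) + S x *m diag_mx ('D_v f x).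
  rewrite -(derive_diag v dfx) -(derive_mul v dS (diff_diag dfx)) -(derive_mul v dAx dS).
  exact (E v).
exact: (@nc_dA M (S x) (invmx (S x)) _ _ _ _ _ _ _ _ _ (mulVmx u) (mulmxV u) (AS Ux) e2 (dA v Ux) erefl erefl).
Qed.
(** Commutation with [A] makes [f_p - f_q] kill the entry [(p, q)], and [mul_zero_cancel] removes
    this factor. Once the matrix is diagonal, the commutators drop out of the diagonal of
    [frame_eq], which becomes the equality with [df]. *)
Lemma conj_C v x : U x -> invmx (S x) *m Cv v x *m S x = diag_mx ('D_v f x).
Proof.
move=> Ux; have u := uS Ux.
have cz y p q : U y -> fd p q y * (invmx (S y) *m Cv v y *m S y) p q = 0.
  move=> Uy; have uy := uS Uy.
  have := @nc_comm_conj M _ _ _ _ _ (mulVmx uy) (mulmxV uy) (AS Uy) (AC v Uy).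
  move/matrixP/(_ p q); rewrite entry_comm_diag [X in _ = X]mxE => /eqP.
  rewrite mulf_eq0 subr_eq0 => /orP[/eqP ->|/eqP e]; first by rewrite mulr0.
  by rewrite /fd e subrr mul0r.
have off p q : p != q -> (invmx (S x) *m Cv v x *m S x) p q = 0.
  move=> pq; apply: (@mul_zero_cancel _ U (fd p q) (fun y => (invmx (S y) *m Cv v y *m S y) p q) x (vv p q) oU Ux).
  - exact: holo_fd.
  - exact: nz.
  - apply: differentiable_continuous; apply: diff_entry; apply: diff_mul; last exact: hS.
    by apply: diff_mul; [apply: diff_inv; [exact: hS|exact: uS]|exact: hC].
  - by move=> y Uy; exact: cz.
have := frame_eq v Ux; set c := _ *m S x in off * => fe; clearbody c.
have cd : c = diag_mx (\row_p c p p).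
  apply/matrixP => p q; rewrite !mxE; have [<-|/off ->//] := eqVneq p q; by rewrite mulr1n.
rewrite {1}cd; congr diag_mx; apply/rowP => p; rewrite mxE.
move/matrixP/(_ p p): fe; rewrite entry_comm_diag subrr mulr0.
have c0 : (c *m Bc x - Bc x *m c) p p = 0.
  by rewrite -opprB mxE {1 2}cd entry_comm_diag subrr mulr0 oppr0.
rewrite mxE c0 addr0 mxE [X in _ + X]mxE mxE eqxx mulr1n => /esym/eqP.
by rewrite subr_eq0 => /eqP.
Qed.
Lemma th_comm v x : U x -> th v x *m diag_mx (f x) - diag_mx (f x) *m th v x =
  diag_mx ('D_v f x) *m Bc x - Bc x *m diag_mx ('D_v f x).
Proof. by move=> Ux; rewrite frame_eq // conj_C // subrr add0r. Qed.
Lemma th_entry v x p q : U x -> th v x p q * fd q p x = 'D_v (fd p q) x * Bc x p q.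
Proof.
move=> Ux; have h := congr1 (fun Z : M => Z p q) (th_comm v Ux).
have h1 := eq_trans (esym (entry_comm_diag (f x) (th v x) p q)) h.
have h2 := eq_trans h1 (entry_diag_comm _ _ _ _).
rewrite (derive_fd v p q Ux); exact h2.
Qed.

(* By [Bc_Fo] and [th_Fo] this factor does not depend on the direction [vv p q]. *)
Definition Fo p q x := th (vv p q) x p q / 'D_(vv p q) (fd p q) x.
Lemma Bc_Fo p q x : U x -> p != q -> Bc x p q = Fo p q x * fd q p x.
Proof.
move=> Ux pq; have z := nz Ux pq.
by rewrite /Fo mulrAC th_entry // mulrAC divff // mul1r.
Qed.
Lemma diff_Dfd v p q x : U x -> differentiable ('D_v (fd p q)) x.
Proof. by move=> Ux; apply: (@holo_derive R V (fd p q) U v oU _ x Ux); exact: holo_fd. Qed.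
Lemma diff_Fo p q x : U x -> p != q -> differentiable (Fo p q) x.
Proof.
move=> Ux pq; apply: (differentiableM (f := fun x => th (vv p q) x p q)).
  by apply: diff_entry; exact: holo_th.
by apply: differentiableV; [exact: diff_Dfd|exact: nz].
Qed.
(** By [th_entry] and [Bc_Fo] the identity holds after multiplication by [f_p - f_q], which can be
    cancelled. Thus the entry of [theta] is a multiple of [d (f_p - f_q)] also where the eigenvalues
    coincide. *)
Lemma th_Fo v p q x : U x -> p != q -> th v x p q = Fo p q x * 'D_v (fd p q) x.
Proof.
move=> Ux pq; apply/eqP; rewrite -subr_eq0; apply/eqP.
apply: (@mul_zero_cancel _ U (fd p q) (fun x => th v x p q - Fo p q x * 'D_v (fd p q) x) x (vv p q) oU Ux).
- exact: holo_fd.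
- exact: nz.
- apply: differentiable_continuous; apply: differentiableB; first by apply: diff_entry; exact: holo_th.
  by apply: differentiableM; [exact: diff_Fo|exact: diff_Dfd].
- move=> y Uy; have h1 := th_entry v p q Uy; have h2 := Bc_Fo Uy pq.
  have fC : fd p q y = - fd q p y by rewrite /fd opprB.
  rewrite mulrBr; apply/eqP; rewrite subr_eq0; apply/eqP.
  by rewrite fC !mulNr (mulrC (fd q p y)) h1 h2; congr (- _); ring.
Qed.
(** The derivative is [[B, theta]_pp]. Each term [B_pq theta_qp - theta_pq B_qp] is [F_pq F_qp]
    times a difference of two equal products of [f_p - f_q] and its derivative. *)
Lemma Bc_diag_const v p x : U x -> 'D_v (fun y => Bc y p p) x = 0.
Proof.
move=> Ux; refine (eq_trans (derive_entry v p p (holo_Bc Ux)) _).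
rewrite derive_Bc // !mxE -sumrB big1 // => q _.
have [->|pq] := eqVneq q p; first by rewrite mulrC subrr.
have qp : p != q by rewrite eq_sym.
rewrite (Bc_Fo Ux pq) (Bc_Fo Ux qp) (th_Fo v Ux pq) (th_Fo v Ux qp) (derive_fdC v p q Ux).
have fC : fd p q x = - fd q p x by rewrite /fd opprB.
by rewrite fC; move: (Fo p q x) (Fo q p x) ('D_v _ x) (fd q p x) => *; ring.
Qed.
(** Maurer-Cartan gives [d theta = - theta /\ theta]; the diagonal of the right-hand side is a sum
    of wedge products of two multiples of [d (f_p - f_q)], hence zero. *)
Lemma th_closed v w p x : U x -> 'D_w (fun y => th v y p p) x = 'D_v (fun y => th w y p p) x.
Proof.
move=> Ux; have dS := hS Ux; have u := uS Ux; have di := diff_inv dS u.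
have D a b : 'D_a (th b) x = invmx (S x) *m 'D_a ('D_b S) x - th a x *m th b x.
  refine (eq_trans (derive_mul a di (holo_derive_mx b oU hS Ux)) _).
  refine (eq_trans (congr1 (fun z => z *m 'D_b S x + _) (derive_inv a dS u)) _).
  rewrite /th; move: (invmx (S x)) ('D_a S x) ('D_b S x) ('D_a ('D_b S) x) => P Q T W.
  by rewrite addrC mulNmx !mulmxA.
refine (eq_trans (derive_entry w p p (holo_th v Ux)) (eq_trans _ (esym (derive_entry v p p (holo_th w Ux))))).
refine (eq_trans (congr1 (fun Z : M => Z p p) (D w v)) (eq_trans _ (esym (congr1 (fun Z : M => Z p p) (D v w))))).
have gen (P P' Q T : M) : P = P' -> Q p p = T p p -> (invmx (S x) *m P - Q) p p = (invmx (S x) *m P' - T) p p.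
  by move=> -> QT; rewrite [LHS]mxE [RHS]mxE; congr (_ + _); rewrite [LHS]mxE [RHS]mxE QT.
apply: gen; first exact (@holo_schwarz_mx R V _ _ S U v w x oU hS Ux).
apply/eqP; rewrite -subr_eq0 [X in X - _]mxE [X in _ - X]mxE -sumrB; apply/eqP.
have c1 (s t : C) : s * t - t * s = 0 by ring.
have c2 (s t y z : C) : (s * y) * (t * - z) - (s * z) * (t * - y) = 0 by ring.
rewrite big1 // => q _; have [pq|pq] := eqVneq q p; first by subst q; exact (c1 _ _).
have qp : p != q by rewrite eq_sym.
refine (eq_trans (congr2 (fun a b : C => a - b) (congr2 *%R (th_Fo w Ux qp) (th_Fo v Ux pq))
  (congr2 *%R (th_Fo v Ux qp) (th_Fo w Ux pq))) _).
refine (eq_trans (congr2 (fun a b : C => Fo p q x * 'D_w (fd p q) x * (Fo q p x * a) - Fo p q x * 'D_v (fd p q) x * (Fo q p x * b))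
  (derive_fdC v p q Ux) (derive_fdC w p q Ux)) _).
exact (c2 _ _ _ _).
Qed.
End frame.
End eigenframes.

(** * The formal gauge transformation over a parameter space *)

Section formal_frames.
Variable R : realType.
Local Notation C := (Cplx R).

Lemma derive_zero_on (V W : normedModType C) (U : set V) (H : V -> W) x v : open U -> U x ->
  (forall y, U y -> H y = 0) -> 'D_v H x = 0.
Proof.
move=> oU Ux H0; have [e e0 eP] := open_nrm oU Ux.
have E0 y : nrm (y - x) < e -> cst 0 y = H y by move=> /eP /H0 ->.
have [_ E] := near_eq_diff e0 E0 (differentiable_cst (0 : W) x).
exact (eq_trans (E v) (derive_cst _ _ _)).
Qed.
Lemma derive_sum4 (V W : normedModType C) (f1 f2 f3 f4 : V -> W) x v : differentiable f1 x ->
  differentiable f2 x -> differentiable f3 x -> differentiable f4 x ->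
  'D_v (fun y => f1 y - f2 y + f3 y - f4 y) x = 'D_v f1 x - 'D_v f2 x + 'D_v f3 x - 'D_v f4 x.
Proof.
move=> d1 d2 d3 d4; have d12 := differentiableB d1 d2; have d123 := differentiableD d12 d3.
refine (eq_trans (deriveB (diff_derv v d123) (diff_derv v d4)) _).
refine (congr1 (fun z => z - 'D_v f4 x) _).
refine (eq_trans (deriveD (diff_derv v d12) (diff_derv v d3)) _).
exact (congr1 (fun z => z + 'D_v f3 x) (deriveB (diff_derv v d1) (diff_derv v d2))).
Qed.
Section recursion.
Variables (d n : nat).
Local Notation V := 'rV[C]_d.
Local Notation M := 'M[C]_n.+1.
Variables (U : set V) (A : V -> M) (Cv : V -> V -> M) (B : M) (S : V -> M) (f : V -> 'rV[C]_n.+1)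
  (vv : 'I_n.+1 -> 'I_n.+1 -> V) (b : 'rV[C]_n.+1).
Hypotheses (oU : open U) (hA : holomorphic_on U A) (hC : forall v, holomorphic_on U (Cv v))
  (hS : holomorphic_on U S) (hf : holomorphic_on U f) (uS : forall x, U x -> S x \in unitmx).
Hypothesis AS : forall x, U x -> A x *m S x = S x *m diag_mx (f x).
Hypothesis AC : forall v x, U x -> A x *m Cv v x = Cv v x *m A x.
Hypothesis dA : forall v x, U x -> 'D_v A x = Cv v x + (Cv v x *m B - B *m Cv v x).
Hypothesis nz : forall p q x, U x -> p != q -> 'D_(vv p q) (fd f p q) x != 0.
Hypothesis thd : forall v x p, U x -> th S v x p p = 0.
Hypothesis bE : forall x p, U x -> Bc B S x p p = b 0 p.
Let L x : M := diag_mx (f x).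
Let c v x : M := diag_mx ('D_v f x).
Let T v x : M := th S v x.
Let Q x : M := Bc B S x.
Let dQ v x : U x -> 'D_v Q x = Q x *m T v x - T v x *m Q x.
Proof. exact (@derive_Bc R d n U B S hS uS v x). Qed.
Let Tc v x : U x -> T v x *m L x - L x *m T v x = c v x *m Q x - Q x *m c v x.
Proof. exact (@th_comm R d n U A Cv B S f vv oU hA hC hS hf uS AS AC dA nz v x). Qed.
Let hQ : holomorphic_on U Q.
Proof. exact: holo_Bc. Qed.
Let hT v : holomorphic_on U (T v).
Proof. exact: holo_th. Qed.

(** Differentiating [w^k] contributes [k F_k], which is absorbed into the diagonal exponent as
    [b - k]. *)
Definition bet k : M := diag_mx (\row_p (b 0 p - k%:R)).
Lemma betS k : bet k.+1 + 1%:M = bet k.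
Proof.
apply/matrixP => i j; rewrite !mxE; case: (i == j); last by rewrite !mulr0n addr0.
by rewrite -natr1 !mulr1n; ring.
Qed.
(* The off-diagonal entries solve one direction of the x-equation: the divisor
   is a derivative of [f_p - f_q], and [f_p - f_q] itself may vanish. *)
Definition offd (F : V -> M) x : M :=
  \matrix_(p, q) if p == q then 0 else
    ('D_(vv p q) F x + T (vv p q) x *m F x) p q / 'D_(vv p q) (fd f p q) x.
(** A diagonal part [g] enters the diagonal of the z-equation one order later through [b_p g_p - g_p
    (b_p - k - 1) = (k + 1) g_p]; it is chosen to cancel the contribution of the off-diagonal
    part. *)
Definition nextF k (F : V -> M) x : M :=
  offd F x + diag_mx (\row_p (- k.+1%:R^-1 * (Q x *m offd F x) p p)).
Fixpoint Fk k : V -> M := if k is j.+1 then nextF j (Fk j) else fun=> 1%:M.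
(** The preceding coefficient, zero at order 0, so that all orders obey equations of one shape. *)
Definition Fp k : V -> M := if k is j.+1 then Fk j else fun=> 0.

Lemma holo_offd F : holomorphic_on U F -> holomorphic_on U (offd F).
Proof.
move=> hF x Ux; apply: diff_mx => p q.
have [pq|pq] := eqVneq p q.
  rewrite (_ : (fun y => _) = cst 0); first exact: differentiable_cst.
  by apply/funext => y; rewrite mxE pq eqxx.
rewrite (_ : (fun y => _) = (fun y => ('D_(vv p q) F y + T (vv p q) y *m F y) p q * ('D_(vv p q) (fd f p q) y)^-1)).
  apply: (differentiableM (f := fun y => ('D_(vv p q) F y + T (vv p q) y *m F y) p q)).
    apply: diff_entry; apply: differentiableD; first exact: (holo_derive_mx _ oU hF).
    by apply: diff_mul; [exact: hT|exact: hF].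
  by apply: differentiableV; [exact: (diff_Dfd oU hf)|exact: nz].
by apply/funext => y; rewrite [LHS]mxE (negbTE pq).
Qed.
Lemma holo_Fk k : holomorphic_on U (Fk k).
Proof.
elim: k => [|k IH] x Ux; first exact: differentiable_cst.
have hO := holo_offd IH Ux.
apply: differentiableD; first exact: hO.
apply: diff_diag; apply: diff_mx => i p.
rewrite (_ : (fun y => _) = (fun y => - k.+1%:R^-1 * (Q y *m offd (Fk k) y) p p)).
  apply: differentiableM; first exact: differentiable_cst.
  by apply: diff_entry; apply: diff_mul; [exact: hQ|exact: hO].
by apply/funext => y; rewrite mxE.
Qed.
Lemma holo_Fp k : holomorphic_on U (Fp k).
Proof. by case: k => [|k] x Ux; [exact: differentiable_cst|exact: holo_Fk]. Qed.

(* The z- and x-components of the gauge equation at order [k], and the diagonal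
   of the z-component at order [k + 1], where the next coefficient drops out. *)
Definition Zeq k := forall x, U x ->
  L x *m Fk k x - Fk k x *m L x + Q x *m Fp k x - Fp k x *m (bet k + 1%:M) = 0.
Definition Xeq k := forall v x, U x ->
  Fk k x *m c v x - c v x *m Fk k x + 'D_v (Fp k) x + T v x *m Fp k x = 0.
Definition Deq k := forall x p, U x -> (Q x *m Fk k x - Fk k x *m bet k) p p = 0.

(** At order 0 this is the definition of [b]; at later orders it is the purpose of the diagonal part
    of [nextF]. *)
Lemma Deq_all k : Deq k.
Proof.
move=> x p Ux; case: k => [|k].
  have gen (X : M) dd : (X - diag_mx dd) p p = X p p - dd 0 p by rewrite !mxE eqxx mulr1n.
  by rewrite /= mulmx1 mul1mx gen bE // mxE subr0 subrr.
rewrite /= /nextF mulmxDr mulmxDl.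
have O0 : offd (Fk k) x p p = 0 by rewrite mxE eqxx.
set O := offd _ _ in O0 *; have bp := bE p Ux; rewrite -/(Q x) in bp.
move: (Q x) bp => q bp; move: (q *m O) => qO.
have gen (X Y : M) g e : Y p p = 0 -> (X + q *m diag_mx g - (Y *m diag_mx e + diag_mx g *m diag_mx e)) p p =
    X p p + q p p * g 0 p - g 0 p * e 0 p.
  by rewrite !mul_mx_diag !mxE eqxx mulr1n => ->; rewrite mul0r add0r.
rewrite gen // bp !mxE.
have z : k.+1%:R != 0 :> C by rewrite pnatr_eq0.
by move: (k.+1%:R : C) z (qO p p) (b 0 p) => z z0 q' bb; field.
Qed.

Lemma dZeq k : Zeq k -> forall v x, U x ->
  (c v x *m Fk k x - Fk k x *m c v x) + (L x *m 'D_v (Fk k) x - 'D_v (Fk k) x *m L x) +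
  ((Q x *m T v x - T v x *m Q x) *m Fp k x + Q x *m 'D_v (Fp k) x) - 'D_v (Fp k) x *m (bet k + 1%:M) = 0.
Proof.
move=> HZ v x Ux; have H0 := derive_zero_on v oU Ux HZ.
have dL : differentiable L x by apply: diff_diag; exact: hf.
have dF := holo_Fk k Ux; have dP := holo_Fp k Ux; have dq := hQ Ux.
have db : differentiable (cst (bet k + 1%:M) : V -> M) x by exact: differentiable_cst.
have E := derive_sum4 v (diff_mul dL dF) (diff_mul dF dL) (diff_mul dq dP) (diff_mul dP db).
have EL : 'D_v L x = c v x by exact: (derive_diag v (hf Ux)).
have Eb : 'D_v (cst (bet k + 1%:M) : V -> M) x = 0 by exact: derive_cst.
move: (eq_trans (esym E) H0).
rewrite (derive_mul v dL dF) (derive_mul v dF dL) (derive_mul v dq dP) (derive_mul v dP db).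
rewrite EL Eb (dQ v Ux).
move: ('D_v (Fk k) x) ('D_v (Fp k) x) (c v x) (Q x *m T v x - T v x *m Q x) (Q x) (bet k + 1%:M) (L x) (Fk k x) (Fp k x).
move=> DF DP cc qt q be l F P <-; rewrite mulmx0 addr0.
congr (_ + _ - _).
by rewrite opprD [- _ - _]addrC addrACA.
Qed.

(** By [nc_residual] the residuals satisfy [Z_pq d (f_q - f_p) = (f_p - f_q) X_pq]. The choice of
    [offd] makes [X_pq] vanish in the direction [vv p q], where the derivative is nonzero, so
    [Z_pq = 0]; then [(f_p - f_q) X_pq = 0] in every direction and the factor is cancelled. The
    diagonal of [Z] is [Deq]. *)
Lemma XZ_step k : Zeq k -> Xeq k -> Zeq k.+1 /\ Xeq k.+1.
Proof.
move=> HZ HX.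
pose Z x : M := L x *m Fk k.+1 x - Fk k.+1 x *m L x + Q x *m Fk k x - Fk k x *m bet k.
pose X v x : M := Fk k.+1 x *m c v x - c v x *m Fk k.+1 x + 'D_v (Fk k) x + T v x *m Fk k x.
have ZX v x : U x -> Z x *m c v x - c v x *m Z x = L x *m X v x - X v x *m L x.
  move=> Ux; apply: (@nc_residual M (L x) (c v x) (T v x) (Q x) (bet k + 1%:M) (Fk k x) (Fp k x)
    (Fk k.+1 x) ('D_v (Fk k) x) ('D_v (Fp k) x)).
  - exact: diag_mxC.
  - exact: (eq_trans (mulmxDl _ _ _) (eq_trans (congr2 +%R (diag_mxC _ _) (eq_trans (mul1mx _) (esym (mulmx1 _)))) (esym (mulmxDr _ _ _)))).
  - exact: Tc.
  - exact: HZ.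
  - exact: dZeq.
  - exact: HX.
  - by [].
  - rewrite /Z; congr (_ - _ *m _); exact (esym (addrK _ _)).
have ZXe v x p q : U x -> Z x p q * 'D_v (fd f q p) x = fd f p q x * X v x p q.
  move=> Ux; have h := congr1 (fun Y : M => Y p q) (ZX v x Ux).
  have h1 := eq_trans (esym (entry_comm_diag _ (Z x) p q)) h.
  have h2 := eq_trans h1 (entry_diag_comm _ _ _ _).
  by rewrite (derive_fd hf v q p Ux).
have Fo p q x : U x -> p != q -> X (vv p q) x p q = 0.
  move=> Ux pq; rewrite /X.
  have nzp := nz Ux pq.
  have e : Fk k.+1 x p q = ('D_(vv p q) (Fk k) x + T (vv p q) x *m Fk k x) p q / 'D_(vv p q) (fd f p q) x.
    by rewrite /= /nextF [LHS]mxE [X in X + _]mxE [X in _ + X]mxE (negbTE pq) mulr0n addr0.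
  move: e nzp; rewrite (derive_fd hf _ p q Ux) -addrA.
  move: (Fk k.+1 x) ('D_(vv p q) (Fk k) x + _) => G W e nzp.
  rewrite [LHS]mxE entry_comm_diag e; move: (W p q) nzp => w.
  move: ('D_ _ f x 0 p) ('D_ _ f x 0 q) => s t st; field; exact: st.
have Zoff p q x : U x -> p != q -> Z x p q = 0.
  move=> Ux pq; have := ZXe (vv p q) x p q Ux; rewrite Fo // mulr0 => /eqP.
  by rewrite mulf_eq0 (derive_fdC hf _ p q Ux) oppr_eq0 (negbTE (nz Ux pq)) orbF => /eqP.
have Z0 x : U x -> Z x = 0.
  move=> Ux; apply/matrixP => p q; rewrite [RHS]mxE.
  have [<-|pq] := eqVneq p q; last exact: Zoff.
  have gen (G Y1 Y2 : M) l : (Y1 - Y2) p p = 0 -> (diag_mx l *m G - G *m diag_mx l + Y1 - Y2) p p = 0.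
    by rewrite mul_diag_mx mul_mx_diag !mxE => h; rewrite -addrA h; ring.
  exact (gen _ _ _ _ (Deq_all k p Ux)).
have hX v : holomorphic_on U (X v).
  move=> x Ux; have dc : differentiable (c v) x by apply: diff_diag; exact: (holo_derive_mx v oU hf).
  have dG := holo_Fk k.+1 Ux.
  apply: differentiableD; last by apply: diff_mul; [exact: hT|exact: holo_Fk].
  apply: differentiableD; last exact: (holo_derive_mx v oU (@holo_Fk k)).
  by apply: differentiableB; exact: diff_mul.
have Xoff v x p q : U x -> p != q -> X v x p q = 0.
  move=> Ux pq; apply: (@mul_zero_cancel R _ U (fd f p q) (fun y => X v y p q) x (vv p q) oU Ux).
  + exact: (holo_fd hf).
  + exact: nz.
  + by apply: differentiable_continuous; apply: diff_entry; exact: hX.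
  + by move=> y Uy; rewrite -ZXe // Z0 // mxE mul0r.
have X0 v x : U x -> X v x = 0.
  move=> Ux; apply/matrixP => p q; rewrite [RHS]mxE.
  have [<-|pq] := eqVneq p q; last exact: Xoff.
  (* The diagonal of [nc_residual_diag] reads [k X_pp = 0]. At [k = 0] this says nothing, and the
     normalization [thd] of the frame takes over. *)
  have [k0|k0] := eqVneq k 0%N.
    have h1 : 'D_v (Fk k) x = 0 by rewrite k0; exact: derive_cst.
    have h2 : Fk k x = 1%:M by rewrite k0.
    rewrite /X h1 h2 mulmx1 addr0 [LHS]mxE entry_comm_diag subrr mulr0 add0r; exact: thd.
  have E := @nc_residual_diag M (L x) (c v x) (T v x) (Q x) (bet k) (Fk k x) (Fk k.+1 x) ('D_v (Fk k) x) (X v x)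
    (Tc v Ux) erefl (Z0 x Ux).
  have dD : ((Q x *m T v x - T v x *m Q x) *m Fk k x + Q x *m 'D_v (Fk k) x - 'D_v (Fk k) x *m bet k) p p = 0.
    have dF := holo_Fk k Ux; have dq := hQ Ux.
    have db : differentiable (cst (bet k) : V -> M) x by exact: differentiable_cst.
    have d1 := diff_mul dq dF; have d2 := diff_mul dF db.
    have H0 := derive_zero_on v oU Ux (fun y Uy => @Deq_all k y p Uy).
    have H1 := eq_trans (esym (derive_entry v p p (differentiableB d1 d2))) H0.
    rewrite -[RHS]H1; apply: (congr1 (fun Y : M => Y p p)); apply: esym.
    refine (eq_trans (deriveB (diff_derv v d1) (diff_derv v d2)) _).
    refine (eq_trans (congr2 (fun a b : M => a - b) (derive_mul v dq dF) (derive_mul v dF db)) _).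
    have -> : 'D_v (cst (bet k) : V -> M) x = 0 by exact: derive_cst.
    by rewrite (dQ v Ux) mulmx0 addr0.
  have h := congr1 (fun Y : M => Y p p) E.
  have rhs0 (Y1 Y2 Y3 G : M) (l1 l2 l3 : 'rV[C]_n.+1) : Y1 p p = 0 ->
     (Y1 + ((Y2 *m diag_mx l1 - diag_mx l1 *m Y2) + (Y3 *m diag_mx l2 - diag_mx l2 *m Y3)) -
       (G *m diag_mx l1 - diag_mx l1 *m G) *m diag_mx l3) p p = 0.
    by rewrite !mul_diag_mx !mul_mx_diag !mxE => ->; ring.
  have h0 := eq_trans h (rhs0 _ _ _ _ _ _ _ dD).
  have lhs (q' Y : M) g : (forall i j, i != j -> Y i j = 0) ->
      (q' *m Y - Y *m diag_mx g) p p = q' p p * Y p p - Y p p * g 0 p.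
    move=> Yo; have e : (q' *m Y) p p = q' p p * Y p p.
      rewrite mxE (bigD1 p isT) big1; first exact: addr0.
      by move=> i ip; exact (eq_trans (congr1 (fun z => q' p i * z) (Yo i p ip)) (mulr0 _)).
    rewrite mul_mx_diag -e; move: (q' *m Y) => W.
    by rewrite !mxE.
  have h2 := eq_trans (esym (lhs _ _ _ (fun i j => Xoff v x i j Ux))) h0.
  have bk : (\row_i (b 0 i - k%:R) : 'rV[C]_n.+1) 0 p = b 0 p - k%:R by rewrite mxE.
  move: h2; rewrite (bE p Ux); move: (X v x p p) => y; rewrite bk; move: (b 0 p) => bb h2; have : k%:R * y = 0 by rewrite -[RHS]h2; ring.
  by move/eqP; rewrite mulf_eq0 pnatr_eq0 (negbTE k0) => /eqP.
split.
- move=> x Ux; rewrite betS; exact: Z0.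
- exact: X0.
Qed.

Lemma XZ_all k : Zeq k /\ Xeq k.
Proof.
elim: k => [|k [HZ HX]]; last exact: XZ_step.
split=> [x Ux|v x Ux]; first by rewrite /= mulmx1 mul1mx subrr add0r mulmx0 mul0mx subrr.
have -> : 'D_v (Fp 0) x = 0 by exact: derive_cst.
by rewrite /= mulmx1 mul1mx subrr add0r mulmx0 addr0.
Qed.
Lemma betE k : bet k = diag_mx b - k%:R%:M.
Proof. by apply/matrixP => i j; rewrite !mxE; case: (i == j); rewrite ?mulr1n ?mulr0n ?subr0. Qed.

(** The coefficients [Fk k] are relative to the eigenframe; in the original frame they become
    [S Fk k]. *)
Lemma formal_frame : exists Phi : nat -> V -> M,
  [/\ forall k, holomorphic_on U (Phi k), forall x, Phi 0%N x = S x,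
    forall x k, U x -> A x *m Phi k.+1 x + B *m Phi k x + Phi k x *+ k =
      Phi k.+1 x *m diag_mx (f x) + Phi k x *m diag_mx b,
    forall v x, U x -> Cv v x *m S x = S x *m diag_mx ('D_v f x)
  & forall v x k, U x -> - (Cv v x *m Phi k.+1 x) + 'D_v (Phi k) x = - (Phi k.+1 x *m diag_mx ('D_v f x))].
Proof.
have CS v x : U x -> Cv v x *m S x = S x *m diag_mx ('D_v f x).
  move=> Ux; rewrite -(@conj_C R d n U A Cv B S f vv oU hA hC hS hf uS AS AC dA nz v x Ux).
  by rewrite -!mulmxA mulKVmx //; exact: uS.
exists (fun k x => S x *m Fk k x); split=> //.
- by move=> k x Ux; apply: diff_mul; [exact: hS|exact: holo_Fk].
- by move=> x; exact: mulmx1.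
- move=> x k Ux; have [HZ _] := XZ_all k.+1; have := HZ x Ux.
  rewrite betS betE; have u := uS Ux.
  have -> : B *m (S x *m Fk k x) = S x *m (Q x *m Fk k x).
    by rewrite /Q /Bc !mulmxA mulmxV // mul1mx.
  have -> : A x *m (S x *m Fk k.+1 x) = S x *m (L x *m Fk k.+1 x) by rewrite !mulmxA AS.
  have -> : (S x *m Fk k x) *+ k = S x *m (Fk k x *+ k) by rewrite -[in RHS]scaler_nat -scalemxAr scaler_nat.
  rewrite -!mulmxA -!mulmxDr => H; congr (S x *m _).
  apply/eqP; rewrite -subr_eq0 -[X in _ == X]H; apply/eqP.
  rewrite /= -/(Fk k.+1) mulmxBr mul_mx_scalar scaler_nat.
  move: (Q x *m Fk k x) (Fk k x *m diag_mx b) (Fk k x *+ k) (L x *m nextF k (Fk k) x) (nextF k (Fk k) x *m L x) => a e g h i.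
  by rewrite opprB !opprD !addrA; apply/matrixP => p q; rewrite !mxE; ring.
- move=> v x k Ux; have [_ HX] := XZ_all k.+1; have := HX v x Ux.
  have -> : Cv v x *m (S x *m Fk k.+1 x) = S x *m (c v x *m Fk k.+1 x) by rewrite !mulmxA CS.
  have dS := hS Ux; have dF := holo_Fk k Ux; have u := uS Ux.
  have eD : 'D_v (fun y => S y *m Fk k y) x = S x *m (T v x *m Fk k x) + S x *m 'D_v (Fk k) x.
    refine (eq_trans (derive_mul v dS dF) _).
    by rewrite /T /th; move: ('D_v S x) => DS; rewrite !mulmxA mulmxV // mul1mx.
  have -> : Fp k.+1 = Fk k by [].
  move=> H; refine (eq_trans (congr1 (fun z => _ + z) eD) _).
  move: H; move: (Fk k.+1 x) => G.
  move: (T v x *m Fk k x) ('D_v (Fk k) x) => a e; rewrite -/(c v x); move: (c v x) => cc H.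
  rewrite -mulmxA; move: H; move: (cc *m G) (G *m cc) => p q H.
  rewrite -!mulmxN -!mulmxDr; congr (S x *m _).
  apply/eqP; rewrite -subr_eq0 -[X in _ == X]H; apply/eqP.
  by apply/matrixP => i j; rewrite !mxE; ring.
Qed.
End recursion.
End formal_frames.

(** * Normalized eigenframes and the inclusion *)

Section generic_deformations.
Variable R : realType.
Local Notation C := (Cplx R).

Lemma finite_ball (V : normedModType C) (x0 : V) (I : finType) (P : I -> V -> Prop) :
  (forall i, exists2 e : R, 0 < e & forall y, nrm (y - x0) < e -> P i y) ->
  exists2 e : R, 0 < e & forall y, nrm (y - x0) < e -> forall i, P i y.
Proof.
move=> H; pose e i := sval (cid2 (H i)).
have eP i : forall y, nrm (y - x0) < e i -> P i y := s2valP' (cid2 (H i)).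
have e0 i : 0 < e i := s2valP (cid2 (H i)).
exists (\big[Num.min/1]_i e i).
  by apply: (big_ind (fun z => 0 < z)) => // a b a0 b0; rewrite lt_min a0.
move=> y ye i; apply: eP; apply: lt_le_trans ye _.
by rewrite (bigD1 i) //= ge_min lexx.
Qed.
Lemma near_neq0 (V : normedModType C) (g : V -> C) x0 : continuous_at x0 g -> g x0 != 0 ->
  exists2 e : R, 0 < e & forall y, nrm (y - x0) < e -> g y != 0.
Proof.
move=> /cont_nrm cg g0; have n0 : 0 < nrm (g x0) by rewrite lt_neqAle nrm_ge0 eq_sym nrm_eq0 g0.
have [e e0 eP] := cg _ n0; exists e => // y /eP h; apply/eqP => gy; move: h.
by rewrite gy sub0r nrmN ltxx.
Qed.

Section directions.
Variable d : nat.
Local Notation V := 'rV[C]_d.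
Lemma derive_sum_delta_mx m n (A : V -> 'M[C]_(m, n)) x v : differentiable A x ->
  'D_v A x = \sum_i v 0 i *: 'D_(delta_mx 0 i) A x.
Proof.
move=> df; rewrite deriveE // {1}[v]matrix_sum_delta big_ord1 linear_sum.
by apply: eq_bigr => i _; rewrite linearZ deriveE.
Qed.
End directions.

Section normalize.
Variables (d n : nat).
Local Notation V := 'rV[C]_d.
Local Notation M := 'M[C]_n.+1.
Variables (S : V -> M) (D : 'I_n.+1 -> V -> C) (x : V).
Let Dm y := diag_mx (\row_p D p y).
Hypotheses (dS : differentiable S x) (uS : S x \in unitmx) (dD : forall p, differentiable (D p) x)
  (D0 : forall p, D p x != 0).
Hypothesis DE : forall p i, 'D_(delta_mx 0 i) (D p) x = - (th S (delta_mx 0 i) x p p * D p x).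

Lemma diff_row : differentiable (fun y => \row_p D p y) x.
Proof.
apply: diff_mx => i p; rewrite (_ : (fun y => _) = D p) //.
by apply/funext => y; rewrite mxE.
Qed.
Lemma unit_scaled : S x *m Dm x \in unitmx.
Proof.
rewrite unitmx_mul uS /= unitmxE det_diag unitfE; apply/prodf_neq0 => p _; by rewrite mxE.
Qed.
Lemma diff_scaled : differentiable (fun y => S y *m Dm y) x.
Proof. by apply: diff_mul => //; apply: diff_diag; exact: diff_row. Qed.
Lemma derive_scaling v p : 'D_v (D p) x = - (th S v x p p * D p x).
Proof.
rewrite (derive_sum_delta v (dD p)) (eq_bigr _ (fun i _ => congr1 (fun z => v 0 i * z) (DE p i))).
rewrite /th (derive_sum_delta_mx v dS) mulmx_sumr summxE mulr_suml -sumrN; apply: eq_bigr => i _.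
rewrite -scalemxAr [in RHS]mxE; move: ((_ *m _) p p) (D p x) => a b; ring.
Qed.
(** Rescaling column [p] by [D_p] adds [d D_p / D_p] to [theta_pp], and [DE] makes this
    [- theta_pp]. *)
Lemma th_scaled v p : th (fun y => S y *m Dm y) v x p p = 0.
Proof.
have dm : differentiable Dm x by apply: diff_diag; exact: diff_row.
have E1 := derive_mul v dS dm.
have E2 : S x *m (Dm x *m th (fun y => S y *m Dm y) v x) = 'D_v (fun y => S y *m Dm y) x.
  by rewrite mulmxA /th; apply: mulKVmx; exact: unit_scaled.
have E3 : Dm x *m th (fun y => S y *m Dm y) v x = th S v x *m Dm x + 'D_v Dm x.
  have := congr1 (mulmx (invmx (S x))) (eq_trans E2 E1); move: (th _ _ _) => t.
  by rewrite mulKmx // mulmxDr mulKmx // /th mulmxA.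
have E4 := congr1 (fun Y : M => Y p p) E3.
have E5 : ('D_v Dm x) p p = 'D_v (D p) x.
  rewrite (derive_diag v diff_row) [LHS]mxE eqxx mulr1n -(derive_entry v 0 p diff_row).
  by congr ('D_v _ x); apply/funext => y; rewrite mxE.
move: E4; rewrite [X in _ = X]mxE E5 derive_scaling; move: (th _ _ _) (th _ _ _) => t s.
rewrite /Dm mul_diag_mx mul_mx_diag !mxE => /eqP; rewrite subrr mulf_eq0 (negbTE (D0 p)) => /eqP; exact.
Qed.
End normalize.

Section structure.
Variables (d n : nat).
Local Notation V := 'rV[C]_d.
Local Notation M := 'M[C]_n.+1.
Variables (Cf : 'I_d -> V -> M).
(** The 1-form [C] contracted with a vector: the directions [vv p q] used for division need not be
    coordinate vectors. *)
Definition Cdir (v x : V) : M := \sum_i v 0 i *: Cf i x.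
Lemma Cdir_delta i x : Cdir (delta_mx 0 i) x = Cf i x.
Proof.
rewrite /Cdir (bigD1 i) //= mxE !eqxx scale1r big1 ?addr0 // => j ji.
by rewrite mxE (negbTE ji) andbF scale0r.
Qed.
Lemma holo_Cdir U v : (forall i, holomorphic_on U (Cf i)) -> holomorphic_on U (Cdir v).
Proof.
move=> hC x Ux; apply: diff_bigsum => i; apply: differentiableZ; exact: hC.
Qed.
Lemma Cdir_comm (A : M) v x : (forall i, A *m Cf i x = Cf i x *m A) -> A *m Cdir v x = Cdir v x *m A.
Proof.
move=> H; rewrite mulmx_sumr mulmx_suml; apply: eq_bigr => i _.
by rewrite -scalemxAr -scalemxAl H.
Qed.
Lemma Cdir_derive (A : V -> M) B v x : differentiable A x ->
  (forall i, 'D_(delta_mx 0 i) A x = Cf i x + (Cf i x *m B - B *m Cf i x)) ->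
  'D_v A x = Cdir v x + (Cdir v x *m B - B *m Cdir v x).
Proof.
move=> dA H; rewrite (derive_sum_delta_mx v dA) (eq_bigr _ (fun i _ => congr1 (fun z => v 0 i *: z) (H i))).
rewrite /Cdir mulmx_sumr mulmx_suml -sumrB -big_split; apply: eq_bigr => i _ /=.
by rewrite -scalemxAr -scalemxAl -scalerBr -scalerDr.
Qed.
End structure.

Lemma const_on_ball (V : normedModType C) (g : V -> C) x0 e y :
  (forall y, nrm (y - x0) < e -> differentiable g y) ->
  (forall y v, nrm (y - x0) < e -> 'D_v g y = 0) -> nrm (y - x0) < e -> g y = g x0.
Proof.
move=> dg g0 ye.
have seg (t : R) : 0 <= t <= 1 -> nrm (x0 + toC t *: (y - x0) - x0) < e.
  move=> /andP[t0 t1]; rewrite addrAC subrr add0r nrmZ cabs_toC ger0_norm //.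
  by rewrite (le_lt_trans _ ye) // ler_piMl ?nrm_ge0.
have := @mvt_ineq R V g x0 (y - x0) 0.
rewrite mulr0 => H; have : cabs (g (x0 + (y - x0)) - g x0) <= 0.
  by apply: H => t /seg h; [exact: diff_derv (dg _ h)|rewrite g0 // cabs0].
rewrite addrCA subrr addr0 -nrmC => h; apply/eqP; rewrite -subr_eq0 -nrm_eq0.
by rewrite eq_le h nrm_ge0.
Qed.

Theorem generic_fs n (Ao Bo : 'M[C]_n.+1) : generic_dtype Ao Bo `<=` fs_type Ao Bo.
Proof.
move=> E [Vn [A [Cf [nf [_ [f [[W [S [[oW Wx hSW uSW] Hf]]] Hdist]]]]]]].
have [hfW fW] := Hf tt.
have [[oV Vx _] [[hAV hCV _] _]] := nf.
have st x i := structure_eqs nf (x := x) i.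
pose Cv := Cdir Cf; set x0 := pt E in Vx Wx Hdist *.
(* Distinct differentials differ on some vector [v]; the value for [p = q] is a placeholder. *)
have Ex p q : exists v, p != q -> 'D_v (fd f p q) x0 != 0.
  have [->|pq] := eqVneq p q; first by exists 0.
  have /existsNP[v hv] := Hdist p q pq; exists v => _; apply/eqP => h; apply: hv.
  have dfx := hfW _ Wx; have dp := diff_entry 0 p dfx; have dq := diff_entry 0 q dfx.
  have e1 := deriveB (diff_derv v dp) (diff_derv v dq).
  have := eq_trans (esym e1) h; rewrite (deriveE v dp) (deriveE v dq) => /eqP.
  by rewrite subr_eq0 => /eqP.
pose vv p q := sval (cid (Ex p q)).
have vvP p q : p != q -> 'D_(vv p q) (fd f p q) x0 != 0 := svalP (cid (Ex p q)).
pose U0 := Vn `&` W; have oU0 : open U0 by exact: openI.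
have hf0 : holomorphic_on U0 f by move=> x [_ Wx']; exact: hfW.
have U0x : U0 x0 by [].
(* The finitely many derivatives that are nonzero at [x0] stay nonzero on a common ball. *)
have [e1 e10 e1P] : exists2 e : R, 0 < e & forall y, nrm (y - x0) < e -> forall pq : 'I_n.+1 * 'I_n.+1,
    U0 y /\ (pq.1 != pq.2 -> 'D_(vv pq.1 pq.2) (fd f pq.1 pq.2) y != 0).
  apply: finite_ball => -[p q] /=; have [r0 r00 r0P] := open_nrm oU0 U0x.
  have [->|pq] := eqVneq p q; first by exists r0 => // y /r0P.
  have [|r1 r10 r1P] := @near_neq0 _ ('D_(vv p q) (fd f p q)) x0 _ (vvP p q pq).
    by apply: differentiable_continuous; exact: (diff_Dfd oU0 hf0).
  exists (Num.min r0 r1); first by rewrite lt_min r00.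
  by move=> y; rewrite lt_min => /andP[/r0P ? /r1P].
pose U1 := [set y : 'rV[C]_(pdim E) | nrm (y - x0) < e1].
have oU1 : open U1 by exact: nrm_open.
have U1x : U1 x0 by rewrite /U1 /= subrr nrm0.
have s1 y : U1 y -> U0 y by move=> /e1P /(_ (ord0, ord0)) [].
have n1 p q y : U1 y -> p != q -> 'D_(vv p q) (fd f p q) y != 0 by move=> /e1P /(_ (p, q)) [].
have sV y : U1 y -> Vn y by move=> /s1 [].
have sW y : U1 y -> W y by move=> /s1 [].
have hA y : U1 y -> differentiable A y by move=> /sV; exact: hAV.
have hC v : holomorphic_on U1 (Cv v) by apply: holo_Cdir => i y /sV; exact: hCV.
have hS : holomorphic_on U1 S by move=> y /sW; exact: hSW.
have hf : holomorphic_on U1 f by move=> y /sW; exact: hfW.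
have uS y : U1 y -> S y \in unitmx by move=> /sW; exact: uSW.
have AS y : U1 y -> A y *m S y = S y *m diag_mx (f y).
  by move=> Uy; rewrite -fW ?mulmxA ?mulmxV ?mul1mx //; [exact: uS|exact: sW].
have AC v y : U1 y -> A y *m Cv v y = Cv v y *m A y.
  by move=> /sV Vy; apply: Cdir_comm => i; have [] := st y i Vy.
have dA v y : U1 y -> 'D_v A y = Cv v y + (Cv v y *m Bo - Bo *m Cv v y).
  move=> Uy; apply: Cdir_derive; first exact: hA.
  by move=> i; have [] := st y i (sV y Uy).
have hth i p : holomorphic_on U1 (fun y => th S (delta_mx 0 i) y p p).
  by move=> y Uy; apply: diff_entry; exact: (holo_th oU1 hS uS).
have cth p i j y : U1 y -> 'D_(delta_mx 0 i) (fun y => th S (delta_mx 0 j) y p p) y =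
    'D_(delta_mx 0 j) (fun y => th S (delta_mx 0 i) y p p) y.
  exact: (@th_closed R _ n U1 A Cv Bo S f vv oU1 hA hC hS hf uS AS AC dA n1).
(* [D p] will be [exp] of minus a primitive of the closed form [theta_pp]; it rescales column
   [p]. *)
have ED p := @exp_primitive R _ U1 x0 (fun i y => th S (delta_mx 0 i) y p p) oU1 U1x (hth^~ p) (cth p).
pose D p := sval (cid (svalP (cid (ED p)))).
have [e2 e20 e2P] : exists2 e : R, 0 < e & forall y, nrm (y - x0) < e -> forall p : 'I_n.+1,
    [/\ U1 y, differentiable (D p) y, D p y != 0 &
      forall i, 'D_(delta_mx 0 i) (D p) y = - (th S (delta_mx 0 i) y p p * D p y)].
  apply: finite_ball => p; have [r0 H] := svalP (cid (svalP (cid (ED p)))).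
  by exists (sval (cid (ED p))).
pose U2 := [set y : 'rV[C]_(pdim E) | nrm (y - x0) < e2].
have oU2 : open U2 by exact: nrm_open.
have U2x : U2 x0 by rewrite /U2 /= subrr nrm0.
have s2 y : U2 y -> U1 y by move=> /e2P /(_ ord0) [].
pose S2 y := S y *m diag_mx (\row_p D p y).
have hS2 : holomorphic_on U2 S2.
  move=> y Uy; apply: diff_scaled; first exact: hS (s2 y Uy).
  by move=> p; have [] := e2P y Uy p.
have uS2 y : U2 y -> S2 y \in unitmx.
  move=> Uy; apply: unit_scaled; first exact: uS (s2 y Uy).
  by move=> p; have [] := e2P y Uy p.
have thd v y p : U2 y -> th S2 v y p p = 0.
  move=> Uy; apply: th_scaled.
  - exact: hS (s2 y Uy).
  - exact: uS (s2 y Uy).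
  - by move=> q; have [] := e2P y Uy q.
  - by move=> q; have [] := e2P y Uy q.
  - by move=> q i; have [_ _ _ ->] := e2P y Uy q.
have hA2 y : U2 y -> differentiable A y by move=> /s2; exact: hA.
have hC2 v : holomorphic_on U2 (Cv v) by move=> y /s2; exact: hC.
have hf2 : holomorphic_on U2 f by move=> y /s2; exact: hf.
have AS2 y : U2 y -> A y *m S2 y = S2 y *m diag_mx (f y).
  by move=> /s2 Uy; rewrite /S2 mulmxA AS // -!mulmxA (diag_mxC (f y)).
have AC2 v y : U2 y -> A y *m Cv v y = Cv v y *m A y by move=> /s2; exact: AC.
have dA2 v y : U2 y -> 'D_v A y = Cv v y + (Cv v y *m Bo - Bo *m Cv v y) by move=> /s2; exact: dA.
have n2 p q y : U2 y -> p != q -> 'D_(vv p q) (fd f p q) y != 0 by move=> /s2; exact: n1.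
(* Values at the base point suffice: the diagonal of [S2^-1 Bo S2] has zero derivative on the ball
   [U2]. *)
pose b : 'rV[C]_n.+1 := \row_p Bc Bo S2 x0 p p.
have bE y p : U2 y -> Bc Bo S2 y p p = b 0 p.
  move=> Uy; rewrite [RHS]mxE; apply: (@const_on_ball _ (fun y => Bc Bo S2 y p p) x0 e2 y _ _ Uy).
  - by move=> z Uz; apply: diff_entry; exact: (@holo_Bc R _ n U2 Bo S2 hS2 uS2 z Uz).
  - move=> z v; exact: (@Bc_diag_const R _ n U2 A Cv Bo S2 f vv oU2 hA2 hC2 hS2 hf2 uS2 AS2 AC2 dA2 n2 v p z).
have [Phi [hP P0 P1 P2 P3]] := @formal_frame R _ n U2 A Cv Bo S2 f vv b oU2 hA2 hC2 hS2 hf2 uS2 AS2 AC2 dA2 n2 thd bE.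
have dDE i x : U2 x -> 'D_(delta_mx 0 i) (fun y => diag_mx (f y)) x = diag_mx ('D_(delta_mx 0 i) f x).
  by move=> /hf2 dfx; exact: derive_diag.
apply: (@fs_intro R n Ao Bo E Vn A Cf nf U2 Phi f b oU2 U2x) => //.
- by move=> y /s2 /sV.
- by move=> x Ux; rewrite P0; exact: uS2.
- by move=> x Ux; rewrite P0; exact: AS2.
- move=> x i Ux; rewrite P0 dDE // -P2 // /Cv Cdir_delta; exact: erefl.
- move=> x i k Ux; rewrite dDE // -P3 // /Cv Cdir_delta; exact: erefl.
Qed.
End generic_deformations.

(** * A generic deformation *)

Section isomonodromic_series.
Variables (R : realType) (n : nat).
Local Notation C := (Cplx R).
Local Notation M := 'M[C]_n.+1.
Implicit Types S T : nat -> M.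

(** Series in this section are in the deformation parameter [x], not in [w]; [shiftf] is
    multiplication by [x] and [derf] is [d/dx]. *)
Definition shiftf S : nat -> M := fun k => if k is j.+1 then S j else 0.
Definition derf S : nat -> M := fun k => S k.+1 *+ k.+1.

Lemma fmulDl S S' T k : fmul (fun j => S j + S' j) T k = fmul S T k + fmul S' T k.
Proof. by rewrite /fmul -big_split; apply: eq_bigr => i _; rewrite mulmxDl. Qed.
Lemma fmulNl S T k : fmul (fun j => - S j) T k = - fmul S T k.
Proof. by rewrite /fmul -sumrN; apply: eq_bigr => i _; rewrite mulNmx. Qed.
Lemma fmulNr S T k : fmul S (fun j => - T j) k = - fmul S T k.
Proof. by rewrite /fmul -sumrN; apply: eq_bigr => i _; rewrite mulmxN. Qed.
Lemma fmul_cstl (X : M) S T k : fmul (fun j => X *m S j) T k = X *m fmul S T k.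
Proof. by rewrite /fmul mulmx_sumr; apply: eq_bigr => i _; rewrite mulmxA. Qed.
Lemma fmul_shl S T k : fmul (shiftf S) T k = shiftf (fmul S T) k.
Proof.
case: k => [|k]; first by rewrite /fmul big_ord1 mul0mx.
by rewrite /fmul big_ord_recl mul0mx add0r; apply: eq_bigr => i _; rewrite /= subSS.
Qed.
Lemma fmul_shr S T k : fmul S (shiftf T) k = shiftf (fmul S T) k.
Proof.
case: k => [|k]; first by rewrite /fmul big_ord1 mulmx0.
rewrite /fmul big_ord_recr /= subnn mulmx0 addr0; apply: eq_bigr => i _.
by rewrite subSn // -ltnS.
Qed.
(** Over a common index [i], the two sums give the [i]-th product the weights [i] and
    [k + 1 - i]. *)
Lemma derf_mul S T k : derf (fmul S T) k = fmul (derf S) T k + fmul S (derf T) k.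
Proof.
have mnl (X Y : M) j : X *+ j *m Y = (X *m Y) *+ j by exact (mulrnAl X Y j).
have mnr (X Y : M) j : X *m (Y *+ j) = (X *m Y) *+ j by exact (mulrnAr X Y j).
have -> : fmul (derf S) T k = \sum_(i < k.+2) (S i *m T (k.+1 - i)%N) *+ i.
  by rewrite [RHS]big_ord_recl mulr0n add0r; apply: eq_bigr => i _; rewrite mnl /= subSS.
have -> : fmul S (derf T) k = \sum_(i < k.+2) (S i *m T (k.+1 - i)%N) *+ (k.+1 - i).
  rewrite [RHS]big_ord_recr /= subnn mulr0n addr0; apply: eq_bigr => i _.
  by rewrite mnr /derf subSn // -ltnS.
rewrite -big_split /= /derf /fmul -sumrMnl; apply: eq_bigr => i _.
by rewrite -mulrnDr subnKC // -ltnS.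
Qed.

Section recursion.
Variables (u v b : 'rV[C]_n.+1) (B : M).
Hypothesis star : forall i j, i != j -> u 0 i = u 0 j -> B i j = 0.
Hypothesis dstar : forall i j, u 0 i = u 0 j -> forall m : int, B i i - B j j = m%:~R -> m = 0.
Let bet i j := B i i - B j j.
(** Coefficient of [F_km F_ml] in the entry [(k, l)] of [[[F, U], [V, F]]]. It equals
    [(u_m - u_k) (v_k - v_l)] when [u_k = u_l], whence the simpler weights of [quadU]. *)
Let cc k m l := (u 0 m - u 0 k) * (v 0 m - v 0 l) - (v 0 m - v 0 k) * (u 0 m - u 0 l).

Definition quad (F : nat -> M) p k l : C := \sum_(q < p.+1) \sum_m cc k m l * (F q k m * F (p - q)%N m l).
Definition quadU (F : nat -> M) p k l : C := \sum_(q < p.+1) \sum_m (u 0 m - u 0 k) * (F q k m * F (p - q)%N m l).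

(* [sum_p F p x^p] solves [(b + [F, U + x V])' = [b + [F, U + x V], [V, F]]].
   When [u_k = u_l] the equation is singular and determines [F p k l] from the
   coefficients of order at most [p] of the entries with distinct [u]. *)
Lemma isoF : exists F : nat -> M,
  [/\ forall p k, F p k k = 0,
      forall k l, u 0 k != u 0 l -> F 0%N k l = B k l / (u 0 l - u 0 k),
      forall p k l, u 0 k != u 0 l -> F p.+1 k l =
        ((v 0 k - v 0 l) * (p.+1%:R + bet k l) * F p k l + quad F p k l) / ((u 0 l - u 0 k) * p.+1%:R)
    & forall p k l, k != l -> u 0 k = u 0 l -> F p k l = - quadU F p k l / (p.+1%:R + bet k l)].
Proof.
pose nc p (f : nat -> M) : M := \matrix_(k, l) if u 0 k == u 0 l then 0 else
   if p is p'.+1 then ((v 0 k - v 0 l) * (p'.+1%:R + bet k l) * f p' k l + quad f p' k l) / ((u 0 l - u 0 k) * p'.+1%:R)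
   else B k l / (u 0 l - u 0 k).
(* At order [p] the resonant entries need the nonresonant ones of the same order, which [nc]
   computes from lower orders. *)
pose N p f q : M := if (q < p)%N then f q else nc p f.
pose step p f : M := nc p f + \matrix_(k, l) if (k != l) && (u 0 k == u 0 l) then
   - quadU (N p f) p k l / (p.+1%:R + bet k l) else 0.
have ncE p f g : (forall j, (j < p)%N -> f j = g j) -> nc p f = nc p g.
  move=> fg; apply/matrixP => k l; rewrite !mxE; case: ifP => // _; case: p fg => // p fg.
  congr ((_ * _ + _) / _); first by rewrite fg.
  apply: eq_bigr => q _; apply: eq_bigr => m _.
  by rewrite fg // fg // ltnS leq_subr.
have [|F FE] := @strong_rec M 0 step.
  move=> p f g fg; rewrite /step (ncE _ _ _ fg); apply: (congr1 (fun z => nc p g + z)); apply/matrixP => k l; rewrite [LHS]mxE [RHS]mxE.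
  case: ifP => [_|_]; last exact: erefl.
  congr (- _ / _); apply: eq_bigr => q _; apply: eq_bigr => m _.
  rewrite /N (ncE _ _ _ fg).
  have E j : (if (j < p)%N then f j else nc p g) = (if (j < p)%N then g j else nc p g).
    by case: ifP => [/fg ->|_].
  by rewrite !E.
exists F; split.
- by move=> p k; rewrite FE !mxE !eqxx addr0.
- by move=> k l ukl; rewrite FE !mxE (negbTE ukl) andbF addr0.
- by move=> p k l ukl; rewrite FE !mxE (negbTE ukl) andbF addr0.
- move=> p k l kl ukl; rewrite FE mxE mxE ukl eqxx add0r mxE kl ukl eqxx /=.
  have NF q i j : (q <= p)%N -> u 0 i != u 0 j -> N p F q i j = F q i j.
    rewrite leq_eqVlt => /orP[/eqP -> uij|qp _]; last by rewrite /N qp.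
    by rewrite /N ltnn FE [RHS]mxE [X in _ + X]mxE (negbTE uij) andbF addr0.
  congr (- _ / _); apply: eq_bigr => q _; apply: eq_bigr => m _.
  have [->|um] := eqVneq (u 0 m) (u 0 k); first by rewrite subrr !mul0r.
  have q1 : (q <= p)%N by rewrite -ltnS ltn_ord.
  have n1 : u 0 k != u 0 m by rewrite eq_sym.
  have n2 : u 0 m != u 0 l by rewrite -ukl.
  exact (congr2 (fun a c => (u 0 m - u 0 k) * (a * c)) (NF q k m q1 n1) (NF (p - q)%N m l (leq_subr _ _) n2)).
Qed.

Variable F : nat -> M.
Hypotheses (F0 : forall p k, F p k k = 0)
  (Fz : forall k l, u 0 k != u 0 l -> F 0%N k l = B k l / (u 0 l - u 0 k))
  (Fnc : forall p k l, u 0 k != u 0 l -> F p.+1 k l =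
     ((v 0 k - v 0 l) * (p.+1%:R + bet k l) * F p k l + quad F p k l) / ((u 0 l - u 0 k) * p.+1%:R))
  (Fc : forall p k l, k != l -> u 0 k = u 0 l -> F p k l = - quadU F p k l / (p.+1%:R + bet k l)).

Lemma res_neq0 p k l : u 0 k = u 0 l -> p.+1%:R + bet k l != 0.
Proof.
move=> ukl; apply/eqP => /eqP; rewrite addrC addr_eq0 => /eqP h.
by have := dstar ukl (m := - (p.+1 : int)); rewrite -/(bet k l) h mulrNz => /(_ erefl) /eqP; rewrite oppr_eq0.
Qed.

(* [thf], [UFf] and [calB] are the coefficients of [[V, F]], [[F, U]] and
   [b + [F, U + x V]]. *)
Definition thf p : M := diag_mx v *m F p - F p *m diag_mx v.
Definition UFf p : M := F p *m diag_mx u - diag_mx u *m F p.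
Definition calB p : M := (if p is 0 then diag_mx (\row_k B k k) else 0) + UFf p - shiftf thf p.

Lemma thfE p k l : thf p k l = (v 0 k - v 0 l) * F p k l.
Proof. exact: entry_diag_comm. Qed.
Lemma UFfE p k l : UFf p k l = F p k l * (u 0 l - u 0 k).
Proof. exact: entry_comm_diag. Qed.
Lemma calB0 : calB 0%N = B.
Proof.
apply/matrixP => k l; rewrite /calB /= subr0 mxE UFfE mxE [X in X *+ _]mxE.
have [->|kl] := eqVneq k l; first by rewrite F0 mul0r addr0.
rewrite mulr0n add0r; have [ukl|ukl] := eqVneq (u 0 k) (u 0 l); first by rewrite ukl subrr mulr0 star.
by rewrite Fz // divfK // subr_eq0 eq_sym.
Qed.
(** If [u_k = u_l], the factor [v_k - v_l] comes out of every term of this coefficient of [x^p],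
    which leaves [Fc]; if not, it is [Fnc] with denominators cleared. On the diagonal all weights
    [cc k m k] vanish. *)
Lemma ode_entry p k l : (F p.+1 k l * (u 0 l - u 0 k) - (v 0 k - v 0 l) * F p k l) * p.+1%:R =
  bet k l * ((v 0 k - v 0 l) * F p k l) + quad F p k l.
Proof.
have p0 : p.+1%:R != 0 :> C by rewrite pnatr_eq0.
have [<-|kl] := eqVneq k l.
  rewrite !F0 !(mul0r, mulr0) subrr mul0r add0r /quad big1 // => q _; rewrite big1 // => m _.
  by rewrite /cc; move: (F q k m * F _ m k) => w; ring.
have [ukl|ukl] := eqVneq (u 0 k) (u 0 l).
  have r0 := res_neq0 p ukl.
  have E : quad F p k l = (v 0 k - v 0 l) * quadU F p k l.
    rewrite /quad /quadU mulr_sumr; apply: eq_bigr => q _; rewrite mulr_sumr; apply: eq_bigr => m _.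
    by rewrite /cc -ukl; move: (F q k m * F _ m l) => w; ring.
  rewrite E (Fc p kl ukl) ukl subrr mulr0 sub0r; move: (quadU _ _ _ _) (v 0 k - v 0 l) p0 r0.
  by move: (p.+1%:R) (bet k l) => *; field.
rewrite Fnc //; have d0 : u 0 l - u 0 k != 0 by rewrite subr_eq0 eq_sym.
move: (quad _ _ _ _) (v 0 k - v 0 l) (F p k l) p0 d0.
by move: (p.+1%:R) (bet k l) (u 0 l - u 0 k) => *; field; apply/andP.
Qed.
(** The summand [- x [V, F]] of [calB] commutes with [[V, F]], so only [b + [F, U]] contributes to
    the commutator. *)
Lemma calB_ode p : derf calB p = fmul calB thf p - fmul thf calB p.
Proof.
pose D q : M := if q is 0 then diag_mx (\row_k B k k) else 0.
have E1 : fmul calB thf p = fmul D thf p + fmul UFf thf p - shiftf (fmul thf thf) p.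
  rewrite -fmul_shl -fmulNl -!fmulDl; exact: eq_fmul.
have E2 : fmul thf calB p = fmul thf D p + fmul thf UFf p - shiftf (fmul thf thf) p.
  rewrite -fmul_shr -fmulNr -!fmulDr; exact: eq_fmul.
have E3 : fmul D thf p = diag_mx (\row_k B k k) *m thf p.
  by rewrite /fmul big_ord_recl subn0 big1 ?addr0 // => i _; rewrite mul0mx.
have E4 : fmul thf D p = thf p *m diag_mx (\row_k B k k).
  rewrite /fmul big_ord_recr /= subnn big1 ?add0r // => i _.
  have -> : D (p - i)%N = 0 by move: (ltn_ord i); rewrite -subn_gt0; case: (p - i)%N.
  by rewrite mulmx0.
have -> : fmul calB thf p - fmul thf calB p =
    (diag_mx (\row_k B k k) *m thf p - thf p *m diag_mx (\row_k B k k)) + (fmul UFf thf p - fmul thf UFf p).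
  rewrite E1 E2 E3 E4; move: (shiftf _ _) (_ *m _) (_ *m _) (fmul _ _ _) (fmul _ _ _) => s x y z w.
  by rewrite opprB addrA subrK opprD addrACA.
apply/matrixP => k l.
have EL : derf calB p k l = (F p.+1 k l * (u 0 l - u 0 k) - (v 0 k - v 0 l) * F p k l) * p.+1%:R.
  have gen (X Y : M) : ((0 + X - Y) *+ p.+1) k l = (X k l - Y k l) * p.+1%:R.
    by rewrite add0r mulmxnE !mxE mulr_natr.
  exact (eq_trans (gen _ _) (congr2 (fun a c => (a - c) * p.+1%:R) (UFfE _ _ _) (thfE _ _ _))).
have ED : (diag_mx (\row_k B k k) *m thf p - thf p *m diag_mx (\row_k B k k)) k l =
    bet k l * ((v 0 k - v 0 l) * F p k l).
  by rewrite entry_diag_comm thfE [X in X - _]mxE [X in _ - X]mxE.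
have EQ : (fmul UFf thf p - fmul thf UFf p) k l = quad F p k l.
  rewrite mxE [X in _ + X]mxE /fmul !summxE -sumrB; apply: eq_bigr => q _.
  rewrite [X in X - _]mxE [X in _ - X]mxE -sumrB; apply: eq_bigr => m _.
  refine (eq_trans (congr2 (fun a c => a - c) (congr2 *%R (UFfE q k m) (thfE (p - q)%N m l))
    (congr2 *%R (thfE q k m) (UFfE (p - q)%N m l))) _).
  by rewrite /cc; move: (F q k m) (F (p - q)%N m l) => a c; ring.
by rewrite EL ode_entry [RHS]mxE ED EQ.
Qed.

Lemma isoG (P : M) : exists G : nat -> M, G 0%N = P /\ forall p, G p.+1 = p.+1%:R^-1 *: fmul G thf p.
Proof.
pose step k (G : nat -> M) : M := if k is p.+1 then p.+1%:R^-1 *: fmul G thf p else P.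
have [|G GE] := @strong_rec M 0 step.
  case=> // p f g fg; rewrite /step; congr (_ *: _); apply: eq_bigr => i _.
  by rewrite fg.
by exists G; split=> [|p]; rewrite GE.
Qed.
(** The defect [Y = Bo G - G calB] solves the linear equation [Y' = Y [V, F]] and vanishes at order
    0, hence at all orders. *)
Lemma isoG_conj (Bo : M) G : (forall p, G p.+1 = p.+1%:R^-1 *: fmul G thf p) ->
  Bo *m G 0%N = G 0%N *m B -> forall p, Bo *m G p = fmul G calB p.
Proof.
move=> GS G0.
have dG : derf G =1 fmul G thf.
  move=> p; rewrite /derf GS scalerMnl -mulr_natl divff ?scale1r // pnatr_eq0.
pose Y p : M := Bo *m G p - fmul G calB p.
have dY p : derf Y p = fmul Y thf p.
  have -> : derf Y p = Bo *m derf G p - derf (fmul G calB) p.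
    rewrite /derf /Y mulrnBl; congr (_ - _); exact (esym (mulrnAr (Bo : M) (G p.+1) p.+1)).
  rewrite derf_mul dG (eq_fmul p dG (frefl calB)) (eq_fmul p (frefl G) calB_ode).
  have -> : fmul G (fun j => fmul calB thf j - fmul thf calB j) p =
      fmul (fmul G calB) thf p - fmul (fmul G thf) calB p.
    by rewrite fmulDr fmulNr !fmulA.
  have -> : fmul Y thf p = Bo *m fmul G thf p - fmul (fmul G calB) thf p.
    by rewrite /Y fmulDl fmul_cstl fmulNl.
  by move: (fmul (fmul G thf) calB p) (fmul (fmul G calB) thf p) (Bo *m _) => a c e; rewrite [a + _]addrC subrK.
have Y0 p : Y p = 0.
  elim/ltn_ind: p => -[_|p IH].
    by rewrite /Y /fmul big_ord1 subnn calB0 G0 subrr.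
  have : Y p.+1 *+ p.+1 = 0.
    have := dY p; rewrite /derf => ->; rewrite /fmul big1 // => i _.
    by rewrite IH // mul0mx.
  move/eqP; rewrite -scaler_nat scaler_eq0 pnatr_eq0 => /eqP; exact.
by move=> p; apply/eqP; rewrite -subr_eq0 -/(Y p) Y0.
Qed.
End recursion.
End isomonodromic_series.

(** * Geometric bounds for the coefficients *)

Section majorants.
Variables (R : realType).
Local Notation C := (Cplx R).

Lemma finite_bound (I : finType) (g : I -> R) : exists2 G : R, 1 <= G & forall i, g i <= G.
Proof.
exists (1 + \sum_i `|g i|); first by rewrite lerDl sumr_ge0.
move=> i; rewrite (bigD1 i) //= (le_trans (ler_norm _)) // addrCA lerDl addr_ge0 ?ler01 ?sumr_ge0 //.
Qed.
Lemma cabs_sum_le (I : finType) (f : I -> C) (b : R) : (forall i, cabs (f i) <= b) ->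
  cabs (\sum_i f i) <= #|I|%:R * b.
Proof.
move=> H; rewrite -sum1_card natr_sum mulr_suml.
elim/big_rec2: _ => [|i y x _ yx]; first by rewrite cabs0.
by rewrite (le_trans (cabsD _ _)) // lerD // mul1r.
Qed.
Lemma cabs_nat k : cabs (k%:R : C) = k%:R.
Proof. by rewrite -toCn cabs_toC ger0_norm. Qed.
(** Once [p + 1 >= 2 |z|], the divisor is at least [(p + 1) / 2]; the finitely many earlier [p]
    contribute their quotients to [c]. *)
Lemma res_bound (z : C) : (forall p : nat, p.+1%:R + z != 0) ->
  exists c : R, forall p : nat, p.+1%:R <= c * cabs (p.+1%:R + z).
Proof.
move=> z0; have [P zP] : exists P : nat, 2 * cabs z <= P%:R.
  exists (Num.bound (2 * cabs z)); rewrite ltW // archi_boundP // mulr_ge0 ?cabs_ge0 //.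
exists (2 + \sum_(p < P) p.+1%:R / cabs (p.+1%:R + z)) => p.
have a0 : 0 <= \sum_(p < P) p.+1%:R / cabs (p.+1%:R + z : C).
  by apply: sumr_ge0 => i _; rewrite divr_ge0 ?cabs_ge0.
have [pP|Pp] := ltnP p P.
  have n0 : cabs (p.+1%:R + z) != 0.
    by rewrite -nrmC nrm_eq0.
  rewrite -[leLHS](divfK n0) ler_wpM2r ?cabs_ge0 //.
  rewrite (bigD1 (Ordinal pP)) //= addrCA lerDl addr_ge0 ?ler0n // sumr_ge0 // => i _.
  by rewrite divr_ge0 ?cabs_ge0.
have h1 : (p.+1%:R : R) <= cabs (p.+1%:R + z) + cabs z.
  by rewrite -[X in _ + X]cabsN -[leLHS]cabs_nat (le_trans _ (cabsD _ _)) // addrK.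
have h2 : (P%:R : R) <= p.+1%:R by rewrite ler_nat ltnW.
have h3 : (p.+1%:R : R) <= 2 * cabs (p.+1%:R + z) by lra.
rewrite (le_trans h3) // ler_wpM2r ?cabs_ge0 // lerDl //.
Qed.
(** Bounds are asked only where the weight [c m] is nonzero: in [quadU] this confines the sum to
    entries with distinct [u], whose bound is the smaller one. *)
Lemma conv_bound n p (c : 'I_n -> C) (a b : nat -> 'I_n -> C) (G N N' K : R) : 0 <= G -> 0 <= N -> 0 <= N' -> 0 <= K ->
  (forall m, cabs (c m) <= G) ->
  (forall q m, (q <= p)%N -> c m != 0 -> cabs (a q m) <= N * K ^+ q /\ cabs (b q m) <= N' * K ^+ q) ->
  cabs (\sum_(q < p.+1) \sum_m c m * (a q m * b (p - q)%N m)) <= p.+1%:R * (n%:R * (G * (N * N') * K ^+ p)).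
Proof.
move=> G0 N0 N0' K0 cG H; rewrite -[X in X%:R * _]card_ord; apply: cabs_sum_le => q.
rewrite -[X in X%:R * _]card_ord; apply: cabs_sum_le => m.
have q1 : (q <= p)%N by rewrite -ltnS.
have pos : 0 <= G * (N * N') * K ^+ p by rewrite !mulr_ge0 // exprn_ge0.
have [->|cm] := eqVneq (c m) 0; first by rewrite mul0r cabs0.
have [h1 _] := H q m q1 cm; have [_ h2] := H (p - q)%N m (leq_subr _ _) cm.
rewrite !cabsM -mulrA ler_pM ?mulr_ge0 ?cabs_ge0 //.
rewrite -[K ^+ p](_ : K ^+ q * K ^+ (p - q)%N = _); last by rewrite -exprD subnKC.
have -> : N * N' * (K ^+ q * K ^+ (p - q)) = (N * K ^+ q) * (N' * K ^+ (p - q)) by ring.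
by rewrite ler_pM ?cabs_ge0.
Qed.

Section isoF_bound.
Variables (n : nat).
Local Notation M := 'M[C]_n.+1.
Variables (u v : 'rV[C]_n.+1) (B : M) (F : nat -> M).
Hypothesis dstar : forall i j, u 0 i = u 0 j -> forall m : int, B i i - B j j = m%:~R -> m = 0.
Hypotheses (F0 : forall p k, F p k k = 0)
  (Fz : forall k l, u 0 k != u 0 l -> F 0%N k l = B k l / (u 0 l - u 0 k))
  (Fnc : forall p k l, u 0 k != u 0 l -> F p.+1 k l =
     ((v 0 k - v 0 l) * (p.+1%:R + (B k k - B l l)) * F p k l + quad u v F p k l) / ((u 0 l - u 0 k) * p.+1%:R))
  (Fc : forall p k l, k != l -> u 0 k = u 0 l -> F p k l = - quadU u F p k l / (p.+1%:R + (B k k - B l l))).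

(** Two scales: entries with distinct [u] are kept below [G K^p], the others below [N K^p]. The
    latter come from the former through [quadU], so [N] depends only on [G] and the size; [K] is
    chosen last and absorbs [N] in the passage from [p] to [p + 1]. Division by [p + 1], or by a
    resonant divisor comparable to it, offsets the [p + 1] terms of a convolution. *)
Lemma isoF_bound : exists N K : R, [/\ 1 <= N, 1 <= K & forall p k l, cabs (F p k l) <= N * K ^+ p].
Proof.
have Hc k l : exists c : R, u 0 k = u 0 l -> forall p : nat, p.+1%:R <= c * cabs (p.+1%:R + (B k k - B l l)).
  have [ukl|/eqP ukl] := eqVneq (u 0 k) (u 0 l); last by exists 0 => /ukl.
  have [c cP] := res_bound (fun p => res_neq0 dstar p ukl).
  by exists c.
pose c k l := sval (cid (Hc k l)).
have cP k l : u 0 k = u 0 l -> forall p : nat, p.+1%:R <= c k l * cabs (p.+1%:R + (B k k - B l l)) := svalP (cid (Hc k l)).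
pose cc k m l := (u 0 m - u 0 k) * (v 0 m - v 0 l) - (v 0 m - v 0 k) * (u 0 m - u 0 l).
(* A single [G] will dominate all data, inverses of differences of [u] and the constants of
   [res_bound] included. *)
pose g (t : 'I_n.+1 * 'I_n.+1 * 'I_n.+1) : R := let: (k, m, l) := t in
  cabs (u 0 l - u 0 k) + cabs (v 0 k - v 0 l) + (1 + cabs (B k k - B l l)) + cabs (cc k m l) +
  cabs (u 0 l - u 0 k)^-1 + cabs (B k l / (u 0 l - u 0 k)) + `|c k l|.
have [G G1 gG] := finite_bound g.
have G0 : 0 <= G by rewrite (le_trans ler01).
have GE k m l : [/\ cabs (u 0 l - u 0 k) <= G, cabs (v 0 k - v 0 l) <= G, 1 + cabs (B k k - B l l) <= G &
    cabs (cc k m l) <= G] /\ [/\ cabs (u 0 l - u 0 k)^-1 <= G, cabs (B k l / (u 0 l - u 0 k)) <= G & c k l <= G].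
  have := gG (k, m, l); rewrite /g.
  have := cabs_ge0 (u 0 l - u 0 k); have := cabs_ge0 (v 0 k - v 0 l); have := cabs_ge0 (B k k - B l l).
  have := cabs_ge0 (cc k m l); have := cabs_ge0 (u 0 l - u 0 k)^-1; have := cabs_ge0 (B k l / (u 0 l - u 0 k)).
  have := normr_ge0 (c k l); have := ler_norm (c k l).
  move: (c k l) `|c k l| (cabs _) (cabs _) (cabs _) (cabs _) (cabs _) (cabs _) => *.
  by split; split; lra.
pose n1 : R := n.+1%:R.
have n10 : 0 <= n1 by exact: ler0n.
pose N := G + G * (n1 * (G * (G * G))).
have NG : G <= N by rewrite lerDl !mulr_ge0.
have N0 : 0 <= N by rewrite (le_trans G0).
(* [W K^p] bounds the nonresonant entries at order [p + 1]; [W <= K] and [1 <= G] turn it into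
   [G K^(p+1)]. *)
pose W := G * (G * G * N + n1 * (G * (N * N))).
have W0 : 0 <= W by rewrite !(mulr_ge0, addr_ge0).
pose K := 1 + W.
have K0 : 0 <= K by rewrite addr_ge0.
have K1 : 1 <= K by rewrite lerDl.
have Kp p : 0 <= K ^+ p by exact: exprn_ge0.
pose NC p := forall k l, u 0 k != u 0 l -> cabs (F p k l) <= G * K ^+ p.
have allP p : (forall q, (q <= p)%N -> NC q) -> forall k l, cabs (F p k l) <= N * K ^+ p.
  move=> H k l; have [ukl|ukl] := eqVneq (u 0 k) (u 0 l); last first.
    by rewrite (le_trans (H p (leqnn p) k l ukl)) // ler_wpM2r.
  have [->|kl] := eqVneq k l; first by rewrite F0 cabs0 mulr_ge0.
  rewrite (Fc p kl ukl) cabsM cabsN cabsV.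
  have r0 : 0 < cabs (p.+1%:R + (B k k - B l l)).
    by rewrite -nrmC lt_neqAle nrm_ge0 eq_sym nrm_eq0 (res_neq0 dstar).
  rewrite ler_pdivrMr //.
  have QB : cabs (quadU u F p k l) <= p.+1%:R * (n1 * (G * (G * G) * K ^+ p)).
    apply: (@conv_bound _ p (fun m => u 0 m - u 0 k) (fun q m => F q k m) (fun q m => F q m l)) => //.
      by move=> m; have [[]] := GE k k m.
    move=> q m qp; rewrite subr_eq0 => um; split; apply: H => //; first by rewrite eq_sym.
    by rewrite -ukl.
  apply: le_trans QB _.
  have cG : p.+1%:R <= G * cabs (p.+1%:R + (B k k - B l l)).
    apply: le_trans (cP k l ukl p) _; rewrite ler_wpM2r ?cabs_ge0 //.
    by have [_ []] := GE k k l.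
  have -> : N * K ^+ p * cabs (p.+1%:R + (B k k - B l l)) =
    G * cabs (p.+1%:R + (B k k - B l l)) * (n1 * (G * (G * G) * K ^+ p)) + G * K ^+ p * cabs (p.+1%:R + (B k k - B l l)).
    by rewrite /N; ring.
  rewrite (le_trans (y := G * cabs (p.+1%:R + (B k k - B l l)) * (n1 * (G * (G * G) * K ^+ p)))) //.
    by rewrite ler_wpM2r // !mulr_ge0.
  by rewrite lerDl !mulr_ge0 ?cabs_ge0.
have ncP p : NC p.
  elim/ltn_ind: p => -[_|p IH] k l ukl.
    by rewrite Fz // expr0 mulr1; have [_ []] := GE k k l.
  have FB q i j : (q <= p)%N -> cabs (F q i j) <= N * K ^+ q.
    by move=> qp; apply: allP => r rq; apply: IH; rewrite ltnS (leq_trans rq).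
  rewrite Fnc // invfM mulrA cabsM cabsM (cabsV p.+1%:R) cabs_nat ler_pdivrMr //.
  have [[_ Gv Gb _] [Gi _ _]] := GE k k l.
  have rb : cabs (p.+1%:R + (B k k - B l l)) <= p.+1%:R * G.
    rewrite (le_trans (cabsD _ _)) // cabs_nat (le_trans (y := p.+1%:R * (1 + cabs (B k k - B l l)))) //.
      by rewrite mulrDr mulr1 lerD2l ler_peMl ?cabs_ge0 // ler1n.
    by rewrite ler_wpM2l.
  have QB : cabs (quad u v F p k l) <= p.+1%:R * (n1 * (G * (N * N) * K ^+ p)).
    apply: (@conv_bound _ p (fun m => cc k m l) (fun q m => F q k m) (fun q m => F q m l)) => //.
      by move=> m; have [[]] := GE k m l.
    by move=> q m qp _; split; exact: FB.
  have num : cabs ((v 0 k - v 0 l) * (p.+1%:R + (B k k - B l l)) * F p k l + quad u v F p k l) <=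
      G * (p.+1%:R * G) * (N * K ^+ p) + p.+1%:R * (n1 * (G * (N * N) * K ^+ p)).
    rewrite (le_trans (cabsD _ _)) // lerD // !cabsM ler_pM ?mulr_ge0 ?cabs_ge0 //.
      by rewrite ler_pM ?cabs_ge0.
    exact: FB.
  apply: le_trans (ler_pM (cabs_ge0 _) (cabs_ge0 _) num Gi) _.
  have -> : (G * (p.+1%:R * G) * (N * K ^+ p) + p.+1%:R * (n1 * (G * (N * N) * K ^+ p))) * G = W * K ^+ p * p.+1%:R.
    by rewrite /W; ring.
  rewrite ler_wpM2r // exprS mulrA ler_wpM2r //.
  by rewrite (le_trans (y := K)) // ?lerDr // ler_peMl.
exists N, K; split=> //; first by rewrite (le_trans G1).
by move=> p k l; apply: allP => q _; exact: ncP.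
Qed.
End isoF_bound.

(** The equation [G' = G T] is linear: the division by [p + 1] offsets the convolution, and one more
    order costs a factor [(n + 1) N], which is part of [K']. *)
Lemma fmul_ode_bound n (G T : nat -> 'M[C]_n.+1) (N K : R) : 0 <= N -> 0 <= K ->
  (forall p, G p.+1 = p.+1%:R^-1 *: fmul G T p) -> (forall p k l, cabs (T p k l) <= N * K ^+ p) ->
  exists N' K' : R, [/\ 1 <= N', 1 <= K' & forall p k l, cabs (G p k l) <= N' * K' ^+ p].
Proof.
move=> N0 K0 GS TB.
have [N' N'1 N'P] := finite_bound (fun t : 'I_n.+1 * 'I_n.+1 => cabs (G 0%N t.1 t.2)).
have N'0 : 0 <= N' by rewrite (le_trans ler01).
pose K' := 1 + K + n.+1%:R * N.
have nN : 0 <= n.+1%:R * N by rewrite mulr_ge0.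
have K'0 : 0 <= K' by rewrite !addr_ge0.
have KK' : K <= K' by rewrite /K'; lra.
exists N', K'; split=> //; first by rewrite /K'; lra.
elim/ltn_ind => -[_|p IH] k l; first by rewrite expr0 mulr1; exact: N'P (k, l).
have TB' q m : cabs (T q m l) <= N * K' ^+ q.
  by rewrite (le_trans (TB q m l)) // ler_wpM2l // lerXn2r.
have QB := @conv_bound n.+1 p (fun=> 1) (fun q m => G q k m) (fun q m => T q m l) 1 N' N K' ler01 N'0 N0 K'0 _ _.
rewrite GS mxE cabsM cabsV cabs_nat mulrC ler_pdivrMr //.
have -> : fmul G T p k l = \sum_(q < p.+1) \sum_m 1 * (G q k m * T (p - q)%N m l).
  by rewrite /fmul summxE; apply: eq_bigr => q _; rewrite mxE; apply: eq_bigr => m _; rewrite mul1r.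
apply: le_trans (QB _ _) _.
- by move=> m; rewrite -toC1 cabs_toC normr1.
- by move=> q m qp _; split; [apply: IH; rewrite ltnS|exact: TB'].
rewrite mul1r mulrC ler_wpM2r // exprS.
have -> : n.+1%:R * (N' * N * K' ^+ p) = (n.+1%:R * N) * (N' * K' ^+ p) by ring.
have -> : N' * (K' * K' ^+ p) = K' * (N' * K' ^+ p) by ring.
by rewrite ler_wpM2r ?mulr_ge0 ?exprn_ge0 // lerDr addr_ge0.
Qed.
End majorants.

(** * Convergent power series *)

Section convergent_series.
Variables (R : realType).
Local Notation C := (Cplx R).

Lemma archi_le0 (a M : R) : (forall N : nat, a * 2 ^+ N <= M) -> a <= 0.
Proof.
move=> H; rewrite leNgt; apply/negP => a0.
have M0 : 0 <= M by rewrite (le_trans _ (H 0%N)) // mulr_ge0 // ltW.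
have := archi_boundP (divr_ge0 M0 (ltW a0)); set N := Num.bound _; rewrite ltr_pdivrMr // => h.
have h2 : N%:R * a <= 2 ^+ N * a.
  by rewrite ler_wpM2r ?(ltW a0) // -natrX ler_nat ltnW // ltn_expl.
by have := lt_le_trans h (le_trans h2 _); rewrite mulrC => /(_ _ (H N)); rewrite ltxx.
Qed.

(* Convergence with an error [O(2^-N)], which every series below satisfies. *)
Definition sums (z : nat -> C) (s : C) : Prop :=
  exists M : R, forall N : nat, cabs (s - \sum_(i < N) z i) * 2 ^+ N <= M.

(** The intervals from [S N - e N] to [S N + e N] are nested because [e N - e N.+1 = M / 2^N]
    dominates the next term; the sum is the supremum of the left ends. *)
Lemma real_sums (a : nat -> R) (M : R) : (forall i, `|a i| * 2 ^+ i <= M) ->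
  exists s, forall N : nat, `|s - \sum_(i < N) a i| * 2 ^+ N <= 2 * M.
Proof.
move=> aM; pose S N := \sum_(i < N) a i; pose e N : R := 2 * M / 2 ^+ N.
have p0 N : 0 < (2 ^+ N : R) by rewrite exprn_gt0.
have M0 : 0 <= M by rewrite (le_trans _ (aM 0%N)) // mulr_ge0.
have aE N : `|a N| <= e N - e N.+1.
  have -> : e N - e N.+1 = M / 2 ^+ N by rewrite /e exprS; field; rewrite gt_eqF.
  by rewrite ler_pdivlMr.
have LS N : S N - e N <= S N.+1 - e N.+1.
  by rewrite /S big_ord_recr /=; have := aE N; rewrite ler_norml => /andP[]; lra.
have US N : S N.+1 + e N.+1 <= S N + e N.
  by rewrite /S big_ord_recr /=; have := aE N; rewrite ler_norml => /andP[]; lra.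
have Lm N K : S N - e N <= S (N + K)%N - e (N + K)%N.
  by elim: K => [|K IH]; rewrite ?addn0 // addnS (le_trans IH).
have Um N K : S (N + K)%N + e (N + K)%N <= S N + e N.
  by elim: K => [|K IH]; rewrite ?addn0 // addnS (le_trans _ IH).
have e0 N : 0 <= e N by rewrite divr_ge0 ?mulr_ge0 // ltW.
have LU N K : S N - e N <= S K + e K.
  have := Lm N K; have := Um K N; rewrite addnC; have := e0 (N + K)%N; lra.
pose A := [set S N - e N | N in [set: nat]].
have A0 : A !=set0 by exists (S 0%N - e 0%N); exists 0%N.
have ubA K : ubound A (S K + e K) by move=> _ [N _ <-].
exists (sup A) => N.
have h1 : S N - e N <= sup A by apply: ub_le_sup; [exists (S 0%N + e 0%N)|exists N].
have h2 : sup A <= S N + e N by apply: ge_sup.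
rewrite -ler_pdivlMr // ler_norml -/(e N) -/(S N); lra.
Qed.

Lemma cre_sum (I : Type) (r : seq I) (F : I -> C) : cre (\sum_(i <- r) F i) = \sum_(i <- r) cre (F i).
Proof. by elim: r => [|i r IH]; rewrite ?big_nil // !big_cons creD IH. Qed.
Lemma cim_sum (I : Type) (r : seq I) (F : I -> C) : cim (\sum_(i <- r) F i) = \sum_(i <- r) cim (F i).
Proof. by elim: r => [|i r IH]; rewrite ?big_nil // !big_cons cimD IH. Qed.
Lemma sums_ex z (M : R) : (forall i, cabs (z i) * 2 ^+ i <= M) -> exists s, sums z s.
Proof.
move=> zM; have p0 N : 0 <= (2 ^+ N : R) by rewrite exprn_ge0.
have [|a aP] := @real_sums (fun i => cre (z i)) M.
  by move=> i; rewrite (le_trans _ (zM i)) // ler_wpM2r // cre_le.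
have [|b bP] := @real_sums (fun i => cim (z i)) M.
  by move=> i; rewrite (le_trans _ (zM i)) // ler_wpM2r // cim_le.
exists (cx a b), (2 * M + 2 * M) => N.
rewrite (le_trans (y := (`|a - \sum_(i < N) cre (z i)| + `|b - \sum_(i < N) cim (z i)|) * 2 ^+ N)) //.
  by rewrite ler_wpM2r // (le_trans (cabs_le _)) // creD cimD creN cimN cre_cx cim_cx cre_sum cim_sum.
by rewrite mulrDl lerD.
Qed.
Lemma sums_lim0 z (s : C) : sums z s -> forall c : R, (forall N, cabs (\sum_(i < N) z i) <= c) -> cabs s <= c.
Proof.
move=> [M HM] c Hc; rewrite -subr_le0; apply: (@archi_le0 _ M) => N; apply: le_trans (HM N).
rewrite ler_wpM2r ?exprn_ge0 // lerBlDr.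
have {1}-> : s = (s - \sum_(i < N) z i) + \sum_(i < N) z i by rewrite subrK.
by rewrite (le_trans (cabsD _ _)) // lerD2l.
Qed.
Lemma geo_sum (a : nat -> R) (M : R) N : 0 <= M -> (forall i, a i * 2 ^+ i <= M) -> \sum_(i < N) a i <= 2 * M.
Proof.
move=> M0 aM; have p0 k : 0 < (2 ^+ k : R) by rewrite exprn_gt0.
have : \sum_(i < N) a i <= 2 * M - 2 * M / 2 ^+ N.
  elim: N => [|N IH]; first by rewrite big_ord0 expr0 divr1 subrr.
  rewrite big_ord_recr /=; have h : a N <= M / 2 ^+ N by rewrite ler_pdivlMr.
  have -> : 2 * M / 2 ^+ N.+1 = M / 2 ^+ N by rewrite exprS; field; rewrite gt_eqF.
  by move: IH h; rewrite -[2 * M / _]mulrA; move: (M / _) (\sum_(i < N) _) (a N) => *; lra.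
by move=> h; rewrite (le_trans h) // gerBl divr_ge0 ?mulr_ge0 // ltW.
Qed.
Lemma cabs_sumr N (z : nat -> C) : cabs (\sum_(i < N) z i) <= \sum_(i < N) cabs (z i).
Proof.
elim: N => [|N IH]; first by rewrite !big_ord0 cabs0.
by rewrite !big_ord_recr /= (le_trans (cabsD _ _)) // lerD.
Qed.
Lemma sums_le z s (M : R) : (forall i, cabs (z i) * 2 ^+ i <= M) -> sums z s -> cabs s <= 2 * M.
Proof.
move=> zM zs; apply: (sums_lim0 zs) => N; apply: le_trans (cabs_sumr _ _) _.
apply: (@geo_sum (fun i => cabs (z i))) => //; by rewrite (le_trans _ (zM 0%N)) // mulr_ge0 ?cabs_ge0.
Qed.
Lemma eq_sums z z' s : z =1 z' -> sums z s -> sums z' s.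
Proof. by move=> /funext ->. Qed.
Lemma sumsD z z' s s' : sums z s -> sums z' s' -> sums (fun i => z i + z' i) (s + s').
Proof.
move=> [M HM] [M' HM']; exists (M + M') => N.
rewrite big_split opprD addrACA (le_trans (y := (cabs (s - \sum_(i < N) z i) + cabs (s' - \sum_(i < N) z' i)) * 2 ^+ N)) //.
  by rewrite ler_wpM2r ?exprn_ge0 // cabsD.
by rewrite mulrDl lerD.
Qed.
Lemma sumsZ a z s : sums z s -> sums (fun i => a * z i) (a * s).
Proof.
move=> [M HM]; exists (cabs a * M) => N.
by rewrite -mulr_sumr -mulrBr cabsM -mulrA ler_wpM2l ?cabs_ge0.
Qed.
Lemma sumsN z s : sums z s -> sums (fun i => - z i) (- s).
Proof.
by move=> /(sumsZ (- 1)); rewrite mulN1r; apply: eq_sums => i; rewrite mulN1r.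
Qed.
Lemma sums0 : sums (fun=> 0) 0.
Proof. by exists 0 => N; rewrite big1 // subrr cabs0 mul0r. Qed.
Lemma sums_sum (I : finType) (z : I -> nat -> C) (s : I -> C) : (forall i, sums (z i) (s i)) ->
  sums (fun k => \sum_i z i k) (\sum_i s i).
Proof.
move=> H; have : forall r : seq I, sums (fun k => \sum_(i <- r) z i k) (\sum_(i <- r) s i).
  elim=> [|i r IH]; first by rewrite big_nil; apply: eq_sums sums0 => k; rewrite big_nil.
  by rewrite big_cons; apply: eq_sums (sumsD (H i) IH) => k; rewrite big_cons.
exact.
Qed.
Lemma sums_shift z s : sums z s -> sums (fun i => if i is j.+1 then z j else 0) s.
Proof.
move=> [M HM]; have M0 : 0 <= M by rewrite (le_trans _ (HM 0%N)) // mulr_ge0 ?cabs_ge0.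
exists (2 * M) => -[|N].
  by rewrite big_ord0 (le_trans (y := M)) //; [have := HM 0%N; rewrite big_ord0|rewrite ler_peMl // ler1n].
by rewrite big_ord_recl add0r exprS mulrCA ler_wpM2l.
Qed.
Lemma sums_uniq z s t : sums z s -> sums z t -> s = t.
Proof.
move=> zs zt; have h := sumsD zs (sumsN zt).
have : cabs (s - t) <= 0.
  by apply: (sums_lim0 h) => N; rewrite big1 ?cabs0 // => i _; rewrite subrr.
rewrite -nrmC => h0; apply/eqP; rewrite -subr_eq0 -nrm_eq0 eq_le h0; exact: nrm_ge0.
Qed.
Lemma sums_const a : sums (fun i => if i is 0 then a else 0) a.
Proof.
exists (cabs a) => -[|N]; first by rewrite big_ord0 subr0 mulr1.
by rewrite big_ord_recl big1 // addr0 subrr cabs0 mul0r cabs_ge0.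
Qed.

Definition conv (a b : nat -> C) k := \sum_(i < k.+1) a i * b (k - i)%N.
Lemma conv_sum (a b : nat -> C) N : \sum_(k < N) conv a b k = \sum_(i < N) a i * \sum_(j < N - i) b j.
Proof.
elim: N => [|N IH]; first by rewrite !big_ord0.
rewrite big_ord_recr /= IH /conv.
transitivity (\sum_(i < N.+1) (a i * (\sum_(j < N - i) b j) + a i * b (N - i)%N)).
  by rewrite big_split; congr (_ + _); rewrite [RHS]big_ord_recr /= subnn big_ord0 mulr0 addr0.
apply: eq_bigr => i _; have iN : (i <= N)%N by rewrite -ltnS ltn_ord.
by rewrite (subSn iN) big_ord_recr mulrDr.
Qed.
(** One factor decays like [4^-i], so that [sum_i |a_i| 2^i] converges; the tails of [b] after
    [N - i] terms, weighted by [a_i], then add up to [O(2^-N)]. *)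
Lemma sumsM a b s t (M : R) : (forall i, cabs (a i) * 4 ^+ i <= M) -> sums a s -> sums b t ->
  sums (conv a b) (s * t).
Proof.
move=> aM [Ma HA] [Mb HB]; have p0 N : 0 < (2 ^+ N : R) by rewrite exprn_gt0.
have M0 : 0 <= M by rewrite (le_trans _ (aM 0%N)) // mulr_ge0 ?cabs_ge0.
have Mb0 : 0 <= Mb by rewrite (le_trans _ (HB 0%N)) // mulr_ge0 ?cabs_ge0.
exists (Ma * cabs t + 2 * (M * Mb)) => N.
have -> : s * t - \sum_(k < N) conv a b k =
    (s - \sum_(i < N) a i) * t + \sum_(i < N) a i * (t - \sum_(j < N - i) b j).
  have -> : \sum_(i < N) a i * (t - \sum_(j < N - i) b j) = (\sum_(i < N) a i) * t - \sum_(k < N) conv a b k.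
    by rewrite conv_sum mulr_suml -sumrB; apply: eq_bigr => i _; rewrite mulrBr.
  by ring.
have h1 : cabs ((s - \sum_(i < N) a i) * t) * 2 ^+ N <= Ma * cabs t.
  by rewrite cabsM mulrAC ler_wpM2r ?cabs_ge0.
have h2 : cabs (\sum_(i < N) a i * (t - \sum_(j < N - i) b j)) * 2 ^+ N <= 2 * (M * Mb).
  apply: le_trans (_ : (\sum_(i < N) cabs (a i * (t - \sum_(j < N - i) b j))) * 2 ^+ N <= _).
    by rewrite ler_wpM2r ?(ltW (p0 N)) // (cabs_sumr N (fun i => a i * (t - \sum_(j < N - i) b j))).
  rewrite mulr_suml.
  pose e i : R := cabs (a i) * 2 ^+ i * Mb.
  apply: le_trans (_ : \sum_(i < N) e i <= _); last first.
    apply: geo_sum; first exact: mulr_ge0.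
    move=> i; rewrite /e mulrAC ler_wpM2r // -mulrA -exprMn.
    by have -> : 2 * 2 = 4 :> R by ring; exact: aM.
  apply: ler_sum => i _; rewrite /e cabsM; have eN : (2 ^+ N : R) = 2 ^+ i * 2 ^+ (N - i) by rewrite -exprD subnKC // ltnW.
  have -> : cabs (a i) * cabs (t - \sum_(j < N - i) b j) * 2 ^+ N =
     cabs (a i) * 2 ^+ i * (cabs (t - \sum_(j < N - i) b j) * 2 ^+ (N - i)) by rewrite eN; ring.
  by rewrite ler_wpM2l // mulr_ge0 ?cabs_ge0 // ltW.
apply: le_trans (_ : (cabs ((s - \sum_(i < N) a i) * t) + cabs (\sum_(i < N) a i * (t - \sum_(j < N - i) b j))) * 2 ^+ N <= _).
  by rewrite ler_wpM2r ?(ltW (p0 N)) // cabsD.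
by rewrite mulrDl lerD.
Qed.

Definition taylor1 (x h : C) p : C := if p is q.+1 then (x + h) ^+ q.+1 - x ^+ q.+1 - q.+1%:R * h * x ^+ q else 0.
(** Induction on [p] through [T_(p+1) = (x + h) T_p + p h^2 x^(p-1)], where [T_p] is the
    second-order Taylor remainder of the [p]-th power. The factor [rho^2] on the left avoids
    negative powers. *)
Lemma taylor1_bound (x h : C) (rho : R) p : 0 <= rho -> cabs x <= rho -> cabs (x + h) <= rho ->
  cabs (taylor1 x h p) * rho ^+ 2 <= p%:R ^+ 2 * cabs h ^+ 2 * rho ^+ p.
Proof.
move=> r0 xr xhr.
have rp k : 0 <= rho ^+ k by exact: exprn_ge0.
have cX (y : C) k : cabs y <= rho -> cabs (y ^+ k) <= rho ^+ k.
  move=> yr; elim: k => [|k IH]; first by rewrite !expr0 -toC1 cabs_toC normr1.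
  by rewrite !exprS cabsM ler_pM ?cabs_ge0.
elim: p => [|p IH]; first by rewrite /= cabs0 mul0r expr0n !mul0r.
have E : taylor1 x h p.+1 = (x + h) * taylor1 x h p + p%:R * h ^+ 2 * (if p is q.+1 then x ^+ q else 0).
  case: p {IH} => [|p] /=; first by rewrite !expr1 expr0; ring.
  by rewrite !exprS; move: (x ^+ p) ((x + h) ^+ p) => a b; ring.
have b2 : cabs (if p is q.+1 then x ^+ q else 0) * (p%:R * rho ^+ 2) <= p%:R * rho ^+ p.+1.
  case: p {IH E} => [|p]; first by rewrite cabs0 !mul0r.
  rewrite mulrCA ler_wpM2l // (_ : rho ^+ p.+2 = rho ^+ p * rho ^+ 2); last by rewrite -exprD addn2.
  by rewrite ler_wpM2r ?cX.
rewrite E; apply: le_trans (_ : (cabs (x + h) * cabs (taylor1 x h p) + p%:R * cabs h ^+ 2 * cabs (if p is q.+1 then x ^+ q else 0)) * rho ^+ 2 <= _).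
  by rewrite ler_wpM2r // (le_trans (cabsD _ _)) // !cabsM cabs_nat [cabs h ^+ 2]expr2.
have b1 : cabs (x + h) * (cabs (taylor1 x h p) * rho ^+ 2) <= rho * (p%:R ^+ 2 * cabs h ^+ 2 * rho ^+ p).
  by rewrite ler_pM ?cabs_ge0 ?mulr_ge0 ?cabs_ge0.
have b3 := ler_wpM2l (exprn_ge0 2 (cabs_ge0 h)) b2.
have pos : 0 <= (p%:R + 1) * cabs h ^+ 2 * rho ^+ p.+1 by rewrite !mulr_ge0 ?addr_ge0 ?exprn_ge0 ?cabs_ge0.
move: b1 b3 pos; rewrite -natr1 !(exprS rho p).
move: (cabs (if p is q.+1 then x ^+ q else 0)) (cabs (taylor1 x h p)) (cabs (x + h)) (cabs h) (rho ^+ p) (p%:R : R) => w e y k s q b1 b3 pos.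
have -> : (y * e + q * k ^+ 2 * w) * rho ^+ 2 = y * (e * rho ^+ 2) + k ^+ 2 * (w * (q * rho ^+ 2)) by ring.
have -> : (q + 1) ^+ 2 * k ^+ 2 * (rho * s) = rho * (q ^+ 2 * k ^+ 2 * s) + k ^+ 2 * (q * (rho * s)) + (q + 1) * k ^+ 2 * (rho * s) by ring.
lra.
Qed.
Lemma sq_le_4exp p : (p%:R ^+ 2 : R) <= 4 ^+ p.
Proof.
have -> : (4 : R) = 2 ^+ 2 by ring.
rewrite exprAC lerXn2r ?nnegrE ?exprn_ge0 // -natrX ler_nat ltnW // ltn_expl //.
Qed.

(** For [rho = (8 K)^-1] the ratio [2 K rho] is [1 / 4]; it beats the factor [p^2 <= 4^p] of
    [taylor1_bound] and leaves the decay [2^-p] that [sums_le] wants. The constant [128 K^2] is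
    [2 / rho^2]. *)
Lemma pseries_deriv (f : nat -> C) (s s1 : C -> C) (M K : R) : 0 <= M -> 1 <= K ->
  (forall p, cabs (f p) <= M * K ^+ p) ->
  (forall x, cabs x <= (8 * K)^-1 -> sums (fun p => f p * x ^+ p) (s x)) ->
  (forall x, cabs x <= (8 * K)^-1 -> sums (fun p => f p.+1 *+ p.+1 * x ^+ p) (s1 x)) ->
  forall x h, cabs x <= (8 * K)^-1 -> cabs (x + h) <= (8 * K)^-1 ->
  cabs (s (x + h) - s x - h * s1 x) <= 128 * M * K ^+ 2 * cabs h ^+ 2.
Proof.
move=> M0 K1 fM hs hs1 x h xr xhr; set rho := (8 * K)^-1 in hs hs1 xr xhr.
have K0 : 0 < K by rewrite (lt_le_trans ltr01).
have rho0 : 0 < rho by rewrite invr_gt0 mulr_gt0.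
have E := sumsD (sumsD (hs _ xhr) (sumsN (hs _ xr))) (sumsN (sumsZ h (sums_shift (hs1 _ xr)))).
have E2 : sums (fun p => f p * taylor1 x h p) (s (x + h) - s x - h * s1 x).
  apply: eq_sums E => -[|p] /=; first by rewrite mulr0; ring.
  have -> : f p.+1 *+ p.+1 = f p.+1 * p.+1%:R by rewrite mulr_natr.
  move: (f p.+1) (x ^+ p.+1) (x ^+ p) ((x + h) ^+ p.+1) (p.+1%:R : C) => *; ring.
have -> : 128 * M * K ^+ 2 * cabs h ^+ 2 = 2 * (M * cabs h ^+ 2 / rho ^+ 2).
  by rewrite /rho; field; rewrite gt_eqF.
apply: (sums_le _ E2) => p; rewrite cabsM ler_pdivlMr ?exprn_gt0 //.
have T := taylor1_bound p (ltW rho0) xr xhr.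
have p20 : 0 <= (2 ^+ p : R) by rewrite exprn_ge0.
have -> : cabs (f p) * cabs (taylor1 x h p) * 2 ^+ p * rho ^+ 2 =
  cabs (f p) * ((cabs (taylor1 x h p) * rho ^+ 2) * 2 ^+ p) by ring.
apply: le_trans (_ : (M * K ^+ p) * (p%:R ^+ 2 * cabs h ^+ 2 * rho ^+ p * 2 ^+ p) <= _).
  apply: ler_pM; rewrite ?cabs_ge0 ?mulr_ge0 ?cabs_ge0 ?exprn_ge0 ?(ltW rho0) //.
  by rewrite ler_wpM2r.
have -> : M * K ^+ p * (p%:R ^+ 2 * cabs h ^+ 2 * rho ^+ p * 2 ^+ p) =
  M * cabs h ^+ 2 * (p%:R ^+ 2 * (K * rho * 2) ^+ p).
  by rewrite !exprMn; move: (K ^+ p) (rho ^+ p) (2 ^+ p) => *; ring.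
have -> : K * rho * 2 = 4^-1 by rewrite /rho; field; rewrite gt_eqF.
rewrite -[leRHS]mulr1 ler_wpM2l ?mulr_ge0 ?exprn_ge0 ?cabs_ge0 //.
by rewrite exprVn ler_pdivrMr ?exprn_gt0 // mul1r sq_le_4exp.
Qed.
End convergent_series.

(** * Summing the formal solution *)

Section isomonodromic_deformation.
Variables (R : realType).
Local Notation C := (Cplx R).

Lemma quad_diff (s s1 : C -> C) (r c : R) : 0 <= c ->
  (forall x h, cabs x <= r -> cabs (x + h) <= r -> cabs (s (x + h) - s x - h * s1 x) <= c * cabs h ^+ 2) ->
  forall x, cabs x < r -> differentiable s x /\ 'D_1 s x = s1 x.
Proof.
move=> c0 H x xr.
have linL : linear (fun h : C => h * s1 x) by move=> a u v; rewrite mulrDl -mulrA.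
have [] := @diff_intro _ _ _ s x (fun h : C => h * s1 x) `|s1 x| linL; last first.
- by move=> ds E; split=> //; rewrite E mul1r.
- move=> _ /gt0_toC[e e0 ->]; exists (toC (Num.min (r - cabs x) (e / (c + 1)))).
    by rewrite toC_gt0 lt_min subr_gt0 xr divr_gt0 // ltr_wpDl.
  move=> h; rewrite !normCE toC_lt lt_min => /andP[h1 h2]; rewrite -toCM toC_le (addrC h x).
  have xh : cabs (x + h) <= r by rewrite (le_trans (cabsD _ _)) // addrC -lerBrDr ltW.
  apply: le_trans (H x h (ltW xr) xh) _; rewrite expr2 mulrA ler_wpM2r ?cabs_ge0 //.
  have : cabs h * (c + 1) < e by rewrite -ltr_pdivlMr // ltr_wpDl.
  by have := cabs_ge0 h; rewrite mulrDr mulr1 mulrC => ? /ltW; apply: le_trans; rewrite lerDl.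
- by move=> h; rewrite normrM mulrC.
Qed.
Lemma comp_coord (W : normedModType C) (g : C -> W) (y : 'rV[C]_1) : differentiable g (y 0 0) ->
  differentiable (fun y : 'rV[C]_1 => g (y 0 0)) y /\
  forall h, 'D_h (fun y : 'rV[C]_1 => g (y 0 0)) y = h 0 0 *: 'D_1 g (y 0 0).
Proof.
move=> dg; pose co (y : 'rV[C]_1) := y 0 0 : C.
have dco : differentiable co y by exact: differentiable_coord.
have dc : differentiable (g \o co) y by exact: differentiable_comp.
split; [exact dc|move=> h].
have Eco : 'd co y h = h 0 0.
  rewrite -(deriveE h dco); refine (eq_trans (derive_entry h 0 0 (ex_diff (f := id))) _).
  by have -> : 'D_h (id : 'rV[C]_1 -> 'rV[C]_1) y = h by exact: derive_id.
have E : 'D_h (g \o co) y = 'd g (co y) ('d co y h).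
  rewrite deriveE //; have H := @diff_comp _ _ _ _ co g y dco dg.
  exact (congr1 (fun f => f h) H).
refine (eq_trans E _); rewrite Eco (deriveE (1 : C) dg) -[in LHS](mulr1 (h 0 0)).
have L : 'd g (co y) (h 0 0 *: (1 : C)) = h 0 0 *: 'd g (co y) (1 : C) by rewrite linearZ.
exact L.
Qed.
Lemma star_connected (V : normedModType C) (U : set V) : U 0 ->
  (forall (t : R) y, 0 <= t <= 1 -> U y -> U (toC t *: y)) -> connected U.
Proof.
move=> U0 Ust.
have -> : U = \bigcup_(y in U) [set toC t *: y | t in `[0%R, 1%R]].
  apply/seteqP; split=> [y Uy|_ [y Uy [t t01 <-]]].
    by exists y => //; exists 1; rewrite /= ?in_itv /= ?ler01 ?lexx // toC1 scale1r.
  by apply: Ust => //; move: t01; rewrite /= in_itv.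
apply: bigcup_connected.
  by exists 0 => y _; exists 0; rewrite /= ?in_itv /= ?ler01 ?lexx // toC0 scale0r.
move=> y _; apply: connected_continuous_connected; first exact: segment_connected.
apply: continuous_subspaceT => t.
have h1 : continuous_at t (fun t : R => toC t) by exact: toC_cont.
exact: ctZ h1 (@ct_cst _ _ _ _ _).
Qed.

Section psum.
Variable n : nat.
Local Notation M := 'M[C]_n.+1.
Definition psum (S : nat -> M) (x : C) (X : M) := forall k l, sums (fun p => S p k l * x ^+ p) (X k l).
Lemma eq_psum S T x X : S =1 T -> psum S x X -> psum T x X.
Proof. by move=> /funext ->. Qed.
Lemma psum_uniq S x X Y : psum S x X -> psum S x Y -> X = Y.
Proof. by move=> h1 h2; apply/matrixP => k l; exact: sums_uniq (h1 k l) (h2 k l). Qed.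
Lemma psumD S T x X Y : psum S x X -> psum T x Y -> psum (fun p => S p + T p) x (X + Y).
Proof.
move=> h1 h2 k l; rewrite mxE; apply: eq_sums (sumsD (h1 k l) (h2 k l)) => p.
by rewrite mxE mulrDl.
Qed.
Lemma psumN S x X : psum S x X -> psum (fun p => - S p) x (- X).
Proof.
by move=> h1 k l; rewrite mxE; apply: eq_sums (sumsN (h1 k l)) => p; rewrite mxE mulNr.
Qed.
Lemma psum_mull (D : M) S x X : psum S x X -> psum (fun p => D *m S p) x (D *m X).
Proof.
move=> h k l; rewrite mxE; apply: eq_sums (sums_sum (fun m => sumsZ (D k m) (h m l))) => p.
by rewrite mxE mulr_suml; apply: eq_bigr => m _; rewrite mulrA.
Qed.
Lemma psum_mulr (D : M) S x X : psum S x X -> psum (fun p => S p *m D) x (X *m D).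
Proof.
move=> h k l; rewrite mxE (eq_bigr _ (fun m _ => mulrC (X k m) (D m l))).
apply: eq_sums (sums_sum (fun m => sumsZ (D m l) (h k m))) => p.
by rewrite mxE mulr_suml; apply: eq_bigr => m _; rewrite mulrA (mulrC (D m l)).
Qed.
Lemma psum_shift S x X : psum S x X -> psum (shiftf S) x (x *: X).
Proof.
move=> h k l; rewrite mxE; apply: eq_sums (sumsZ x (sums_shift (h k l))) => -[|p] /=.
  by rewrite mxE mulr0 mul0r.
by rewrite exprS; ring.
Qed.
Lemma psum_const (D : M) x : psum (fun p => if p is 0 then D else 0) x D.
Proof.
move=> k l; apply: eq_sums (sums_const (D k l)) => -[|p] /=; first by rewrite expr0 mulr1.
by rewrite mxE mul0r.
Qed.
Lemma psum_mul (S T : nat -> M) x X Y (c : R) : (forall p k l, cabs (S p k l * x ^+ p) * 4 ^+ p <= c) ->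
  psum S x X -> psum T x Y -> psum (fmul S T) x (X *m Y).
Proof.
move=> Sc hX hY k l; rewrite mxE.
apply: eq_sums (sums_sum (fun m => sumsM (fun p => Sc p k m) (hX k m) (hY m l))) => p.
rewrite /fmul summxE mulr_suml /conv exchange_big; apply: eq_bigr => q _ /=.
rewrite mxE mulr_suml; apply: eq_bigr => m _.
have -> : x ^+ p = x ^+ q * x ^+ (p - q) by rewrite -exprD subnKC // -ltnS.
by move: (S q k m) (T (p - q)%N m l) (x ^+ q) (x ^+ (p - q)) => *; ring.
Qed.
End psum.

(** Since [4 K (8 K)^-1 = 1 / 2]; this supplies the [4^-p] decay that [sumsM] asks of one factor. *)
Lemma geo_term (f : nat -> C) (N K : R) (x : C) p : 0 <= N -> 1 <= K -> (forall p, cabs (f p) <= N * K ^+ p) ->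
  cabs x <= (8 * K)^-1 -> cabs (f p * x ^+ p) * 4 ^+ p <= N.
Proof.
move=> N0 K1 fN xr; have K0 : 0 < K by rewrite (lt_le_trans ltr01).
have cX : cabs (x ^+ p) <= (8 * K)^-1 ^+ p.
  elim: p => [|p IH]; first by rewrite !expr0 -toC1 cabs_toC normr1.
  by rewrite !exprS cabsM ler_pM ?cabs_ge0.
rewrite cabsM; apply: le_trans (_ : N * K ^+ p * (8 * K)^-1 ^+ p * 4 ^+ p <= _).
  by rewrite ler_wpM2r ?exprn_ge0 // ler_pM ?cabs_ge0.
have -> : N * K ^+ p * (8 * K)^-1 ^+ p * 4 ^+ p = N * (K * (8 * K)^-1 * 4) ^+ p.
  by move: (8 * K)^-1 => i; rewrite !exprMn !mulrA.
have -> : K * (8 * K)^-1 * 4 = 2^-1 by field; rewrite gt_eqF.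
by rewrite ler_piMr // exprVn invf_le1 ?exprn_gt0 // exprn_ege1 // ler1n.
Qed.

(** Derivative of [g L gi] for [g' = g T] and [L' = W]: the commutator [[T, L]] becomes [[W, b]],
    which conjugates to the term with [B] of the structure equation. *)
Lemma nc_conj_derive (A : pzRingType) (g gi W L T b B dA : A) : gi * g = 1 -> g * gi = 1 ->
  B * g = g * b -> T * L - L * T = W * b - b * W ->
  dA = (g * T * L + g * W) * gi + g * L * - (gi * (g * T) * gi) ->
  dA = g * W * gi + (g * W * gi * B - B * (g * W * gi)).
Proof.
move=> h1 h2 e1 e2 ->.
have k x : gi * (g * x) = x by rewrite mulrA h1 mul1r.
have -> : B = g * (b * gi) by rewrite mulrA -e1 -mulrA h2 mulr1.
transitivity (g * (T * L - L * T + W) * gi).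
  rewrite !mulrDr !mulrDl mulrN mulrN mulNr -!mulrA k.
  by rewrite addrAC.
by rewrite e2 !mulrDr !mulrDl mulrN mulNr -!mulrA !k addrC.
Qed.

Lemma nc_conj_comm (A : pzRingType) (g gi L W : A) : gi * g = 1 -> L * W = W * L ->
  (g * L * gi) * (g * W * gi) = (g * W * gi) * (g * L * gi).
Proof.
move=> h LW; have k x : gi * (g * x) = x by rewrite mulrA h mul1r.
by rewrite -!mulrA !k (mulrA L) (mulrA W) LW.
Qed.

Section local_solution.
Variable n : nat.
Local Notation M := 'M[C]_n.+1.
Variables (Ao Bo P : M) (u v : 'rV[C]_n.+1).
Hypotheses (uP : P \in unitmx) (PA : invmx P *m Ao *m P = diag_mx u).
Let B := invmx P *m Bo *m P.
Hypothesis star : forall i j, i != j -> u 0 i = u 0 j -> B i j = 0.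
Hypothesis dstar : forall i j, u 0 i = u 0 j -> forall m : int, B i i - B j j = m%:~R -> m = 0.

(** The last two conclusions are what [nc_conj_derive] needs about the frame [G]: its derivative and
    the shape of [G^-1 Bo G]. *)
Lemma local_frame : exists (r : R) (G F : C -> M),
  [/\ 0 < r, G 0 = P & forall z, cabs z < r ->
    [/\ differentiable G z, G z \in unitmx,
        'D_1 G z = G z *m (diag_mx v *m F z - F z *m diag_mx v)
      & Bo *m G z = G z *m (diag_mx (\row_k B k k) + (F z *m diag_mx u - diag_mx u *m F z) -
          z *: (diag_mx v *m F z - F z *m diag_mx v))]].
Proof.
have [Fs [F0 Fz Fnc Fc]] := isoF u v B.
have [N [K [N1 K1 FB]]] := isoF_bound dstar F0 Fz Fnc Fc.
have N0 : 0 <= N by rewrite (le_trans ler01).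
have K0 : 0 <= K by rewrite (le_trans ler01).
have [Gs [Gs0 GsS]] := isoG v Fs P.
have [g g1 gP] := finite_bound (fun t : 'I_n.+1 * 'I_n.+1 => cabs (v 0 t.1 - v 0 t.2)).
have g0 : 0 <= g by rewrite (le_trans ler01).
have TB p k l : cabs (thf v Fs p k l) <= g * N * K ^+ p.
  by rewrite thfE cabsM -mulrA ler_pM ?cabs_ge0 //; exact: (gP (k, l)).
have [N' [K' [N'1 K'1 GB]]] := fmul_ode_bound (mulr_ge0 g0 N0) K0 GsS TB.
have N'0 : 0 <= N' by rewrite (le_trans ler01).
(* A common growth rate for [F] and [G]; [(8 L)^-1] is the radius that [geo_term] and
   [pseries_deriv] expect. *)
pose L := K + K'.
have L1 : 1 <= L by rewrite (le_trans K1) // lerDl (le_trans ler01).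
have FB' p k l : cabs (Fs p k l) <= N * L ^+ p.
  rewrite (le_trans (FB p k l)) // ler_wpM2l // lerXn2r ?nnegrE ?addr_ge0 ?(le_trans ler01 K'1) //.
  by rewrite lerDl (le_trans ler01).
have GB' p k l : cabs (Gs p k l) <= N' * L ^+ p.
  rewrite (le_trans (GB p k l)) // ler_wpM2l // lerXn2r ?nnegrE ?addr_ge0 ?(le_trans ler01 K'1) //.
  by rewrite lerDr.
pose r := (8 * L)^-1.
have L0 : 0 < L by rewrite (lt_le_trans ltr01).
have r0 : 0 < r by rewrite invr_gt0 mulr_gt0.
(* Beyond radius [r] the value 0 is a placeholder. *)
have Ex (S : nat -> M) (N2 : R) z : 0 <= N2 -> (forall p k l, cabs (S p k l) <= N2 * L ^+ p) -> exists X : M, cabs z <= r -> psum S z X.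
  move=> N20 SB; have [zr|zr] := leP (cabs z) r; last by exists 0.
  have H k l : exists s, sums (fun p => S p k l * z ^+ p) s.
    apply: (@sums_ex _ _ N2) => p.
    apply: le_trans (geo_term p N20 L1 (fun p => SB p k l) zr).
    by rewrite ler_wpM2l ?cabs_ge0 // lerXn2r // ?nnegrE // ler_nat.
  by exists (\matrix_(k, l) sval (cid (H k l))) => _ k l; rewrite mxE; exact: svalP (cid (H k l)).
pose F z := sval (cid (Ex Fs N z N0 FB')); have FP z : cabs z <= r -> psum Fs z (F z) := svalP (cid (Ex Fs N z N0 FB')).
pose G z := sval (cid (Ex Gs N' z N'0 GB')); have GP z : cabs z <= r -> psum Gs z (G z) := svalP (cid (Ex Gs N' z N'0 GB')).
pose T z := diag_mx v *m F z - F z *m diag_mx v.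
have TP z : cabs z <= r -> psum (thf v Fs) z (T z).
  by move=> /FP h; apply: psumD; [exact: psum_mull|apply: psumN; exact: psum_mulr].
have GT z : cabs z <= r -> psum (fmul Gs (thf v Fs)) z (G z *m T z).
  move=> zr; apply: (@psum_mul _ _ _ _ _ _ N') (GP _ zr) (TP _ zr) => p k l.
  exact: (geo_term p N'0 L1 (fun p => GB' p k l) zr).
have dG z : cabs z < r -> differentiable G z /\ 'D_1 G z = G z *m T z.
  move=> zr; have He k l : differentiable (fun z => G z k l) z /\ 'D_1 (fun z => G z k l) z = (G z *m T z) k l.
    apply: (@quad_diff (fun z => G z k l) (fun z => (G z *m T z) k l) r (128 * N' * L ^+ 2) _ _ z zr).
      apply: mulr_ge0; first exact: (mulr_ge0 (ler0n _ _) N'0).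
      exact: (exprn_ge0 2 (ltW L0)).
    move=> x h xr xhr; apply: (@pseries_deriv _ (fun p => Gs p k l) (fun z => G z k l) (fun z => (G z *m T z) k l) N' L N'0 L1 (fun p => GB' p k l) _ _ x h xr xhr).
      by move=> y yr; exact: GP.
    move=> y yr; apply: eq_sums (GT y yr k l) => p; congr (_ * _).
    by rewrite GsS mxE -[RHS]mulr_natl mulrA divff ?mul1r // pnatr_eq0.
  have dGz : differentiable G z by apply: diff_mx => k l; have [] := He k l.
  split=> //; apply/matrixP => k l; rewrite -(derive_entry (1 : C) k l dGz); by have [] := He k l.
have G0 : G 0 = P.
  have h0 : cabs (0 : C) <= r by rewrite cabs0 ltW.
  apply: (psum_uniq (GP _ h0)) => k l; apply: eq_sums (sums_const (P k l)) => -[|p] /=.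
    by rewrite Gs0 expr0 mulr1.
  by rewrite exprS mul0r mulr0.
have BP z : cabs z <= r -> psum (calB u v B Fs) z
    (diag_mx (\row_k B k k) + (F z *m diag_mx u - diag_mx u *m F z) - z *: T z).
  move=> zr; apply: psumD; last by apply: psumN; apply: psum_shift; exact: TP.
  apply: psumD; first exact: psum_const.
  by apply: psumD; [apply: psum_mulr; exact: FP|apply: psumN; apply: psum_mull; exact: FP].
have conj p : Bo *m Gs p = fmul Gs (calB u v B Fs) p.
  apply: (isoG_conj star dstar F0 Fz Fnc Fc GsS); by rewrite Gs0 /B !mulmxA mulmxV // mul1mx.
have BG z : cabs z <= r -> Bo *m G z = G z *m
    (diag_mx (\row_k B k k) + (F z *m diag_mx u - diag_mx u *m F z) - z *: T z).
  move=> zr; apply: psum_uniq (psum_mull Bo (GP _ zr)) _.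
  apply: eq_psum (fun p => esym (conj p)) _.
  apply: (@psum_mul _ _ _ _ _ _ N') (GP _ zr) (BP _ zr) => p k l.
  exact: (geo_term p N'0 L1 (fun p => GB' p k l) zr).
have dG0 : differentiable G 0 by have [] := dG 0; rewrite ?cabs0.
have uG0 : G 0 \in unitmx by rewrite G0.
have [d d0 dP] := near_unit dG0 uG0.
(* [d] is the radius around 0 within which [G], equal to [P] at 0, stays invertible. *)
exists (Num.min r d), G, F; split; [by rewrite lt_min r0 d0|exact: G0|].
move=> z; rewrite lt_min => /andP[zr zd]; have [dz Ez] := dG z zr; split.
- exact: dz.
- by apply: dP; rewrite subr0 nrmC.
- exact: Ez.
- exact: BG (ltW zr).
Qed.

Theorem generic_nonempty : (forall i j, v 0 i = v 0 j -> i = j) -> generic_dtype Ao Bo !=set0.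
Proof.
move=> vinj; have [r [G [F [r0 G0 H]]]] := local_frame.
pose X := [set y : 'rV[C]_1 | cabs (y 0 0) < r].
have oX : open X.
  have -> : X = (fun y : 'rV[C]_1 => y 0 0 : C) @^-1` [set z | nrm (z - 0) < r].
    by apply/seteqP; split=> y; rewrite /X /= subr0 nrmC.
  apply: open_comp; last exact: nrm_open.
  by move=> y _; apply: differentiable_continuous; exact: differentiable_coord.
have X0 : X 0 by rewrite /X /= mxE cabs0.
have cX : connected X.
  apply: star_connected => // t y /andP[t0 t1]; rewrite /X /= mxE cabsM cabs_toC ger0_norm // => yr.
  by rewrite (le_lt_trans _ yr) // ler_piMl ?cabs_ge0.
(* One parameter: [y] is a row with one entry [x], and the eigenvalues are [u_k + x v_k]. *)
pose f (y : 'rV[C]_1) : 'rV[C]_n.+1 := u + y *m v.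
pose Gv (y : 'rV[C]_1) := G (y 0 0).
have df y : differentiable f y /\ forall h, 'D_h f y = h *m v.
  have d1 : differentiable (fun y : 'rV[C]_1 => y *m v) y by apply: diff_mul; [exact: ex_diff|exact: differentiable_cst].
  have dc : differentiable (cst u : 'rV[C]_1 -> 'rV[C]_n.+1) y by exact: differentiable_cst.
  split=> [|h]; first exact: differentiableD dc d1.
  refine (eq_trans (deriveD (diff_derv h dc) (diff_derv h d1)) _).
  have e1 : 'D_h (cst u : 'rV[C]_1 -> 'rV[C]_n.+1) y = 0 by exact: derive_cst.
  have e2 : 'D_h (fun y : 'rV[C]_1 => y *m v) y = h *m v.
    have dc2 : differentiable (cst v : 'rV[C]_1 -> 'rV[C]_n.+1) y by exact: differentiable_cst.
    refine (eq_trans (derive_mul h (ex_diff (f := id)) dc2) _).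
    have -> : 'D_h (cst v : 'rV[C]_1 -> 'rV[C]_n.+1) y = 0 by exact: derive_cst.
    have -> : 'D_h (fun y : 'rV[C]_1 => y) y = h by exact: derive_id.
    by rewrite mulmx0 addr0.
  exact (eq_trans (congr2 +%R e1 e2) (add0r _)).
have dG y : X y -> differentiable Gv y /\ forall h, 'D_h Gv y = h 0 0 *: (G (y 0 0) *m (diag_mx v *m F (y 0 0) - F (y 0 0) *m diag_mx v)).
  move=> /H [dz _ E _]; have [d1 E1] := comp_coord dz; split; first exact: d1.
  move=> h; refine (eq_trans (E1 h) (congr1 (fun z => h 0 0 *: z) E)).
have uG y : X y -> Gv y \in unitmx by move=> /H [].
pose A y := Gv y *m diag_mx (f y) *m invmx (Gv y).
pose Cf y := Gv y *m diag_mx v *m invmx (Gv y).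
have hA : holomorphic_on X A.
  move=> y Xy; have [d1 _] := dG y Xy; have [d2 _] := df y.
  by apply: diff_mul; [apply: diff_mul => //; exact: diff_diag|apply: diff_inv => //; exact: uG].
have hC : holomorphic_on X Cf.
  move=> y Xy; have [d1 _] := dG y Xy; apply: diff_mul; last by apply: diff_inv => //; exact: uG.
  by apply: diff_mul => //; exact: differentiable_cst.
have A0 : A 0 = Ao.
  rewrite /A /Gv mxE G0 /f mul0mx addr0 -PA !mulmxA mulmxV // mul1mx -mulmxA mulmxV // mulmx1 //.
have AC y : X y -> A y *m Cf y = Cf y *m A y.
  by move=> /uG uy; exact: (@nc_conj_comm M _ _ _ _ (mulVmx uy) (diag_mxC (f y) v)).
have dA y : X y -> 'D_(delta_mx 0 0) A y = Cf y + (Cf y *m Bo - Bo *m Cf y).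
  move=> Xy; have [d1 E1] := dG y Xy; have [d2 E2] := df y; have uy := uG y Xy.
  have [_ _ _ HB] := H _ Xy; have d3 := diff_inv d1 uy; have d4 := diff_diag d2.
  have Ef : 'D_(delta_mx 0 0) (fun y => diag_mx (f y)) y = diag_mx v.
    refine (eq_trans (derive_diag _ d2) (congr1 _ (eq_trans (E2 _) _))).
    by apply/rowP => i; rewrite mxE big_ord1 mxE eqxx mul1r.
  have EG : 'D_(delta_mx 0 0) Gv y = Gv y *m (diag_mx v *m F (y 0 0) - F (y 0 0) *m diag_mx v).
    by refine (eq_trans (E1 _) _); rewrite mxE !eqxx scale1r.
  have ED := eq_trans (derive_mul (delta_mx 0 0) (diff_mul d1 d4) d3)
    (congr2 (fun a b => a *m invmx (Gv y) + (Gv y *m diag_mx (f y)) *m b)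
      (eq_trans (derive_mul (delta_mx 0 0) d1 d4) (congr2 (fun a b => a *m diag_mx (f y) + Gv y *m b) EG Ef))
      (eq_trans (derive_inv (delta_mx 0 0) d1 uy) (congr1 (fun a => - (invmx (Gv y) *m a *m invmx (Gv y))) EG))).
  refine (@nc_conj_derive M (Gv y) (invmx (Gv y)) (diag_mx v) (diag_mx (f y)) _ _ Bo _ (mulVmx uy) (mulmxV uy) HB _ ED).
  (* Off the diagonal [b + [F, U] - x [V, F]] has entries [F_kl (f_l - f_k)], so both commutators
     are [(v_k - v_l) F_kl (f_l - f_k)]. *)
  apply/matrixP => k l.
  refine (eq_trans (entry_comm_diag (f y) _ k l) (eq_trans _ (esym (entry_diag_comm v _ k l)))).
  have gen (D X2 X3 : M) a : (D + X2 - a *: X3) k l = D k l + X2 k l - a * X3 k l by rewrite !mxE.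
  rewrite gen entry_comm_diag !(entry_diag_comm v (F _) k l).
  rewrite [(diag_mx _) k l]mxE !mxE !big_ord1.
  have [->|kl] := eqVneq k l; first by rewrite !subrr !mul0r.
  by rewrite mulr0n; move: (y 0 0) (F _ k l) => *; ring.
have I1 (i : 'I_1) : i = 0 by exact: ord1.
pose E := @nf_def R n 1 Ao Bo X 0 A (fun _ => Cf) oX cX X0 hA (fun _ => hC) A0
  (fun y _ Xy => AC y Xy) (fun y i Xy => eq_ind_r (fun i => 'D_(delta_mx 0 i) A y = _) (dA y Xy) (I1 i)) (fun _ _ _ _ => erefl)
  (fun y i j _ => congr1 (fun k => 'D_(delta_mx 0 k) Cf y) (eq_trans (I1 i) (esym (I1 j)))).
exists E, X, A, (fun _ => Cf); split; first exact: nf_def_normal.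
have hG : holomorphic_on X Gv by move=> y /dG [].
split.
  exists (fun _ _ => v), X, Gv; split; first by split.
  move=> i; split; first by move=> y _; exact: differentiable_cst.
  by move=> y /uG uy; rewrite /Cf !mulmxA mulVmx // mul1mx -mulmxA mulVmx // mulmx1.
exists f; split.
  exists X, Gv; split; first by split.
  move=> _; split; first by move=> y _; have [] := df y.
  by move=> y /uG uy; rewrite /A !mulmxA mulVmx // mul1mx -mulmxA mulVmx // mulmx1.
move=> i j ij /(_ (delta_mx 0 0)).
have [d0 E0] := df 0; have di := diff_entry 0 i d0; have dj := diff_entry 0 j d0.
move=> h; have h1 := eq_trans (deriveE (delta_mx 0 0) di) (eq_trans h (esym (deriveE (delta_mx 0 0) dj))).
have h2 := eq_trans (esym (derive_entry (delta_mx 0 0) 0 i d0)) (eq_trans h1 (derive_entry (delta_mx 0 0) 0 j d0)).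
move: h2; rewrite E0 !mxE !big_ord1 !mxE !mul1r => /vinj e; by rewrite e eqxx in ij.
Qed.
End local_solution.
End isomonodromic_deformation.

(** For matrices of size one, genericity puts no condition on differentials and the two classes
    coincide; hence the size condition on the strict inclusion. *)
Theorem theorem4p24 (R : realType) (n : nat) (Ao Bo : 'M[Cplx R]_n.+1) :
  (regular_mx Ao /\ diagonalizable Ao) \/ (diagonalizable Ao /\ PNR Ao Bo) ->
  [/\ generic_dtype Ao Bo !=set0,
      generic_dtype Ao Bo `<=` fs_type Ao Bo
    & (1 < n.+1)%N -> generic_dtype Ao Bo `<` fs_type Ao Bo].
Proof.
move=> H; have pnr : PNR Ao Bo by case: H => [[reg dg]|[_ //]]; exact: regular_PNR.
have sub := @generic_fs R n Ao Bo.
split=> // [|n1].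
  have [P [u [uP PA star dstar]]] := pnr.
  (* Any distinct [v_k] would do; [0, 1, 2, ...] are distinct in characteristic zero. *)
  apply: (generic_nonempty uP PA star dstar (v := \row_k (k : nat)%:R)) => i j.
  by rewrite !mxE => /eqP; rewrite eqr_nat => /eqP /val_inj.
split=> // sup; exact: (@point_not_generic R n Ao Bo n1) (sup _ (point_fs pnr)).
Qed.
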